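(* Let $\Omega\subset\mathbb{R}^n$ be a bounded domain, let $1<p<\infty$, and let $w\le\tau$ be a pair of $p$-admissible weights in $\Omega$. Let $Q$ be a measurable function on $\Omega$ with values in the non-negative definite symmetric $n\times n$ matrices satisfying $$w(x)|\xi|^p\le\big|\sqrt{Q(x)}\,\xi\big|^p\le\tau(x)|\xi|^p\qquad\text{for a.e. }x\in\Omega\text{ and all }\xi\in\mathbb{R}^n.$$ Then there is $q>p$ such that for every $1\le r<q$: (a) for every open $E\Subset\Omega$, $QH^{1,p}_0(\tau,dx;E)$ is compactly embedded in $L^r_\tau(E)$ through $(u,\nabla u)\mapsto u$; (b) for every $E\Subset\Omega$, $QH^{1,p}(\tau,dx;\Omega)$ is compactly embedded in $L^r_\tau(E)$ through $(u,\nabla u)\mapsto u|_E$. Here a normed space $X$ is compactly embedded in a normed space $Y$ through a map $\pi:X\to Y$ if for every bounded sequence in $X$ the image sequence under $\pi$ has a subsequence converging in $Y$ (in particular the indicated map takes values in $Y$).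
   Context: A domain is an open connected set. $E\Subset\Omega$ means that the closure of $E$ is a compact subset of $\Omega$ (sets $E$ are measurable). $\sqrt{Q(x)}$ is the non-negative definite square root of $Q(x)$. A weight on $\Omega$ is a nonnegative locally integrable function. $L^r_\tau(E)$ has norm $(\int_E|f|^r\tau\,dx)^{1/r}$. Euclidean balls: $D(x_0,r)=\{x\in\Omega:|x-x_0|<r\}$ for $x_0\in\Omega$, $r>0$; for a weight $\nu$, $\nu(D)=\int_D\nu\,dx$; $|D|$ is Lebesgue measure. $p$-admissible weights: two weights $w\le\tau$ on $\Omega$ are called $p$-admissible in $\Omega$ ($p>1$) if: 1. $\tau$ is doubling: there is a constant $C$ such that $\tau(D(x,2r))\le C\,\tau(D(x,r))$ for all $x\in\Omega$, $r>0$; 2. $w\in A_p(\Omega)$, i.e. $w$ is a nonnegative function in $L^1_{\mathrm{loc}}(\Omega)$ with $$\sup_D\Big(\frac1{|D|}\int_Dw\,dz\Big)\Big(\frac1{|D|}\int_Dw^{\frac1{1-p}}\,dz\Big)^{p-1}<\infty,$$ the supremum being over all Euclidean balls $D=D(x_0,r)$ centered in $\Omega$; 3. (Chanillo--Wheeden balance condition) there are $C>0$ and $q>p$ such that for all $0<s\le r$ and $x\in\Omega$, $$\frac sr\Big(\frac{\tau(D(x,s))}{\tau(D(x,r))}\Big)^{1/q}\le C\Big(\frac{w(D(x,s))}{w(D(x,r))}\Big)^{1/p}.$$ Sobolev spaces. For an open set $G\subset\Omega$ and a locally Lipschitz $f$ on $G$ let $$\|f\|_{QH^{1,p}(\tau,dx;G)}=\Big(\int_G|f|^p\tau\,dx\Big)^{1/p}+\Big(\int_G|\sqrt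 Q\,\nabla f|^p\,dx\Big)^{1/p}.$$ $Lip_0(G)$ is the set of locally Lipschitz functions with compact support in $G$; $Lip_Q(G)$ is the set of locally Lipschitz functions on $G$ for which this norm is finite. $QH^{1,p}(\tau,dx;G)$ (respectively $QH^{1,p}_0(\tau,dx;G)$) is the completion of $Lip_Q(G)$ (respectively $Lip_0(G)$) with respect to this norm, identified with the closure of the set of pairs $(f,\nabla f)$, with $f$ in $Lip_Q(G)$ (respectively $Lip_0(G)$), in $L^p_\tau(G)\times\mathcal L^p_Q(G)$, where $\mathcal L^p_Q(G)$ is the space of measurable vector fields $\vec k$ on $G$ with $(\int_G|\sqrt Q\,\vec k|^p\,dx)^{1/p}<\infty$ (modulo fields of zero norm). Elements are written as pairs $(u,\nabla u)$, where the second component $\nabla u$ denotes the $\mathcal L^p_Q$-limit of gradients of an approximating sequence. *)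

(* Defs.v *)
From HB Require Import structures.
From mathcomp Require Import all_boot all_order all_algebra.
From mathcomp Require Import all_classical all_reals all_analysis.

Set Implicit Arguments.
Unset Strict Implicit.
Unset Printing Implicit Defensive.

Import Order.TTheory GRing.Theory Num.Theory.
Import numFieldNormedType.Exports.

Local Open Scope classical_set_scope.
Local Open Scope ring_scope.

(* Points, gradients and vector fields are row vectors, and a dimension n.+1
   is used throughout so that R^0 is excluded.  The topology on 'rV[R]_n.+1 is
   the usual one, but the library norm `|v| is the sup norm; the Euclidean norm
   is enorm. *)

Section lebesgue_outer_measure.
Context (R : realType) (n : nat).
Local Notation V := 'rV[R]_n.+1.

Definition box (a b : V) : set V :=
  [set x | forall i, a ord0 i <= x ord0 i < b ord0 i].

Definition box_vol (a b : V) : R :=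
  \prod_(i < n.+1) Num.max 0 (b ord0 i - a ord0 i).

Definition box_cover (X : set V) : set ((V * V)^nat) :=
  [set F | X `<=` \bigcup_k box (F k).1 (F k).2].

Local Open Scope ereal_scope.

Definition lebesgue_outer (X : set V) : \bar R :=
  ereal_inf [set \sum_(k <oo) (box_vol (F k).1 (F k).2)%:E | F in box_cover X].

Lemma box_vol_ge0 a b : 0 <= (box_vol a b)%:E.
Proof. by rewrite lee_fin prodr_ge0// => i _; rewrite le_max lexx. Qed.

Lemma lebesgue_outer_ge0 X : 0 <= lebesgue_outer X.
Proof.
apply: le_ereal_inf_tmp => _ [F _ <-].
by apply: nneseries_ge0 => k _ _; exact: box_vol_ge0.
Qed.

Lemma lebesgue_outer0 : lebesgue_outer set0 = 0.
Proof.
apply/eqP; rewrite eq_le lebesgue_outer_ge0 andbT.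
apply: ereal_inf_lbound; exists (fun=> (0, 0)%R); first by [].
apply: eseries0 => k _ _ /=.
by rewrite /box_vol big_ord_recl !mxE subrr maxxx mul0r.
Qed.

Lemma le_lebesgue_outer :
  {homo lebesgue_outer : A B / A `<=` B >-> A <= B}.
Proof.
move=> A B AB; apply: ereal_inf_le_tmp => _ [F BF <-].
by exists F => //; exact: subset_trans BF.
Qed.

Lemma lebesgue_outer_sigma_subadditive : sigma_subadditive lebesgue_outer.
Proof.
move=> A; have [[i ioo]|] := pselect (exists i, lebesgue_outer (A i) = +oo).
  rewrite (eseries_pinfty _ _ ioo) ?leey// => k _.
  by rewrite -ltNye (lt_le_trans _ (lebesgue_outer_ge0 _)).
rewrite -forallNE => Aoo.
pose vol (F : V * V) := (box_vol F.1 F.2)%:E.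
have vol_ge0 F : 0 <= vol F by exact: box_vol_ge0.
suff add2e (e : {posnum R}) : lebesgue_outer (\bigcup_k A k) <=
    \sum_(i <oo) lebesgue_outer (A i) + e%:num%:E.
  by apply/lee_addgt0Pr => _/posnumP[].
rewrite (le_trans _ (epsilon_trick _ _ _))//; last first.
  by move=> k; exact: lebesgue_outer_ge0.
pose P k (B : (V * V)^nat) := box_cover (A k) B /\
  \sum_(j <oo) vol (B j) <=
  lebesgue_outer (A k) + (e%:num / (2 ^ k.+1)%:R)%:E.
have [G PG] : {G : nat -> (V * V)^nat & forall k, P k (G k)}.
  apply: (@choice _ _ P) => k; rewrite /P.
  have fin : lebesgue_outer (A k) \is a fin_num.
    by rewrite ge0_fin_numE ?lebesgue_outer_ge0// ltey; apply/eqP; exact: Aoo.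
  have ek0 : (0 < e%:num / (2 ^ k.+1)%:R)%R by [].
  have [_ [B AB <-] Bx] := lb_ereal_inf_adherent ek0 fin.
  by exists B; split => //; exact: ltW.
apply: (@le_trans _ _ (\esum_(i in setT) (vol \o uncurry G) i)).
  apply: ereal_inf_lbound.
  have /card_esym/ppcard_eqP[f] := card_nat2.
  exists (uncurry G \o f).
    move=> t [i _ /(PG i).1 [j _ Gijt]]; exists (f^-1%FUN (i, j)) => //=.
    by rewrite invK ?inE.
  rewrite -(esum_pred_image (vol \o uncurry G) _ xpredT) ?[fun=> _]set_true//.
    by rewrite image_eq.
  by move=> k _; exact: vol_ge0.
rewrite (_ : esum _ _ = \sum_(i <oo) \sum_(j <oo) vol (G i j)); last first.
  pose J : nat -> set (nat * nat) := fun i => [set (i, j) | j in setT].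
  rewrite (_ : setT = \bigcup_k J k); last first.
    by rewrite predeqE => -[a b]; split => // _; exists a => //; exists b.
  rewrite esum_bigcupT /=; last 2 first.
    - apply/trivIsetP => i j _ _ ij.
      rewrite predeqE => -[k m] /=; split => //= -[] [_] _ [<-{k} _].
      by move=> [m' _] [] /esym/eqP; rewrite (negbTE ij).
    - by move=> -[k m]; exact: vol_ge0.
  rewrite -(image_id [set: nat]) -fun_true esum_pred_image//; last first.
    by move=> k _; apply: esum_ge0 => -[a b] _; exact: vol_ge0.
  apply: eq_eseriesr => /= j _.
  rewrite -(esum_pred_image (vol \o uncurry G) (pair j) predT)//=; last first.
    by move=> ? ? _ _; exact: (@can_inj _ _ _ snd).
  by congr esum; rewrite predeqE => -[a b]; split; move=> [i _ <-]; exists i.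
apply: lee_lim.
- apply: is_cvg_nneseries => k _ _.
  by apply: nneseries_ge0 => m _ _; exact: vol_ge0.
- apply: is_cvg_nneseries => k _ _.
  by apply: adde_ge0 => //; exact: lebesgue_outer_ge0.
- by near=> k; apply: lee_sum => i _; exact: (PG i).2.
Unshelve. all: by end_near. Qed.

HB.instance Definition _ := isOuterMeasure.Build R V lebesgue_outer
  lebesgue_outer0 lebesgue_outer_ge0 le_lebesgue_outer
  lebesgue_outer_sigma_subadditive.

End lebesgue_outer_measure.

Section weighted_sobolev.
Context (R : realType) (n : nat).
Local Notation V := 'rV[R]_n.+1.

(* R^(n+1) with the sigma-algebra of Lebesgue measurable sets, i.e. of the
   Caratheodory measurable sets of the Lebesgue outer measure. *)
Local Notation L := (caratheodory_type (@lebesgue_outer R n)).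

Definition lebesgue : set L -> \bar R := @lebesgue_outer R n.

HB.instance Definition _ := isMeasure.Build _ _ _ lebesgue
  (@caratheodory_measure0 R V (@lebesgue_outer R n))
  (@caratheodory_measure_ge0 R V (@lebesgue_outer R n))
  (@caratheodory_measure_sigma_additive R V (@lebesgue_outer R n)).

Definition lebesgue_measurable (E : set V) := measurable (E : set L).

Definition enorm (v : V) : R := Num.sqrt (\sum_i v ord0 i ^+ 2).

Implicit Types (Om G E D : set V) (w tau : V -> R) (Q : V -> 'M[R]_n.+1).

Definition eball Om (x0 : V) (r : R) : set V :=
  Om `&` [set x | enorm (x - x0) < r].

Definition compactly_inside E Om := compact (closure E) /\ closure E `<=` Om.

Local Open Scope ereal_scope.

Definition wmeas w D : \bar R := \int[lebesgue]_(x in D) (w x)%:E.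

Definition is_weight Om w :=
  [/\ forall x, Om x -> (0 <= w x)%R, measurable_fun (Om : set L) (w : L -> R) &
      forall K, compact K -> K `<=` Om -> wmeas w K < +oo].

Definition doubling Om tau := exists C : R, forall x r, Om x -> (0 < r)%R ->
  wmeas tau (eball Om x (2 * r)) <= C%:E * wmeas tau (eball Om x r).

Definition average D (f : V -> \bar R) : \bar R :=
  (lebesgue D)^-1 * \int[lebesgue]_(x in D) f x.

(* w^(1/(1-p)) is written as the extended real 1 / w^(1/(p-1)), which is +oo
   where w vanishes; the real power 0 `^ (1 - p)^-1 would be 0. *)
Definition Ap_product p w D : \bar R :=
  average D (fun z => (w z)%:E) *
  (average D (fun z => ((w z `^ (p - 1)^-1)%:E)^-1)) `^ (p - 1).

Definition Ap p Om w := is_weight Om w /\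
  ereal_sup [set Ap_product p w (eball Om xr.1 xr.2) |
             xr in [set xr : V * R | Om xr.1 /\ (0 < xr.2)%R]] < +oo.

(* The quotients are taken in \bar R; under the doubling condition all the
   measures involved are finite. *)
Definition balance p Om w tau := exists C q : R, [/\ (0 < C)%R, (p < q)%R &
  forall s r x, (0 < s)%R -> (s <= r)%R -> Om x ->
    (s / r)%:E *
      (wmeas tau (eball Om x s) / wmeas tau (eball Om x r)) `^ q^-1 <=
    C%:E * (wmeas w (eball Om x s) / wmeas w (eball Om x r)) `^ p^-1].

Definition p_admissible p Om w tau :=
  [/\ is_weight Om w, is_weight Om tau &
      {ae lebesgue, forall x, Om x -> (w x <= tau x)%R}] /\
  [/\ doubling Om tau, Ap p Om w & balance p Om w tau].

Definition psd (A : 'M[R]_n.+1) :=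
  A^T = A /\ forall xi : V, (0 <= (xi *m A *m xi^T) ord0 ord0)%R.

Definition sqrt_psd (A : 'M[R]_n.+1) : 'M[R]_n.+1 :=
  xget 0%R [set B | psd B /\ B *m B = A].

Definition measurable_matrix Om Q := forall i j,
  measurable_fun (Om : set L) (fun x : L => Q x i j).

Definition measurable_field G (k : V -> V) := forall i,
  measurable_fun (G : set L) (fun x : L => k x ord0 i).

(* Vectors being rows, sqrt(Q) xi is the row xi *m sqrt_psd Q (sqrt_psd Q is
   symmetric). *)
Definition Qnorm Q (x xi : V) : R := enorm (xi *m sqrt_psd (Q x)).

Definition structure_condition p Om w tau Q :=
  {ae lebesgue, forall x, Om x -> forall xi : V,
     (w x * enorm xi `^ p <= Qnorm Q x xi `^ p <= tau x * enorm xi `^ p)%R}.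

Definition Lnorm_weight tau r E (f : V -> R) : \bar R :=
  (\int[lebesgue]_(x in E) (`|f x| `^ r * tau x)%:E) `^ r^-1.

(* Elements of L^r_tau and of L^p_Q are represented by functions on the whole
   space of which only the values on E, resp. G, matter. *)
Definition Lspace_weight tau r E : set (V -> R) :=
  [set f | measurable_fun (E : set L) (f : L -> R) /\
           Lnorm_weight tau r E f < +oo].

Definition Lnorm_field Q p G (k : V -> V) : \bar R :=
  (\int[lebesgue]_(x in G) (Qnorm Q x (k x) `^ p)%:E) `^ p^-1.

Definition Lspace_field Q p G : set (V -> V) :=
  [set k | measurable_field G k /\ Lnorm_field Q p G k < +oo].

Definition locally_lipschitz G (f : V -> R) := forall x, G x ->
  exists2 U, nbhs x U & [lipschitz f y | y in G `&` U].

(* By Rademacher's theorem the partial derivatives of a locally Lipschitz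
   function exist a.e.; elsewhere 'D takes an arbitrary value. *)
Definition grad (f : V -> R) (x : V) : V :=
  \row_i 'D_(delta_mx ord0 i) f x.

Definition QHnorm p tau Q G (uk : (V -> R) * (V -> V)) : \bar R :=
  Lnorm_weight tau p G uk.1 + Lnorm_field Q p G uk.2.

Definition Lip0 G : set (V -> R) :=
  [set f | locally_lipschitz G f /\
           compactly_inside [set x | G x /\ f x != 0%R] G].

Definition LipQ p tau Q G : set (V -> R) :=
  [set f | locally_lipschitz G f /\ QHnorm p tau Q G (f, grad f) < +oo].

Definition QH_closure p tau Q G (F : set (V -> R)) :
    set ((V -> R) * (V -> V)) :=
  [set uk | [/\ Lspace_weight tau p G uk.1, Lspace_field Q p G uk.2 &
     forall e : R, (0 < e)%R -> exists2 f, F f &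
       QHnorm p tau Q G (uk.1 \- f, uk.2 \- grad f)%R < e%:E]].

Definition QH p tau Q G := QH_closure p tau Q G (LipQ p tau Q G).

Definition QH0 p tau Q G := QH_closure p tau Q G (Lip0 G).

End weighted_sobolev.

(* Normed spaces are given by representatives: a set X of elements of S with an
   extended-real-valued (semi)norm NX. *)
Definition compactly_embedded (R : realType) (S : Type) (T : zmodType)
    (X : set S) (NX : S -> \bar R) (Y : set T) (NY : T -> \bar R)
    (f : S -> T) :=
  (forall x, X x -> Y (f x)) /\
  forall x_ : nat -> S, (forall j, X (x_ j)) ->
    (exists M : R, forall j, (NX (x_ j) <= M%:E)%E) ->
    exists2 phi : nat -> nat, {homo phi : i j / (i < j)%N} &
    exists2 y, Y y & (fun j => NY (f (x_ (phi j)) - y)) @ \oo --> 0%E.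

(* Main.v *)
From HB Require Import structures.
Require Import Defs.
From mathcomp Require Import all_boot all_order all_algebra.
From mathcomp Require Import all_classical all_reals all_analysis.
From mathcomp Require Import measurable_realfun.
From mathcomp Require Import ring lra zify.

Set Implicit Arguments.
Unset Strict Implicit.
Unset Printing Implicit Defensive.

Import Order.TTheory GRing.Theory Num.Theory.
Import numFieldNormedType.Exports.

Local Open Scope classical_set_scope.
Local Open Scope ring_scope.

(** The embeddings are compact because, on a cube, a function with bounded gradient is
    uniformly approximated in norm by finitely many of its averages.

    Let a cube in [Om] be bisected again and again, in the coordinate directions in turn, and
    let [F] be Lipschitz. The averages of [F] over a cell and over one of its halves differ by
    at most the scale of the cell times the mean of one partial derivative
    ([avg_child_dist]). The [A_p] condition bounds that mean by a [w]-weighted norm, and the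
    balance condition then gives
      [`|avg F child - avg F cell| <= K * tau(cell) `^ (- q^-1) * (norm of the derivative)]
    ([cell_poincare]). For [p <= r < q], take the [r]-th power, integrate with respect to
    [tau] and sum over the cells of one generation: the energies add up to at most that of
    the cube, and a factor [tau(cell) `^ (1 - r / q)] is left, which decays geometrically
    with the generation because [tau] is doubling ([cell_tau_decay]). So the averages over
    the cells of a fine generation are close to [F] in the norm of [L^r_tau], uniformly in
    all [F] with a given bound on the energy ([cavg_approx]). These averages are finitely
    many bounded numbers, so that every sequence of such functions has a subsequence with
    arbitrarily small mutual distances ([cube_close_subseq]).

    A compact subset of [Om] is covered by finitely many cubes on which a locally Lipschitz
    function coincides with a Lipschitz one ([safe_cube_cover], [safe_cube_lipschitz]), and a
    diagonal argument makes the subsequence convergent ([tame_limit]). An element of a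
    completion is an [L^p_tau]-limit of locally Lipschitz functions; by the lower bound on
    [Q] their energies on cubes are bounded by the Sobolev norm ([sobolev_approximable]). Such
    approximants converge in [L^r_tau] as well, along a subsequence
    ([approximable_exponent]), so each element of a bounded sequence can be replaced by a
    nearby locally Lipschitz function. Exponents below [p] follow since [tau] has finite
    mass, and functions with compact support in [E] are extended by zero to [Om].

    The partial derivatives exist almost everywhere by differentiation of Lipschitz functions
    of one variable and Fubini's theorem ([lipschitz_ae_partial]), which together with the
    translation invariance of Lebesgue measure gives [avg_child_dist]. *)

(** * Lipschitz functions on the line *)

Section lipschitz_line.
Context {R : realType}.
Notation mu := (@lebesgue_measure R).

(** Adding a linear function makes a Lipschitz function the distribution function of a
    measure; that measure is dominated by a multiple of Lebesgue measure, and
    its Radon-Nikodym density is the derivative at all Lebesgue points. *)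
Lemma lipschitz_ae_derivable (g : R -> R) (l : R) :
  (forall x y, `|g x - g y| <= l * `|x - y|) ->
  {ae mu, forall x, `]0, 1[%classic x -> derivable g x 1}.
Proof.
move=> gl.
have l0 : 0 <= l by have := gl 0 1; rewrite sub0r normrN1 mulr1; apply: le_trans.
pose G x := g x + l * x.
have Gnd : {homo G : x y / x <= y}.
  move=> x y xy; rewrite /G; have := gl x y.
  rewrite ler_norml ler0_norm ?subr_le0// => /andP[h1 h2].
  nra.
have l1 : 0 < 2 * l + 1 by lra.
have Gl x y : `|G x - G y| <= (2 * l + 1) * `|x - y|.
  rewrite /G (_ : _ - _ = (g x - g y) + l * (x - y)); last ring.
  rewrite (le_trans (ler_normD _ _))// normrM (ger0_norm l0).
  have := gl x y; have := normr_ge0 (x - y); nra.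
have Gc : continuous G.
  move=> x; apply/cvgrPdist_le => e e0; near=> y.
  rewrite (le_trans (Gl _ _))// -ler_pdivlMl//; near: y.
  apply: cvgr_dist_le; first exact: cvg_id.
  by rewrite mulr_gt0 ?invr_gt0.
have Grc : right_continuous G.
  by move=> x; apply: cvg_at_right_filter; exact: Gc.
pose GC : cumulative R R :=
  HB.pack G (isCumulative.Build R _ R G Gnd Grc).
pose nu0 := lebesgue_stieltjes_measure GC.
have l20 : (0 <= (2 * l + 1)%:E)%E by rewrite lee_fin ltW.
have nu0le (A : set (measurableTypeR R)) : (nu0 A <= (2 * l + 1)%:E * mu A)%E.
  rewrite /nu0 /lebesgue_measure /lebesgue_stieltjes_measure /measure_extension.
  rewrite /mu_ext -ereal_inf_pZl//.
  apply: le_ereal_inf_tmp => _ [_ [F AF <-] <-].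
  apply: (@le_trans _ _ (\sum_(k <oo) wlength GC (F k))%E).
    by apply: ereal_inf_lbound; exists F.
  rewrite -nneseriesZl; last by move=> i _; exact: (wlength_ge0 idfun).
  apply: lee_nneseries => [k _ _|k _]; first exact: (wlength_ge0 GC).
  have := AF.1 k; rewrite /= => /ocitvP[->|[x xlt ->]].
    by rewrite !wlength0 mule0.
  have xle := ltW xlt; rewrite !wlength_itv_bnd//= -EFinM lee_fin.
  by have := Gl x.2 x.1; rewrite !ger0_norm ?subr_ge0 ?Gnd.
have mI : measurable (`]0, 1]%classic : set (measurableTypeR R)).
  exact: measurable_itv.
pose nu1 := mrestr nu0 mI.
have nu1fin : fin_num_fun nu1.
  apply: lty_fin_num_fun; rewrite /nu1/= /mrestr setTI.
  rewrite (le_lt_trans (nu0le _))// lebesgue_measure_itv/= lte01 oppr0 adde0.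
  by rewrite mule1 ltry.
pose nu : {finite_measure set (measurableTypeR R) -> \bar R} :=
  HB.pack nu1 (Measure_isFinite.Build _ _ _ nu1 nu1fin).
have numu : nu `<< mu.
  apply/null_content_dominatesP => A mA A0; apply/eqP.
  rewrite eq_le measure_ge0 andbT.
  apply: le_trans (nu0le (A `&` `]0, 1]%classic)) _.
  rewrite (_ : mu _ = 0)%E ?mule0//; apply/eqP.
  rewrite eq_le measure_ge0 andbT -A0 le_measure ?inE//; exact: measurableI.
have [f [f0 ffin intf nuf]] := radon_nikodym_sigma_finite numu.
pose f' := fine \o f.
have f'E : EFin \o f' = f.
  by apply/funext => x /=; rewrite fineK.
have intf' A : measurable A -> mu.-integrable A (EFin \o f').
  by move=> mA; rewrite f'E; exact: integrableS intf.
have locf : locally_integrable [set: R] f'.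
  by apply: open_integrable_locally => //; [exact: openT| exact: intf'].
have := @FTC1 R f' (BRight 0) (fun y => intf' _ (measurable_itv _)) locf.
rewrite /=; apply: filterS.
  exact: (ae_filter_ringOfSetsType mu).
move=> x h /=; rewrite in_itv/= => /andP[x0 x1].
have {h} [dF _] := h x0.
have FE y : 0 < y <= 1 ->
    \int[mu]_(t in `]0, y]) f' t = G y - G 0.
  move=> /andP[y0 y1]; rewrite /Rintegral.
  rewrite (eq_integral f); last by move=> t _; rewrite -f'E.
  rewrite -nuf; last exact: measurable_itv.
  rewrite /nu/= /nu1/= /mrestr (_ : _ `&` _ = `]0, y]%classic); last first.
    rewrite setIidl// => t /=; rewrite !in_itv/= => /andP[-> ty].
    exact: le_trans y1.
  rewrite /nu0 /lebesgue_stieltjes_measure /measure_extension measurable_mu_extE/=; last first.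
    exact: is_ocitv.
  by rewrite wlength_itv_bnd//= ltW.
have dG : derivable G x 1.
  have : derivable (fun y : R => (\int[mu]_(t in `]0, y]) f' t) + G 0) x 1.
    exact: (derivableD dF (@derivable_cst _ _ _ _ _ _)).
  apply: near_eq_derivable.
  have : x \in `]0, 1[ by rewrite in_itv/= x0.
  move=> /near_in_itvoo; apply: filterS => y; rewrite in_itv/= => /andP[y0 y1].
  by rewrite FE ?subrK// y0 ltW.
rewrite (_ : g = G \- (fun x => l * x)); last first.
  by apply/funext => y /=; rewrite /G addrK.
apply: derivableB => //; apply: derivableM => //; exact: derivable_cst.
Unshelve. all: by end_near. Qed.
End lipschitz_line.

(** * Lebesgue measure: boxes, open sets and translations *)

Section lebesgue_boxes.
Context {R : realType} {n : nat}.
Local Notation V := 'rV[R]_n.+1.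
Local Notation lam := (@lebesgue R n).
Local Notation L := (caratheodory_type (@lebesgue_outer R n)).

Definition upd (v : V) (j : 'I_n.+1) (c : R) : V :=
  \row_i (if i == j then c else v ord0 i).

Lemma updE v j c i : upd v j c ord0 i = if i == j then c else v ord0 i.
Proof. by rewrite mxE. Qed.

Lemma box_setI_lt (a b : V) j c :
  box a b `&` [set x | x ord0 j < c] = box a (upd b j (Num.min (b ord0 j) c)).
Proof.
apply/seteqP; split => [x [/= abx xc] i|x /= abx].
  rewrite updE; case: eqVneq => [->|//].
  by have /andP[-> xb] := abx j; rewrite lt_min xb.
split => [i|].
  have := abx i; rewrite updE; case: eqVneq => // ->.
  by rewrite lt_min => /and3P[-> ->].
by have := abx j; rewrite updE eqxx lt_min => /and3P[].
Qed.

Lemma box_setI_ge (a b : V) j c :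
  box a b `&` [set x | c <= x ord0 j] = box (upd a j (Num.max (a ord0 j) c)) b.
Proof.
apply/seteqP; split => [x [/= abx xc] i|x /= abx].
  rewrite updE; case: eqVneq => [->|//].
  by have /andP[ax ->] := abx j; rewrite ge_max ax xc.
split => [i|].
  have := abx i; rewrite updE; case: eqVneq => // ->.
  by rewrite ge_max => /andP[/andP[-> _] ->].
by have := abx j; rewrite updE eqxx ge_max => /andP[/andP[]].
Qed.

Lemma max_split (a b c : R) :
  Num.max 0 (Num.min b c - a) + Num.max 0 (b - Num.max a c) = Num.max 0 (b - a).
Proof.
have [bc|cb] := leP b c.
  by rewrite [X in _ + X]max_l ?addr0// subr_le0 le_max bc orbT.
have [ac|ca] := leP a c; last by rewrite max_l ?add0r// subr_le0 ltW.
by rewrite !max_r ?subr_ge0 ?(ltW cb)//; [ring|exact: le_trans (ltW cb)].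
Qed.

Lemma box_vol_split (a b : V) j c :
  box_vol a (upd b j (Num.min (b ord0 j) c)) +
  box_vol (upd a j (Num.max (a ord0 j) c)) b = box_vol a b.
Proof.
rewrite /box_vol [X in X + _](bigD1 j)//= [X in _ + X](bigD1 j)//= [RHS](bigD1 j)//=.
rewrite !updE eqxx.
rewrite [X in _ * X + _](eq_bigr (fun i => Num.max 0 (b ord0 i - a ord0 i))); last first.
  by move=> i ij; rewrite updE (negbTE ij).
rewrite [X in _ + _ * X](eq_bigr (fun i => Num.max 0 (b ord0 i - a ord0 i))); last first.
  by move=> i ij; rewrite updE (negbTE ij).
rewrite -mulrDl; congr (_ * _); exact: max_split.
Qed.

Lemma lebesgue_outer_le_cover (X : set V) (F : (V * V)^nat) : box_cover X F ->
  (lebesgue_outer X <= \sum_(k <oo) (box_vol (F k).1 (F k).2)%:E)%E.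
Proof. by move=> XF; apply: ereal_inf_lbound; exists F. Qed.

(** A half-space cuts a box into two boxes whose volumes add up; hence it splits every
    cover additively, which is the Caratheodory criterion. *)
Lemma measurable_lt_coord j c : measurable ([set x : V | x ord0 j < c] : set L).
Proof.
apply: le_caratheodory_measurable => X.
apply: le_ereal_inf_tmp => _ [F XF <-].
rewrite (eq_eseriesr (fun k _ => f_equal EFin (esym (box_vol_split _ _ j c)))).
under eq_eseriesr do rewrite EFinD.
rewrite nneseriesD; [|by move=> k _ _; exact: box_vol_ge0..].
apply: leeD.
  apply: (@lebesgue_outer_le_cover _ (fun k => ((F k).1,
    upd (F k).2 j (Num.min ((F k).2 ord0 j) c)))) => x [/XF[k _ Fkx] xc].
  by exists k => //=; rewrite -box_setI_lt.
apply: (@lebesgue_outer_le_cover _ (fun k =>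
  (upd (F k).1 j (Num.max ((F k).1 ord0 j) c), (F k).2))) => x [/XF[k _ Fkx] xc].
by exists k => //=; rewrite -box_setI_ge; split => //=; rewrite leNgt; exact/negP.
Qed.

Lemma measurable_coord j : measurable_fun setT (fun x : L => (x : V) ord0 j).
Proof.
apply: (measurability _ (RGenInftyO.measurableE R)).
move=> _ [_ [c ->] <-].
have -> : [set: L] `&` (fun x : L => (x : V) ord0 j) @^-1` `]-oo, c[ =
    [set x : V | x ord0 j < c].
  by apply/seteqP; split => [x [_ /=]|x /= xc]; [|split => //=]; rewrite in_itv.
exact: measurable_lt_coord.
Qed.

Lemma measurable_box (a b : V) : measurable (box a b : set L).
Proof.
have -> : box a b = \bigcap_(i in [set: 'I_n.+1])
    ([set x | a ord0 i <= x ord0 i] `&` [set x | x ord0 i < b ord0 i]).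
  apply/seteqP; split => [x abx i _|x abx i].
    by have /andP := abx i.
  by apply/andP; exact: (abx i).
apply: fin_bigcap_measurable => // i _; apply: measurableI.
  rewrite (_ : [set x | _] = ~` [set x | x ord0 i < a ord0 i]); last first.
    apply/seteqP; split => x /=; first by rewrite leNgt => /negP.
    by move=> /negP; rewrite -leNgt.
  by apply: measurableC; exact: measurable_lt_coord.
exact: measurable_lt_coord.
Qed.

Lemma rV_norm_lt (v : V) e : 0 < e -> (`|v| < e) = [forall i, `|v ord0 i| < e].
Proof.
move=> e0; apply/idP/forallP => [ve i|ve].
  apply: le_lt_trans ve; rewrite /Num.norm/= mx_normrE.
  by apply: le_trans (le_bigmax _ _ (ord0, i)).
rewrite /Num.norm/= mx_normrE; apply/bigmax_ltP; split => // -[i j] _ /=.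
by rewrite (ord1 i); exact: ve.
Qed.

Lemma rV_norm_le (v : V) e : 0 <= e -> (`|v| <= e) = [forall i, `|v ord0 i| <= e].
Proof.
move=> e0; apply/idP/forallP => [ve i|ve].
  apply: le_trans ve; rewrite /Num.norm/= mx_normrE.
  by apply: le_trans (le_bigmax _ _ (ord0, i)).
rewrite /Num.norm/= mx_normrE; apply/bigmax_leP; split => // -[i j] _ /=.
by rewrite (ord1 i); exact: ve.
Qed.

Lemma coord_le_norm (v : V) i : `|v ord0 i| <= `|v|.
Proof. by have := rV_norm_le v (normr_ge0 v); rewrite lexx => /esym/forallP. Qed.

Lemma rat_between (x y : R) : x < y -> {q : rat | x < ratr q < y}.
Proof.
by move=> xy; apply: cid; have [q] := rat_in_itvoo xy; rewrite in_itv/=; exists q.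
Qed.

(** Boxes with rational corners are a countable base of the topology. *)
Lemma measurable_preimage_open d (T : measurableType d) (Phi : T -> V) (U : set V) :
  (forall i, measurable_fun setT (fun t => Phi t ord0 i)) -> open U ->
  measurable (Phi @^-1` U).
Proof.
move=> mPhi oU.
pose rbox (ab : 'rV[rat]_n.+1 * 'rV[rat]_n.+1) : set V :=
  [set x | forall i, ratr (ab.1 ord0 i) < x ord0 i < ratr (ab.2 ord0 i)].
have -> : Phi @^-1` U = \bigcup_ab
    (if `[< rbox ab `<=` U >] then Phi @^-1` rbox ab else set0).
  apply/seteqP; split => [t /= Ut|t [ab _]]; last first.
    by case: ifPn => // /asboolP abU /abU.
  have /nbhs_ballP[e /= e0 eU] := oU _ Ut.
  have /all_sig[a ha] i : {q : rat | Phi t ord0 i - e < ratr q < Phi t ord0 i}.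
    by apply: rat_between; rewrite ltrBlDr ltrDl.
  have /all_sig[b hb] i : {q : rat | Phi t ord0 i < ratr q < Phi t ord0 i + e}.
    by apply: rat_between; rewrite ltrDl.
  exists (\row_i a i, \row_i b i) => //=; rewrite ifT; last first.
    apply/asboolP => y /= aby; apply: eU; rewrite -ball_normE/= rV_norm_lt//.
    apply/forallP => i; have := aby i; have := ha i; have := hb i.
    rewrite !mxE distrC ltr_norml => /andP[? ?] /andP[? ?] /andP[? ?].
    by apply/andP; split; lra.
  move=> i; rewrite /= !mxE; have /andP[_ ->] := ha i.
  by have /andP[-> _] := hb i.
apply: countable_bigcupT_measurable => // ab; case: ifPn => // _.
rewrite (_ : _ @^-1` _ = \bigcap_(i in [set: 'I_n.+1])
  ((fun t => Phi t ord0 i) @^-1` `]ratr (ab.1 ord0 i), ratr (ab.2 ord0 i)[)); last first.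
  apply/seteqP; split => [t /= abt i _|t abt i] /=.
    by rewrite in_itv/=; exact: abt.
  by have := abt i I; rewrite /= in_itv.
apply: fin_bigcap_measurable => // i _; rewrite -[X in measurable X]setTI.
by apply: mPhi => //; exact: measurable_itv.
Qed.

Lemma measurable_open (U : set V) : open U -> measurable (U : set L).
Proof. exact: (@measurable_preimage_open _ L id U measurable_coord). Qed.

Lemma continuous_measurable (f : V -> R) : continuous f ->
  measurable_fun setT (f : L -> R).
Proof.
move=> cf; apply: (measurability _ (RGenOpens.measurableE R)).
move=> _ [_ [a [b ->]] <-]; rewrite setTI; apply: measurable_open.
by apply: open_comp => [x _|]; [exact: cf|exact: interval_open].
Qed.

Lemma lebesgue_box_le (a b : V) : (lam (box a b) <= (box_vol a b)%:E)%E.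
Proof.
pose F k : V * V := if k is 0%N then (a, b) else (0, 0).
apply: (@le_trans _ _ (\sum_(k <oo) (box_vol (F k).1 (F k).2)%:E)%E).
  by apply: lebesgue_outer_le_cover => x abx; exists 0%N.
rewrite nneseries_recl//; last by move=> k _; exact: box_vol_ge0.
rewrite eseries0 ?adde0// => -[//|k] _ _ /=.
by rewrite /box_vol big_ord_recl !mxE subrr maxxx mul0r.
Qed.

Lemma lebesgue_box_lty (a b : V) : (lam (box a b) < +oo)%E.
Proof. exact: le_lt_trans (lebesgue_box_le _ _) (ltry _). Qed.

Lemma cover_boxes : [set: V] = \bigcup_k box (const_mx (- k%:R)) (const_mx k%:R).
Proof.
apply/esym; rewrite -subTset => x _.
exists (Num.bound `|x|).+1 => // i; rewrite !mxE.
have xi := coord_le_norm x i.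
have xb : `|x| < (Num.bound `|x|)%:R by rewrite archi_boundP.
move: xi; rewrite ler_norml -natr1 => /andP[? ?]; apply/andP; split; lra.
Qed.

Lemma sigma_finite_lebesgue : sigma_finite [set: L] lam.
Proof.
exists (fun k => box (const_mx (- k%:R)) (const_mx k%:R) : set L).
  exact: cover_boxes.
by move=> k; split; [exact: measurable_box|exact: lebesgue_box_lty].
Qed.

HB.instance Definition _ := @Measure_isSigmaFinite.Build _ _ _ lam sigma_finite_lebesgue.

Lemma lebesgue_outer_shift (v : V) (X : set V) :
  lebesgue_outer [set x | X (x + v)] = lebesgue_outer X.
Proof.
suff le (v' : V) (Y : set V) :
    (lebesgue_outer [set x | Y (x + v')%R] <= lebesgue_outer (Y : set V))%E.
  apply/eqP; rewrite eq_le le/=.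
  apply: le_trans (le (- v) [set x | X (x + v)]).
  by apply: le_lebesgue_outer => x Xx /=; rewrite subrK.
apply: le_ereal_inf_tmp => _ [F YF <-].
pose G k := ((F k).1 - v', (F k).2 - v').
rewrite (eq_eseriesr (g := fun k => (box_vol (G k).1 (G k).2)%:E)); last first.
  move=> k _; congr EFin; apply: eq_bigr => i _ /=.
  by rewrite !mxE opprB addrA subrK.
apply: lebesgue_outer_le_cover => x /YF[k _ Fk]; exists k => // i.
by have := Fk i; rewrite /= !mxE lerBlDr ltrBrDr.
Qed.

Lemma measurable_shift (v : V) : measurable_fun setT ((fun x => x + v) : L -> L).
Proof.
move=> _ A mA; rewrite setTI.
have {}mA : (@lebesgue_outer R n).-caratheodory A by [].
suff : (@lebesgue_outer R n).-caratheodory ((fun x => x + v) @^-1` A) by [].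
move=> X; have := mA [set x | X (x - v)].
rewrite -(lebesgue_outer_shift (- v) X) => ->.
by congr (_ + _)%E; rewrite -(lebesgue_outer_shift v); congr lebesgue_outer;
  apply/seteqP; split => x /= []; rewrite ?addrK.
Qed.

Lemma lebesgue_shift (v : V) (A : set V) : lam [set x | A (x + v)] = lam A.
Proof. exact: lebesgue_outer_shift. Qed.

Lemma ge0_integral_shift (v : V) (D : set V) (f : V -> \bar R) :
  measurable (D : set L) -> measurable_fun (D : set L) f ->
  (forall x, D x -> (0 <= f x)%E) ->
  (\int[lam]_(x in [set x | D (x + v)%R]) f (x + v)%R = \int[lam]_(x in D) f x)%E.
Proof.
move=> mD mf f0.
pose phi : L -> L := fun x => x + v.
transitivity (\int[pushforward lam phi]_(y in D) f y)%E.
  rewrite (@ge0_integral_pushforward _ _ L L R phi)//; first exact: measurable_shift.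
  by move=> y; rewrite inE; exact: f0.
apply: eq_measure_integral; first exact: measurable_shift.
by move=> mphi A mA _; exact: (lebesgue_shift v A).
Qed.

Lemma integral_shift (v : V) (D : set V) (f : V -> \bar R) :
  measurable (D : set L) -> lam.-integrable D f ->
  (\int[lam]_(x in [set x | D (x + v)%R]) f (x + v)%R = \int[lam]_(x in D) f x)%E.
Proof.
move=> mD /integrableP[mf fi]; rewrite integralE [RHS]integralE.
congr (_ - _)%E.
  rewrite -(ge0_integral_shift v mD (measurable_funepos mf) (fun x _ => funepos_ge0 f x)).
  by apply: eq_integral => x _; rewrite !funeposE.
rewrite -(ge0_integral_shift v mD (measurable_funeneg mf) (fun x _ => funeneg_ge0 f x)).
by apply: eq_integral => x _; rewrite !funenegE.
Qed.

Lemma lebesgue_complete : measure_is_complete lam.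
Proof. exact: measure_is_complete_caratheodory. Qed.

End lebesgue_boxes.

(** * Partial derivatives of Lipschitz functions *)

Section partial_derivatives.
Context {R : realType} {n : nat}.
Local Notation V := 'rV[R]_n.+1.
Local Notation lam := (@lebesgue R n).
Local Notation L := (caratheodory_type (@lebesgue_outer R n)).
Local Notation mu := (@lebesgue_measure R).

Definition basis_vec (j : 'I_n.+1) : V := delta_mx ord0 j.

Lemma norm_basis_vec j : `|basis_vec j| = 1.
Proof.
apply/eqP; rewrite eq_le; apply/andP; split.
  rewrite rV_norm_le//; apply/forallP => i; rewrite !mxE eqxx /=.
  by case: (i == j); rewrite ?normr1 ?normr0.
by have := coord_le_norm (basis_vec j) j; rewrite !mxE !eqxx normr1.
Qed.

Definition diffq (F : V -> R) (j : 'I_n.+1) (h : R) (x : V) : R :=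
  h^-1 * (F (h *: basis_vec j + x) - F x).

Definition is_lipschitz (l : R) (F : V -> R) := forall x y, `|F x - F y| <= l * `|x - y|.

Lemma lipschitz_continuous l F : is_lipschitz l F -> continuous F.
Proof.
move=> Fl x; have l0 : 0 <= `|l| + 1 by rewrite addr_ge0.
apply/(@cvgrPdist_le _ _ _ (nbhs x)) => e e0; near=> y.
apply: (@le_trans _ _ ((`|l| + 1) * `|x - y|)).
  by rewrite (le_trans (Fl _ _))// ler_wpM2r// (le_trans (ler_norm _))// lerDl.
rewrite -ler_pdivlMl ?ltr_pwDr//; near: y.
apply: cvgr_dist_le; first exact: cvg_id.
by rewrite mulr_gt0 ?invr_gt0 ?ltr_pwDr.
Unshelve. all: by end_near. Qed.

Lemma diffq_lipschitz l F j h x : is_lipschitz l F -> `|diffq F j h x| <= `|l|.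
Proof.
move=> Fl; rewrite /diffq normrM normfV.
have [->|h0] := eqVneq h 0; first by rewrite normr0 invr0 mul0r.
rewrite ler_pdivrMl ?normr_gt0// (le_trans (Fl _ _))// addrK normrZ.
by rewrite norm_basis_vec mulr1 mulrC ler_wpM2l// ler_norm.
Qed.

Lemma diffq_continuous F j h : continuous F -> continuous (diffq F j h).
Proof.
move=> Fc x.
have Fhc : {for x, continuous (fun y => F (h *: basis_vec j + y))}.
  apply: (@continuous_comp _ _ _ (fun y => h *: basis_vec j + y) F);
    last exact: Fc.
  by apply: continuousD; [exact: cst_continuous|exact: cvg_id].
have dc : {for x, continuous (fun y => F (h *: basis_vec j + y) - F y)}.
  exact: (continuousB Fhc (Fc x)).
exact: (continuousM (@cst_continuous _ _ h^-1 x) dc).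
Qed.

Lemma derivable_diffq F j x :
  derivable F x (basis_vec j) <-> cvg (diffq F j h x @[h --> 0^']).
Proof. by []. Qed.

(** The points at which the difference quotients oscillate by more than [k.+1%:R^-1]
    at a scale below [m.+1%:R^-1]; this set is open, which makes the set of points
    without a partial derivative a Borel set. *)
Definition oscillating (F : V -> R) (j : 'I_n.+1) (k m : nat) : set V :=
  [set x | exists r s : R, [/\ 0 < `|r| < m.+1%:R^-1, 0 < `|s| < m.+1%:R^-1 &
     k.+1%:R^-1 < `|diffq F j r x - diffq F j s x|]].

Definition nonderivable (F : V -> R) (j : 'I_n.+1) : set V :=
  \bigcup_k \bigcap_m oscillating F j k m.

Lemma oscillating_open F j k m : continuous F -> open (oscillating F j k m).
Proof.
move=> Fc; have -> : oscillating F j k m = \bigcup_(rs in [set rs : R * R |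
    0 < `|rs.1| < m.+1%:R^-1 /\ 0 < `|rs.2| < m.+1%:R^-1])
    (fun x => `|diffq F j rs.1 x - diffq F j rs.2 x|) @^-1` `]k.+1%:R^-1, +oo[.
  apply/seteqP; split => [x [r [s [rm sm xk]]]|x [[r s] /= [rm sm]]].
    by exists (r, s) => //=; rewrite in_itv/= xk.
  by rewrite in_itv/= andbT => xk; exists r, s.
apply: bigcup_open => rs _; apply: open_comp; last exact: interval_open.
move=> x _.
have h : {for x, continuous (fun x => diffq F j rs.1 x - diffq F j rs.2 x)}.
  exact: (continuousB (@diffq_continuous F j rs.1 Fc x)
    (@diffq_continuous F j rs.2 Fc x)).
apply: (@continuous_comp _ _ _
  (fun x => diffq F j rs.1 x - diffq F j rs.2 x) (fun z : R => `|z|)); last exact: norm_continuous.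
exact: h.
Qed.

(** Cauchy's criterion for the difference quotients. *)
Lemma nonderivableP F j x :
  nonderivable F j x <-> ~ derivable F x (basis_vec j).
Proof.
rewrite derivable_diffq; split => [[k _ xk] /cvg_ex[l /cvgrPdist_lt dl]|ndx].
  have k2 : 0 < k.+1%:R^-1 / 2 :> R by [].
  have /nbhs_ballP[d /= d0 dk] : nbhs (0 : R)
    (fun h => h != 0 -> `|l - diffq F j h x| < k.+1%:R^-1 / 2) := dl _ k2.
  have [m dm] : exists m : nat, m.+1%:R^-1 < d.
    by exists (Num.trunc d^-1); rewrite invf_plt ?posrE// truncnS_gt.
  have [r [s [/andP[r0 rm] /andP[s0 sm]]]] := xk m I.
  have inb t : 0 < `|t| -> `|t| < m.+1%:R^-1 -> `|l - diffq F j t x| < k.+1%:R^-1 / 2.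
    move=> t0 tm; apply: dk; last by rewrite -normr_gt0.
    by rewrite -ball_normE/= sub0r normrN (lt_trans tm).
  apply/negP; rewrite -leNgt.
  rewrite (_ : _ - _ = (l - diffq F j s x) - (l - diffq F j r x)); last ring.
  rewrite (le_trans (ler_normB _ _))// [leRHS]splitr lerD// ltW//; exact: inb.
apply: contrapT => nx; apply: ndx.
have osc k : exists m : nat, forall r s : R, 0 < `|r| < m.+1%:R^-1 ->
    0 < `|s| < m.+1%:R^-1 -> `|diffq F j r x - diffq F j s x| <= k.+1%:R^-1.
  apply: contrapT => /forallNP h; apply: nx; exists k => // m _.
  have /existsNP[r /existsNP[s]] := h m.
  by move=> /not_implyP[rm /not_implyP[sm /negP]]; rewrite -ltNge => rs; exists r, s.
apply: cauchy_cvg; apply: cauchy_exP => e e0.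
have [k ke] : exists k : nat, k.+1%:R^-1 < e.
  by exists (Num.trunc e^-1); rewrite invf_plt ?posrE// truncnS_gt.
have [m hm] := osc k.
exists (diffq F j (m.+1%:R^-1 / 2) x).
have m0 : 0 < m.+1%:R^-1 :> R by [].
apply/nbhs_ballP; exists m.+1%:R^-1 => //= t; rewrite -ball_normE/= sub0r normrN.
move=> tm t0.
change (ball (diffq F j (m.+1%:R^-1 / 2) x) e (diffq F j t x)).
rewrite -ball_normE/=; apply: le_lt_trans ke; apply: hm.
  by rewrite gtr0_norm ?divr_gt0//= ltr_pdivrMr// ltr_pMr// ltr1n.
by rewrite normr_gt0 t0.
Qed.

Lemma measurable_preimage_nonderivable d (T : measurableType d) (Phi : T -> V) F j :
  (forall i, measurable_fun setT (fun t => Phi t ord0 i)) -> continuous F ->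
  measurable (Phi @^-1` nonderivable F j).
Proof.
move=> mPhi Fc; rewrite /nonderivable preimage_bigcup.
apply: bigcupT_measurable => k; rewrite preimage_bigcap.
apply: bigcapT_measurable => m.
by apply: measurable_preimage_open => //; exact: oscillating_open.
Qed.

Lemma derivable_line (F : V -> R) j (x : V) (t : R) :
  derivable (fun t : R => F (x + t *: basis_vec j)) t 1 <->
  derivable F (x + t *: basis_vec j) (basis_vec j).
Proof.
rewrite /derivable.
set f := (X in X @ _); set g := (X in _ <-> cvg (X @ _)).
suff -> : f = g by [].
by apply/funext => h; rewrite /f /g /= [_ *: 1]mulr1 scalerDl addrCA.
Qed.

(** Fubini: translating by a random multiple of a basis vector does not change the
    measure of the exceptional set, and on each line it is a null set. *)
Lemma lipschitz_ae_partial l F j : is_lipschitz l F ->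
  {ae lam, forall x, derivable F x (basis_vec j)}.
Proof.
move=> Fl; have Fc := lipschitz_continuous Fl.
pose N : set V := nonderivable F j.
have mN : measurable (N : set L).
  exact: (@measurable_preimage_nonderivable _ L id F j measurable_coord).
suff N0 : lam N = 0%E.
  by exists N; split => // x /= /nonderivableP.
pose RT := measurableTypeR R.
pose Phi (z : L * RT) : V := (z.1 : V) + (z.2 : R) *: basis_vec j.
have mPhi i : measurable_fun setT (fun z => Phi z ord0 i).
  rewrite /Phi; under eq_fun do rewrite !mxE mulrC.
  apply: measurable_funD.
    exact: (measurableT_comp (measurable_coord i) measurable_fst).
  apply: measurable_funM; first exact: measurable_cst.
  exact: measurable_snd.
pose Z : set (L * RT) := (Phi @^-1` N) `&` (snd @^-1` `]0, 1[%classic).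
have mZ : measurable Z.
  apply: measurableI; first exact: measurable_preimage_nonderivable.
  have m01 : measurable (`]0, 1[%classic : set RT) by exact: measurable_itv.
  by have := @measurable_snd _ _ L RT measurableT _ m01; rewrite setTI.
have := @indic_fubini_tonelli _ _ L RT R lam mu Z mZ.
rewrite indic_fubini_tonelli_FE// indic_fubini_tonelli_GE//.
rewrite [LHS]integral0_eq => [|x _ /=]; last first.
  pose g t := F (x + t *: basis_vec j).
  have gl s t : `|g s - g t| <= `|l| * `|s - t|.
    rewrite (le_trans (Fl _ _))// opprD addrACA subrr add0r -scalerBl normrZ.
    by rewrite norm_basis_vec mulr1 ler_wpM2r// ler_norm.
  have [A [mA A0 gA]] := lipschitz_ae_derivable gl.
  apply: (subset_measure0 _ mA _ A0); first exact: measurable_xsection.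
  move=> t; rewrite /xsection/= inE => -[/= Nxt t01].
  by apply: gA => /= /(_ t01) /derivable_line; exact/nonderivableP.
have -> : (lam \o ysection Z) = (fun t : RT => lam N * (\1_(`]0, 1[%classic : set R) t)%:E)%E.
  apply/funext => t /=; rewrite indicE.
  have [t01|t01] := boolP (t \in `]0, 1[%classic).
    rewrite mule1 -(lebesgue_shift (t *: basis_vec j) N); congr (lam _).
    apply/seteqP; split => x; rewrite /ysection/= inE; first by case.
    by move=> Nx; split => //=; rewrite inE in t01.
  rewrite mule0 (_ : ysection _ _ = set0) ?measure0//.
  apply/seteqP; split => x //; rewrite /ysection/= inE => -[_ /=].
  by move: t01; rewrite notin_setE.
rewrite ge0_integralZl//; last first.
  by apply/measurable_EFinP; exact: measurable_indic.
rewrite integral_indic//= setIT lebesgue_measure_itv/= lte01 oppr0 adde0 mule1.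
by move=> /esym.
Qed.

End partial_derivatives.

(** * Differences of translates *)

Section partial_integrals.
Context {R : realType} {n : nat}.
Local Notation V := 'rV[R]_n.+1.
Local Notation lam := (@lebesgue R n).
Local Notation L := (caratheodory_type (@lebesgue_outer R n)).

Definition partial (F : V -> R) (j : 'I_n.+1) (x : V) : R := 'D_(basis_vec j) F x.

Lemma gradE F x j : grad F x ord0 j = partial F j x.
Proof. by rewrite mxE. Qed.

Lemma cvg_diffq F j x : derivable F x (basis_vec j) ->
  diffq F j h x @[h --> 0^'] --> partial F j x.
Proof. by []. Qed.

Lemma cvg_diffq_seq F j x (s : R^nat) : derivable F x (basis_vec j) ->
  (forall m, s m != 0) -> s @ \oo --> 0 ->
  diffq F j (s m) x @[m --> \oo] --> partial F j x.
Proof.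
move=> dF s0 scv; have := cvg_diffq dF.
move=> /cvgrPdist_lt h; apply/cvgrPdist_lt => e e0.
have /nbhs_ballP[d /= d0 dk] : nbhs (0 : R)
  (fun h => h != 0 -> `|partial F j x - diffq F j h x| < e) := h _ e0.
move/cvgrPdist_lt : scv => /(_ _ d0); apply: filterS => m hm.
by apply: dk => //; rewrite -ball_normE.
Qed.

Lemma cvg_invS0 (h : R) : h / m.+1%:R @[m --> \oo] --> (0 : R).
Proof.
rewrite -[X in _ --> X](mulr0 h); apply: cvgM; first exact: cvg_cst.
exact: cvg_harmonic.
Qed.

Lemma measurable_diffq (F : V -> R) j h : continuous F ->
  measurable_fun setT (diffq F j h : L -> R).
Proof. by move=> Fc; apply: continuous_measurable; exact: diffq_continuous. Qed.

(** Almost everywhere the partial derivative is a limit of continuous difference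
    quotients; on the exceptional null set completeness of Lebesgue measure applies. *)
Lemma measurable_partial l F j : is_lipschitz l F ->
  measurable_fun setT (partial F j : L -> R).
Proof.
move=> Fl; have Fc := lipschitz_continuous Fl.
have [N [mN N0 dN]] := lipschitz_ae_partial j Fl.
have dN' x : (~` N) x -> derivable F x (basis_vec j).
  by move=> Nx; apply: contrapT => nd; apply: Nx; exact: dN.
apply/measurable_EFinP.
apply: (@ae_measurable_fun _ _ _ lam lebesgue_complete setT
  (EFin \o (partial F j \_ (~` N)))).
  exists N; split => // x /=; apply: contra_notP => Nx _.
  by rewrite /= patchE mem_set.
apply/measurable_EFinP.
apply: (@measurable_fun_cvg _ _ _ _ (fun m => diffq F j (1 / m.+1%:R) \_ (~` N))).
  move=> m; apply/(measurable_restrictT _ (measurableC mN)).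
  by apply: measurable_funTS; exact: measurable_diffq.
move=> x _; rewrite patchE; case: ifPn => [|xN].
  rewrite inE => Nx; rewrite (_ : (fun _ => _) = fun m => diffq F j (1 / m.+1%:R) x).
    apply: cvg_diffq_seq; [exact: dN'|by move=> m; rewrite div1r invr_neq0|].
    exact: cvg_invS0.
  by apply/funext => m; rewrite patchE mem_set.
rewrite (_ : (fun _ => _) = cst 0); first exact: cvg_cst.
by apply/funext => m; rewrite patchE (negbTE xN).
Qed.

Lemma shift_telescope (F : V -> R) j h m x :
  `|F (h *: basis_vec j + x) - F x| <=
  \sum_(i < m.+1) (`|h| / m.+1%:R) *
    `|diffq F j (h / m.+1%:R) (x + (i%:R * (h / m.+1%:R)) *: basis_vec j)|.
Proof.
have [->|h0] := eqVneq h 0.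
  by rewrite scale0r add0r subrr normr0 sumr_ge0// => i _; rewrite !mulr_ge0.
pose G i := F (x + (i%:R * (h / m.+1%:R)) *: basis_vec j).
have -> : F (h *: basis_vec j + x) - F x = \sum_(i < m.+1) (G i.+1 - G i).
  rewrite -(big_mkord xpredT (fun i => G i.+1 - G i)) telescope_sumr// /G.
  rewrite mul0r scale0r addr0 mulrCA divff ?mulr1 ?pnatr_eq0//.
  by rewrite [x + _]addrC.
rewrite (le_trans (ler_norm_sum _ _ _))//; apply: ler_sum => i _.
rewrite /diffq normrM normfV normf_div (ger0_norm (ler0n _ _)).
rewrite mulVKf; last by rewrite mulf_neq0 ?invr_eq0 ?normr_eq0.
rewrite /G addrCA -scalerDl (_ : _ + i%:R * _ = i.+1%:R * (h / m.+1%:R))//.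
by rewrite -natr1; ring.
Qed.

Local Open Scope ereal_scope.

Lemma integral_norm_shift_le (G : V -> R) j (s : R) (Q Q' : set V) :
  measurable_fun setT (G : L -> R) ->
  measurable (Q : set L) -> measurable (Q' : set L) ->
  (forall x, Q' x -> Q (x + s *: basis_vec j)%R) ->
  \int[lam]_(x in Q') `|G (x + s *: basis_vec j)%R|%:E <= \int[lam]_(x in Q) `|G x|%:E.
Proof.
move=> mG mQ mQ' QQ'; pose D := [set y | Q' (y - s *: basis_vec j)%R].
have mD : measurable (D : set L).
  by have := measurable_shift (- (s *: basis_vec j)) measurableT mQ'; rewrite setTI.
have mnG A : measurable_fun (A : set L) (fun x : L => `|G x|%:E).
  apply/measurable_EFinP; apply: measurable_funTS.
  exact: (measurableT_comp (@normr_measurable R setT) mG).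
have Q'E : Q' = [set x | D (x + s *: basis_vec j)%R].
  by apply/seteqP; split => x; rewrite /D/= addrK.
rewrite {1}Q'E (@ge0_integral_shift _ _ (s *: basis_vec j) D (fun x => `|G x|%:E))//.
apply: ge0_subset_integral => // x Dx.
by have := QQ' _ Dx; rewrite subrK.
Qed.

(** The displacement is cut into [m] equal steps; each contributes a difference
    quotient integrated over a translate of [Q'] inside [Q], and these converge to the
    partial derivative. *)
Lemma integral_shift_le l (F : V -> R) j (h : R) (Q Q' : set V) :
  is_lipschitz l F -> measurable (Q : set L) -> measurable (Q' : set L) ->
  lam Q < +oo ->
  (0 <= h)%R ->
  (forall x t, Q' x -> (0 <= t <= h)%R -> Q (x + t *: basis_vec j)%R) ->
  \int[lam]_(x in Q') `|F (h *: basis_vec j + x)%R - F x|%:E <=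
  h%:E * \int[lam]_(x in Q) `|partial F j x|%:E.
Proof.
move=> Fl mQ mQ' Qoo h0 QQ'; have Fc := lipschitz_continuous Fl.
have mnq s A : measurable_fun (A : set L) (fun x : L => `|diffq F j s x|%:E).
  apply/measurable_EFinP; apply: measurable_funTS.
  exact: (measurableT_comp (@normr_measurable R setT) (measurable_diffq j s Fc)).
have mnp A : measurable_fun (A : set L) (fun x : L => `|partial F j x|%:E).
  apply/measurable_EFinP; apply: measurable_funTS.
  exact: (measurableT_comp (@normr_measurable R setT) (measurable_partial j Fl)).
move: h0; rewrite le_eqVlt => /predU1P[<-|h0].
  rewrite mul0e integral0_eq// => x _; by rewrite scale0r add0r subrr normr0.
have step m : \int[lam]_(x in Q') `|F (h *: basis_vec j + x)%R - F x|%:E <=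
    h%:E * \int[lam]_(x in Q) `|diffq F j (h / m.+1%:R) x|%:E.
  pose s := (h / m.+1%:R)%R.
  have s0 : (0 < s)%R by rewrite divr_gt0.
  have mshift (i : nat) : measurable_fun (Q' : set L)
      (fun x : L => `|diffq F j s (x + (i%:R * s) *: basis_vec j)%R|%:E).
    apply: measurable_funTS.
    exact: (measurableT_comp (mnq s setT) (measurable_shift _)).
  apply: (@le_trans _ _ (\int[lam]_(x in Q') \sum_(i < m.+1)
      (s%:E * `|diffq F j s (x + (i%:R * s) *: basis_vec j)%R|%:E))).
    apply: ge0_le_integral.
    - exact: mQ'.
    - by move=> x _; rewrite lee_fin.
    - apply/measurable_EFinP; apply: measurable_funTS.
      apply: (measurableT_comp (@normr_measurable R setT)).
      apply: measurable_funB; last exact: continuous_measurable.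
      under eq_fun do rewrite addrC.
      exact: (measurableT_comp (continuous_measurable Fc) (measurable_shift _)).
    - apply: emeasurable_sum => i; apply: emeasurable_funM => //.
    - move=> x _; rewrite (eq_bigr (fun i : 'I_m.+1 => (s * `|diffq F j s
          (x + (i%:R * s) *: basis_vec j)%R|)%:E)) // sumEFin lee_fin.
      by have := shift_telescope F j h m x; rewrite (gtr0_norm h0).
  rewrite (@ge0_integral_sum _ L R lam Q' mQ' _ (fun (i : 'I_m.+1) (x : L) =>
    (s%:E * `|diffq F j s (x + (i%:R * s) *: basis_vec j)%R|%:E))); first last.
  - by move=> i x _; rewrite mule_ge0 ?lee_fin// ltW.
  - by move=> i; apply: emeasurable_funM; [exact: measurable_cst|exact: mshift].
  apply: (@le_trans _ _ (\sum_(i < m.+1)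
      (s%:E * \int[lam]_(x in Q) `|diffq F j s x|%:E))).
    apply: lee_sum => i _; rewrite ge0_integralZl//; last by rewrite lee_fin ltW.
    rewrite lee_wpmul2l ?lee_fin ?(ltW s0)//.
    apply: integral_norm_shift_le => //; first exact: measurable_diffq.
    move=> x Q'x; apply: QQ' => //; rewrite mulr_ge0 ?(ltW s0)//=.
    by rewrite /s mulrCA ler_piMr ?(ltW h0)// ler_pdivrMr// mul1r ler_nat ltnW.
  rewrite -ge0_sume_distrl; last by move=> i _; rewrite lee_fin ltW.
  rewrite sumEFin sumr_const card_ord.
  rewrite (_ : (s *+ m.+1)%R = h)//.
  by rewrite -mulr_natl /s mulrCA divff ?pnatr_eq0// mulr1.
have intl : lam.-integrable Q (fun=> `|l|%:E).
  apply/integrableP; split; first exact: measurable_cst.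
  rewrite integral_cst// lte_mul_pinfty//.
have [] := @dominated_convergence _ _ _ lam Q mQ
  (fun m x => `|diffq F j (h / m.+1%:R) x|%:E) (fun x => `|partial F j x|%:E)
  (fun=> `|l|%:E).
- by move=> m; exact: mnq.
- exact: mnp.
- have := lipschitz_ae_partial j Fl; apply: filterS.
    exact: (ae_filter_ringOfSetsType lam).
  move=> x dx Qx.
  apply: cvg_EFin; first exact: nearW.
  apply: cvg_norm; apply: cvg_diffq_seq => //; last exact: cvg_invS0.
  by move=> m; rewrite mulf_neq0 ?invr_neq0// gt_eqF.
- exact: intl.
- by apply/aeW => x m _; rewrite lee_fin normr_id; exact: diffq_lipschitz.
move=> _ _ cv.
have {}cv : (h%:E * \int[lam]_(x in Q) `|diffq F j (h / m.+1%:R) x|%:E)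
    @[m --> \oo] --> h%:E * \int[lam]_(x in Q) `|partial F j x|%:E.
  by apply: cvgeZl.
by apply: (cvge_ge _ cv); apply: nearW => m; exact: step.
Qed.

End partial_integrals.

(** * Dyadic cells *)

Section dyadic_cells.
Context {R : realType} {n : nat}.
Local Notation V := 'rV[R]_n.+1.
Local Notation lam := (@lebesgue R n).
Local Notation L := (caratheodory_type (@lebesgue_outer R n)).
Local Notation N := n.+1.

(** A cube is bisected in the coordinate directions in turn, [side len k] being the edges
    of the boxes after [k] bisections. A box then has two children only, and these are
    translates of each other along a single axis. *)
Definition dir (k : nat) : 'I_N := inord (k %% N).

Fixpoint side (len : R) (k : nat) : V :=
  if k is k'.+1 then
    upd (side len k') (dir k') (side len k' ord0 (dir k') / 2)
  else const_mx len.

(** The longest edge; all edges lie between half of it and itself. *)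
Definition scale (len : R) (k : nat) : R := len / 2 ^+ (k %/ N).

Definition half (len : R) (k : nat) : R := side len k ord0 (dir k) / 2.

Definition cell (len : R) (k : nat) (a : V) : set V := box a (a + side len k).

Definition sibling (len : R) (k : nat) (a : V) : V := a + half len k *: basis_vec (dir k).

Definition center (len : R) (k : nat) (a : V) : V := a + 2^-1 *: side len k.

(** The descendants of the cube [cell len 0 a0], named by their lowest corners. *)
Inductive corner (len : R) (a0 : V) : nat -> V -> Prop :=
| corner0 : corner len a0 0 a0
| corner_left k a : corner len a0 k a -> corner len a0 k.+1 a
| corner_right k a : corner len a0 k a -> corner len a0 k.+1 (sibling len k a).

Variable len : R.
Hypothesis len0 : 0 < len.

Lemma val_dir k : dir k = (k %% N)%N :> nat.
Proof. by rewrite /dir inordK// ltn_pmod. Qed.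

Lemma sideE k i : side len k ord0 i = len / 2 ^+ (k %/ N + (i < k %% N)).
Proof.
elim: k i => [|k IH] i /=; first by rewrite mxE div0n ?mod0n ?ltn0 expr0 divr1.
rewrite updE !IH val_dir ltnn addn0.
have kN : (k %% N < N)%N by rewrite ltn_pmod.
have Ek := divn_eq k N.
have [km|km] := eqVneq (k %% N)%N n.
  have [d m] : (k.+1 %/ N = (k %/ N).+1)%N /\ (k.+1 %% N = 0)%N.
    have -> : k.+1 = ((k %/ N).+1 * N)%N by rewrite mulSn {1}Ek km; lia.
    by rewrite mulnK// modnMl.
  rewrite d m ltn0 addn0 exprSr invfM mulrA.
  case: eqVneq => [_//|ni].
  have -> : (i < k %% N)%N.
    rewrite km ltn_neqAle -ltnS ltn_ord andbT; apply: contra ni => /eqP ii.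
    by apply/eqP/ord_inj; rewrite val_dir km.
  by rewrite addn1 exprSr invfM mulrA.
have km' : ((k %% N).+1 < N)%N by lia.
have [d m] : (k.+1 %/ N = k %/ N)%N /\ (k.+1 %% N = (k %% N).+1)%N.
  have -> : k.+1 = (k %/ N * N + (k %% N).+1)%N by lia.
  rewrite divnMDl// (divn_small km') addn0 modnMDl (modn_small km'); split=> //.
rewrite d m; case: eqVneq => [->|ni].
  by rewrite val_dir leqnn addn1 exprSr invfM mulrA.
congr (_ / 2 ^+ (_ + _)); rewrite ltnS [in RHS]leq_eqVlt; case: eqVneq => //= ik.
by case/negP: ni; apply/eqP/ord_inj; rewrite val_dir ik.
Qed.

Lemma sideS k : side len k.+1 =
  upd (side len k) (dir k) (side len k ord0 (dir k) / 2).
Proof. by []. Qed.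

Lemma scale_gt0 k : 0 < scale len k.
Proof. by rewrite divr_gt0// exprn_gt0. Qed.

Lemma side_le_scale k i : side len k ord0 i <= scale len k.
Proof.
rewrite sideE /scale ler_pM2l// lef_pV2 ?posrE ?exprn_gt0//.
by rewrite ler_weXn2l ?ler1n// leq_addr.
Qed.

Lemma scale_half_le_side k i : scale len k / 2 <= side len k ord0 i.
Proof.
rewrite sideE /scale -mulrA ler_pM2l// -invfM -exprSr lef_pV2 ?posrE ?exprn_gt0//.
by rewrite ler_weXn2l ?ler1n//; case: (_ < _)%N; rewrite ?addn1 ?addn0.
Qed.

Lemma side_gt0 k i : 0 < side len k ord0 i.
Proof. by apply: lt_le_trans (scale_half_le_side _ _); rewrite divr_gt0 ?scale_gt0. Qed.

Lemma half_gt0 k : 0 < half len k.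
Proof. by rewrite /half divr_gt0// side_gt0. Qed.

Lemma half_le_side k : half len k <= side len k ord0 (dir k).
Proof. by rewrite /half ler_pdivrMr// ler_peMr ?ler1n// ltW// side_gt0. Qed.

Lemma half_le_scale k : half len k <= scale len k.
Proof. exact: le_trans (half_le_side k) (side_le_scale k (dir k)). Qed.

Lemma scale_le_double k : scale len k <= 2 * scale len k.+1.
Proof.
rewrite /scale mulrCA ler_pM2l//.
have : (k.+1 %/ N <= (k %/ N).+1)%N.
  apply: (@leq_trans ((k + N) %/ N)%N); first by rewrite leq_div2r//; lia.
  by rewrite divnDr ?dvdnn// divnn addn1.
move=> h; apply: (@le_trans _ _ (2 * (2 ^+ (k %/ N).+1)^-1)).
  by rewrite exprS invfM mulVKf.
by rewrite ler_pM2l// lef_pV2 ?posrE ?exprn_gt0// ler_weXn2l ?ler1n.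
Qed.

Lemma scaleN_le k : (scale len k) ^+ N <= len ^+ N * 2 ^+ n / 2 ^+ k.
Proof.
rewrite /scale expr_div_n -mulrA ler_pM2l ?exprn_gt0// -exprM.
rewrite ler_pdivlMr ?exprn_gt0// mulrC ler_pdivrMr ?exprn_gt0// -exprD.
rewrite ler_weXn2l ?ler1n//.
have := divn_eq k N; have : (k %% N < N)%N by rewrite ltn_pmod.
lia.
Qed.

Lemma measurable_cell k a : measurable (cell len k a : set L).
Proof. exact: measurable_box. Qed.

Lemma cell_left k a :
  cell len k a `&` [set x | x ord0 (dir k) < a ord0 (dir k) + half len k] =
  cell len k.+1 a.
Proof.
rewrite /cell box_setI_lt; congr box; apply/rowP => i; rewrite !mxE /=.
case: eqVneq => [->|//]; rewrite min_r ?lerD2l//.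
exact: half_le_side.
Qed.

Lemma cell_right k a :
  cell len k a `&` [set x | a ord0 (dir k) + half len k <= x ord0 (dir k)] =
  cell len k.+1 (sibling len k a).
Proof.
rewrite /cell box_setI_ge.
have -> : upd a (dir k) (Num.max (a ord0 (dir k)) (a ord0 (dir k) + half len k)) =
    sibling len k a.
  apply/rowP => i; rewrite !mxE eqxx/=; case: eqVneq => [->|_].
    by rewrite mulr1 max_r// lerDl ltW// half_gt0.
  by rewrite mulr0 addr0.
have -> // : sibling len k a + side len k.+1 = a + side len k.
apply/rowP => i; rewrite sideS !mxE eqxx/=; case: eqVneq => [->|_].
  by rewrite mulr1 /half -addrA -splitr.
by rewrite mulr0 addr0.
Qed.

(** A cell is half-open, so that its two children partition it. *)
Lemma cell_split k a :
  cell len k a = cell len k.+1 a `|` cell len k.+1 (sibling len k a).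
Proof.
rewrite -cell_left -cell_right -setIUr; apply/esym/setIidl => x _ /=.
by case: (ltP (x ord0 (dir k)) (a ord0 (dir k) + half len k)) => h; [left|right].
Qed.

Lemma cell_disjoint k a :
  cell len k.+1 a `&` cell len k.+1 (sibling len k a) = set0.
Proof.
rewrite -cell_left -cell_right -subset0 => x [[_ /= h1] [_ /= h2]].
by have := lt_le_trans h1 h2; rewrite ltxx.
Qed.

Lemma cell_left_sub k a : cell len k.+1 a `<=` cell len k a.
Proof. by rewrite (cell_split k a); left. Qed.

Lemma cell_right_sub k a : cell len k.+1 (sibling len k a) `<=` cell len k a.
Proof. by rewrite (cell_split k a); right. Qed.

Lemma corner_sub a0 k a : corner len a0 k a -> cell len k a `<=` cell len 0 a0.
Proof.
elim=> {k a} [//|k a _|k a _]; apply: subset_trans.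
  exact: cell_left_sub.
exact: cell_right_sub.
Qed.

Lemma cell_shift k a v :
  cell len k (a + v) = [set x | cell len k a (x - v)].
Proof.
apply/seteqP; split => x /= abx i; have := abx i; rewrite !mxE.
  by rewrite lerBrDr ltrBlDr addrAC.
by rewrite lerBrDr ltrBlDr addrAC.
Qed.

Lemma lebesgue_cell_shift k a v : lam (cell len k (a + v)) = lam (cell len k a).
Proof. by rewrite cell_shift (lebesgue_shift (- v)). Qed.

Lemma cell_fin k a : lam (cell len k a) \is a fin_num.
Proof. by rewrite ge0_fin_numE ?measure_ge0// lebesgue_box_lty. Qed.

Lemma lebesgue_cell_split k a :
  (lam (cell len k a) = lam (cell len k.+1 a) *+ 2)%E.
Proof.
transitivity (lam (cell len k.+1 a) + lam (cell len k.+1 (sibling len k a)))%E.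
  rewrite cell_split; exact: (measureU lam (measurable_cell _ _)
    (measurable_cell _ _) (cell_disjoint _ _)).
by rewrite /sibling lebesgue_cell_shift mule2n.
Qed.

Lemma lebesgue_cellE a0 k a : corner len a0 k a ->
  fine (lam (cell len k a)) = fine (lam (cell len 0 a0)) / 2 ^+ k.
Proof.
have halve m b : fine (lam (cell len m.+1 b)) = fine (lam (cell len m b)) / 2.
  rewrite (lebesgue_cell_split m b); have /EFin_fin_numP[u ->] := cell_fin m.+1 b.
  by rewrite mule2n /=; lra.
elim=> {k a} [|k a _ IH|k a _ IH]; first by rewrite expr0 divr1.
  by rewrite exprSr invfM mulrA -IH halve.
by rewrite /sibling lebesgue_cell_shift exprSr invfM mulrA -IH halve.
Qed.

Lemma center_in_cell k a : cell len k a (center len k a).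
Proof.
move=> i; rewrite !mxE; have := side_gt0 k i => s0.
by apply/andP; split; lra.
Qed.

Lemma enorm_coord_le (v : V) i : `|v ord0 i| <= enorm v.
Proof.
rewrite /enorm -sqrtr_sqr ler_wsqrtr// (bigD1 i)//= lerDl sumr_ge0// => j _.
exact: sqr_ge0.
Qed.

Lemma enorm_lt (v : V) (c : R) : 0 < c -> (forall i, `|v ord0 i| <= c) ->
  enorm v < 2 * N%:R * c.
Proof.
move=> c0 vc; rewrite /enorm.
apply: (@lt_le_trans _ _ (Num.sqrt ((2 * N%:R * c) ^+ 2))); last first.
  by rewrite sqrtr_sqr ger0_norm// !mulr_ge0// ltW.
rewrite ltr_sqrt; last by rewrite exprn_gt0// !mulr_gt0.
apply: (@le_lt_trans _ _ (\sum_(i < N) c ^+ 2)).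
  by apply: ler_sum => i _; rewrite -[leLHS]real_normK ?num_real// lerXn2r ?nnegrE// ltW.
rewrite sumr_const card_ord -[ltLHS]mulr_natl exprMn ltr_pM2r ?exprn_gt0//.
have N1 : 1 <= N%:R :> R by rewrite ler1n.
by nra.
Qed.

Lemma cell_coord_dist k a x y i : cell len k a x -> cell len k a y ->
  `|x ord0 i - y ord0 i| <= scale len k.
Proof.
move=> /(_ i) /andP[ax xb] /(_ i) /andP[ay yb].
have := side_le_scale k i; move: xb yb; rewrite !mxE => xb yb s.
by rewrite ler_norml; apply/andP; split; lra.
Qed.

Lemma cell_enorm_dist k a x y : cell len k a x -> cell len k a y ->
  enorm (x - y) < 2 * N%:R * scale len k.
Proof.
move=> xa ya; apply: enorm_lt; first exact: scale_gt0.
by move=> i; rewrite !mxE; exact: cell_coord_dist xa ya.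
Qed.

(** A cell contains a ball of comparable size because its edges are at least half of its
    scale. *)
Lemma ball_sub_cell k a x : enorm (x - center len k a) < scale len k / 4 ->
  cell len k a x.
Proof.
move=> xc i; have := le_lt_trans (enorm_coord_le _ i) xc.
have := scale_half_le_side k i; rewrite !mxE ltr_norml => s /andP[h1 h2].
by apply/andP; split; lra.
Qed.

Lemma ball_sub_box (c x : V) r : enorm (x - c) < r ->
  box (c - const_mx r) (c + const_mx r) x.
Proof.
move=> xc i; have := le_lt_trans (enorm_coord_le _ i) xc.
by rewrite !mxE ltr_norml => /andP[h1 h2]; apply/andP; split; lra.
Qed.

End dyadic_cells.

(** * Weighted norms *)

Section integral_comparison.
Local Open Scope ereal_scope.

(** The integral of a nonnegative function is the supremum of those of the simple functions
    below it. Hence [g] may be nonmeasurable, as is conceivable for the densities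
    [Qnorm Q x (k x) `^ p]. *)
Lemma le_integral_lower d (T : measurableType d) (R : realType)
    (mu : {measure set T -> \bar R}) (D : set T) (f g : T -> \bar R) :
  measurable D -> measurable_fun D f ->
  (forall x, D x -> 0 <= f x) -> (forall x, D x -> 0 <= g x) ->
  {ae mu, forall x, D x -> f x <= g x} ->
  \int[mu]_(x in D) f x <= \int[mu]_(x in D) g x.
Proof.
move=> mD mf f0 g0 [N [mN N0 fgN]].
rewrite (ge0_negligible_integral mN mD mf f0 N0).
rewrite ge0_integralE; last by move=> x [Dx _]; exact: f0.
rewrite ge0_integralE//; apply: ge_ereal_sup => _ [h hf <-]; apply: ereal_sup_ubound.
exists h => // x; apply: le_trans (hf x) _; rewrite /= !patchE.
case: ifPn => [|_]; last by case: ifPn => // /[1!inE]; exact: g0.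
rewrite inE => -[Dx Nx]; rewrite mem_set//.
apply: contrapT => nfg; apply: Nx; apply: fgN => /= /(_ Dx); exact: nfg.
Qed.

End integral_comparison.

(** As for [le_integral_lower]: a simple function below [f] on [A] is also below [f] on
    [B]. *)
Lemma le_integral_subset_lower d (T : measurableType d) (R : realType)
    (mu : {measure set T -> \bar R}) (A B : set T) (f : T -> \bar R) :
  A `<=` B -> (forall x, B x -> 0 <= f x)%E ->
  (\int[mu]_(x in A) f x <= \int[mu]_(x in B) f x)%E.
Proof.
move=> AB f0; rewrite ge0_integralE; last by move=> x /AB; exact: f0.
rewrite ge0_integralE//; apply: ge_ereal_sup => _ [h hf <-].
apply: ereal_sup_ubound; exists h => // x; apply: le_trans (hf x) _.
rewrite !patchE; case: ifPn => [|_]; last by case: ifPn => // /[1!inE]; exact: f0.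
by rewrite inE => /AB Bx; rewrite mem_set.
Qed.

Lemma cvg_powR (R : realType) (u : R^nat) (l r : R) : 0 < r ->
  (forall k, 0 <= u k) -> u @ \oo --> l -> u k `^ r @[k --> \oo] --> l `^ r.
Proof.
move=> r0 u0 ul.
have : 0 <= l by apply: (cvgr_to_ge ul); exact: nearW.
rewrite le_eqVlt => /predU1P[l0|l0]; last first.
  have pc : {for l, continuous (fun y : R => y `^ r)}.
    apply: differentiable_continuous; apply/derivable1_diffP.
    by apply: derivable_powR; rewrite in_itv/= l0.
  exact: (cvg_comp _ _ ul pc).
rewrite -l0 powR0 ?gt_eqF//; apply/cvgrPdist_lt => e e0.
have er0 : 0 < e `^ r^-1 by rewrite powR_gt0.
move/cvgrPdist_lt : ul => /(_ _ er0); apply: filterS => k.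
rewrite -l0 !sub0r !normrN !ger0_norm ?powR_ge0// => uk.
rewrite [ltRHS](_ : e = (e `^ r^-1) `^ r); last first.
  by rewrite -powRrM mulVf ?gt_eqF// powRr1// ltW.
by apply: gt0_ltr_powR => //; rewrite nnegrE// ltW.
Qed.

Lemma le_poweR (R : realType) (x y : \bar R) (r : R) : 0 <= r -> (0 <= x)%E ->
  (x <= y)%E -> (x `^ r <= y `^ r)%E.
Proof.
move=> r0 x0 xy; apply: gt0_ler_poweR => //; rewrite in_itv/= leey andbT//.
exact: le_trans xy.
Qed.

Section weighted_norm.
Context d (T : measurableType d) (R : realType) (mu : {measure set T -> \bar R}).

(** The norm of [L^r] with respect to the measure of density [tau]. *)
Definition wnorm (tau : T -> R) (r : R) (E : set T) (f : T -> R) : \bar R :=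
  (\int[mu]_(x in E) (`|f x| `^ r * tau x)%:E) `^ r^-1.

Variables (tau : T -> R) (r : R) (E : set T).
Hypothesis r1 : 1 <= r.
Hypothesis mE : measurable E.
Hypothesis mtau : measurable_fun E tau.
Hypothesis tau0 : forall x, E x -> 0 <= tau x.

Implicit Types f g : T -> R.
Local Notation mfun f := (measurable_fun E f).
Local Notation norm f := (wnorm tau r E f).

Let r0 : 0 < r. Proof. exact: lt_le_trans r1. Qed.

Lemma measurable_powRr (D : set T) (f : T -> R) s :
  measurable_fun D f -> measurable_fun D (fun x => f x `^ s).
Proof. exact: (@measurableT_comp _ _ _ _ _ _ (@powR R ^~ s)). Qed.

Lemma measurable_normRr (D : set T) (f : T -> R) :
  measurable_fun D f -> measurable_fun D (fun x => `|f x|).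
Proof. exact: (measurableT_comp (@normr_measurable R setT)). Qed.

Lemma measurable_weighted_power f : mfun f ->
  measurable_fun E (fun x => (`|f x| `^ r * tau x)%:E).
Proof.
move=> mf; apply/measurable_EFinP; apply: measurable_funM => //.
exact/measurable_powRr/measurable_normRr.
Qed.

Local Open Scope ereal_scope.

Lemma weighted_power_ge0 f x : E x -> 0 <= (`|f x| `^ r * tau x)%:E.
Proof. by move=> Ex; rewrite lee_fin mulr_ge0 ?powR_ge0 ?tau0. Qed.

Lemma weighted_integral_ge0 f : 0 <= \int[mu]_(x in E) (`|f x| `^ r * tau x)%:E.
Proof. by apply: integral_ge0 => x; exact: weighted_power_ge0. Qed.

Lemma wnorm_ge0 f : 0 <= norm f.
Proof. exact: poweR_ge0. Qed.

Lemma wnorm_powE f :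
  norm f `^ r = \int[mu]_(x in E) (`|f x| `^ r * tau x)%:E.
Proof.
rewrite /wnorm -poweRrM mulVf ?gt_eqF// poweRe1//.
exact: weighted_integral_ge0.
Qed.

Lemma wnorm_le_pow f (c : R) : (0 <= c)%R ->
  (norm f <= c%:E) = (\int[mu]_(x in E) (`|f x| `^ r * tau x)%:E <= (c `^ r)%:E).
Proof.
move=> c0; rewrite -wnorm_powE; apply/idP/idP => h.
  by rewrite -poweR_EFin le_poweR ?(ltW r0)// wnorm_ge0.
have -> : norm f = (norm f `^ r) `^ r^-1.
  by rewrite -poweRrM divff ?gt_eqF// poweRe1// wnorm_ge0.
have -> : c%:E = ((c `^ r)%:E) `^ r^-1.
  by rewrite poweR_EFin -powRrM divff ?gt_eqF// powRr1.
by rewrite le_poweR ?invr_ge0 ?(ltW r0)// poweR_ge0.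
Qed.

Lemma wnormE f :
  norm f = 'N[mu]_r%:E[EFin \o ((fun x => f x * tau x `^ r^-1)%R \_ E)].
Proof.
rewrite unlock /Lnorm/= /wnorm; congr (_ `^ _).
rewrite integral_mkcond; apply: eq_integral => x _ /=.
rewrite !patchE; case: ifPn => [|_]; last by rewrite normr0 powR0 ?gt_eqF.
rewrite inE => Ex; rewrite normrM powRM// (ger0_norm (powR_ge0 _ _)).
by rewrite -powRrM mulVf ?gt_eqF// powRr1// tau0.
Qed.

Lemma measurable_weighted f : mfun f ->
  measurable_fun [set: T] ((fun x => f x * tau x `^ r^-1)%R \_ E).
Proof.
move=> mf; apply/(measurable_restrictT _ mE); apply: measurable_funM => //.
exact: measurable_powRr.
Qed.

Lemma wnormD f g : mfun f -> mfun g ->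
  norm (f \+ g)%R <= norm f + norm g.
Proof.
move=> mf mg; rewrite !wnormE.
rewrite (_ : (_ \_ E) = ((fun x => f x * tau x `^ r^-1) \_ E \+
   (fun x => g x * tau x `^ r^-1) \_ E)%R).
  exact: (minkowski_EFin mu (measurable_weighted mf) (measurable_weighted mg) r1).
by apply/funext => x /=; rewrite !patchE; case: ifPn => _; rewrite ?addr0// mulrDl.
Qed.

Lemma wnorm_le f g : mfun f -> mfun g ->
  (forall x, E x -> `|f x| <= `|g x|)%R -> norm f <= norm g.
Proof.
move=> mf mg fg; apply: le_poweR; first by rewrite invr_ge0 ltW.
  exact: weighted_integral_ge0.
apply: ge0_le_integral => //.
- exact: weighted_power_ge0.
- exact: measurable_weighted_power.
- exact: measurable_weighted_power.
move=> x Ex; rewrite lee_fin ler_wpM2r ?tau0// ge0_ler_powR ?nnegrE ?(ltW r0)//.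
exact: fg.
Qed.

Lemma eq_wnorm f g : (forall x, E x -> f x = g x) -> norm f = norm g.
Proof.
move=> fg; rewrite /wnorm (eq_integral (fun x => (`|g x| `^ r * tau x)%:E))//.
by move=> x; rewrite inE => Ex; rewrite fg.
Qed.

Lemma wnormN f : norm (\- f)%R = norm f.
Proof.
rewrite /wnorm (eq_integral (fun x => (`|f x| `^ r * tau x)%:E))//.
by move=> x _; rewrite normrN.
Qed.

Lemma wnormB f g : mfun f -> mfun g ->
  norm (f \- g)%R <= norm f + norm g.
Proof.
move=> mf mg; rewrite -(wnormN g).
by apply: (@wnormD f (\- g)%R) => //; exact: measurableT_comp.
Qed.

Lemma wnorm_dist f g h : mfun f -> mfun g -> mfun h ->
  norm (f \- h)%R <= norm (f \- g)%R + norm (g \- h)%R.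
Proof.
move=> mf mg mh.
rewrite (@eq_wnorm (f \- h)%R ((f \- g) \+ (g \- h))%R).
  by apply: wnormD; exact: measurable_funB.
by move=> x _ /=; rewrite addrA subrK.
Qed.

Lemma wnorm_distC f g : norm (f \- g)%R = norm (g \- f)%R.
Proof.
by rewrite -wnormN; apply: eq_wnorm => x _ /=; rewrite opprB.
Qed.

Lemma wnorm0 : norm (cst 0%R) = 0.
Proof.
rewrite /wnorm integral0_eq ?poweR0r ?invr_neq0 ?gt_eqF//.
by move=> x _; rewrite /= normr0 powR0 ?gt_eqF// mul0r.
Qed.

Lemma wnorm_sum (f : nat -> T -> R) (c : nat -> R) k m :
  (k <= m)%N -> (forall i, mfun (f i)) ->
  (forall i, (k <= i)%N -> norm (f i.+1 \- f i)%R <= (c i)%:E) ->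
  norm (f m \- f k)%R <= (\sum_(k <= i < m) c i)%:E.
Proof.
move=> km mf fc; elim: m km => [|m IH].
  rewrite leqn0 => /eqP ->; rewrite big_geq// (@eq_wnorm _ (cst 0%R)).
    by rewrite wnorm0.
  by move=> x _ /=; rewrite subrr.
rewrite leq_eqVlt => /predU1P[->|].
  rewrite big_geq// (@eq_wnorm _ (cst 0%R)) ?wnorm0//.
  by move=> x _ /=; rewrite subrr.
rewrite ltnS => km; rewrite big_nat_recr//= EFinD addeC.
apply: le_trans (wnorm_dist (mf _) (mf m) (mf _)) _.
by apply: leeD; [exact: fc|exact: IH].
Qed.

(** Fatou's lemma; the norm only sees the points at which the weight is positive. *)
Lemma wnorm_fatou (h : nat -> T -> R) (f : T -> R) (c : R) :
  (0 <= c)%R -> (forall k, mfun (h k)) -> mfun f ->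
  {ae mu, forall x, E x -> tau x != 0%R -> h k x @[k --> \oo] --> f x} ->
  (forall k, norm (h k) <= c%:E) -> norm f <= c%:E.
Proof.
move=> c0 mh mf hf hc; rewrite wnorm_le_pow//.
pose H k x := (`|h k x| `^ r * tau x)%:E.
apply: (@le_trans _ _ (\int[mu]_(x in E) limn_einf (H ^~ x))).
  apply: le_integral_lower => //.
  - exact: measurable_weighted_power.
  - exact: weighted_power_ge0.
  - move=> x Ex; rewrite limn_einf_lim; apply: lime_ge; first exact: is_cvg_einfs.
    by apply: nearW => k; apply: le_ereal_inf_tmp => _ [m _ <-]; exact: weighted_power_ge0.
  apply: filterS hf => x hx Ex; have [t0|t0] := eqVneq (tau x) 0%R.
    rewrite (_ : H ^~ x = cst 0) ?t0 ?mulr0; last first.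
      by apply/funext => k; rewrite /H t0 mulr0.
    by rewrite (_ : limn_einf _ = 0)//; apply: (cvg_limn_einf_sup (cvg_cst 0)).1.
  have Hx : H k x @[k --> \oo] --> (`|f x| `^ r * tau x)%:E.
    apply: cvg_EFin; first exact: nearW.
    apply: cvgM; last exact: cvg_cst.
    by apply: cvg_powR => //; apply: cvg_norm; exact: hx.
  by rewrite (cvg_limn_einf_sup Hx).1.
apply: le_trans (fatou _ _ _ _) _ => //.
- by move=> k; exact: measurable_weighted_power.
- by move=> k x; exact: weighted_power_ge0.
rewrite limn_einf_lim; apply: lime_le; first exact: is_cvg_einfs.
apply: nearW => k; apply: ereal_inf_le; exists (\int[mu]_(x in E) H k x).
  by exists k => /=.
by rewrite -wnorm_le_pow.
Qed.

End weighted_norm.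

Section weighted_norm_sets.
Context d (T : measurableType d) (R : realType) (mu : {measure set T -> \bar R}).
Variables (tau : T -> R).
Implicit Types (f : T -> R) (r s : R) (A B E : set T).
Local Open Scope ereal_scope.

Lemma wnorm_patch r A E f : (0 < r)%R -> A `<=` E ->
  wnorm mu tau r E (f \_ A) = wnorm mu tau r A f.
Proof.
move=> r0 AE.
suff intE : \int[mu]_(x in E) (`|(f \_ A) x| `^ r * tau x)%:E =
    \int[mu]_(x in A) (`|f x| `^ r * tau x)%:E by rewrite /wnorm intE.
rewrite integral_mkcond [RHS]integral_mkcond; apply: eq_integral => x _.
rewrite !patchE; have [xA|xA] := boolP (x \in A).
  by rewrite mem_set//; apply: AE; rewrite inE in xA.
by case: ifPn => // _; rewrite normr0 powR0 ?gt_eqF// mul0r.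
Qed.

Lemma wnorm_subset r A E f : (1 <= r)%R -> measurable A -> measurable E ->
  measurable_fun E tau -> (forall x, E x -> (0 <= tau x)%R) ->
  measurable_fun E f -> A `<=` E ->
  wnorm mu tau r A f <= wnorm mu tau r E f.
Proof.
move=> r1 mA mE mtau tau0 mf AE; rewrite /wnorm; apply: le_poweR.
- by rewrite invr_ge0 (le_trans _ r1).
- apply: integral_ge0 => x /AE Ex.
  by rewrite lee_fin mulr_ge0 ?powR_ge0 ?tau0.
apply: ge0_subset_integral => //; first exact: measurable_weighted_power.
by move=> x Ex; rewrite lee_fin mulr_ge0 ?powR_ge0 ?tau0.
Qed.

Lemma wnorm_setU r A B f : (1 <= r)%R -> measurable A -> measurable B ->
  measurable_fun (A `|` B) tau -> (forall x, (A `|` B) x -> (0 <= tau x)%R) ->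
  measurable_fun (A `|` B) f ->
  wnorm mu tau r (A `|` B) f <= wnorm mu tau r A f + wnorm mu tau r B f.
Proof.
move=> r1 mA mB mtau tau0 mf.
have r0 : (0 < r)%R by exact: lt_le_trans r1.
have mAB : measurable (A `|` B) by exact: measurableU.
have mp C : measurable C -> C `<=` A `|` B -> measurable_fun (A `|` B) (f \_ C).
  move=> mC CAB; apply/measurable_restrict => //.
  by rewrite setIidr//; exact: measurable_funS mf.
have AAB : A `<=` A `|` B by left.
have BAB : B `<=` A `|` B by right.
have mpA := mp _ mA AAB; have mpB := mp _ mB BAB.
have mnA := measurable_normRr mpA; have mnB := measurable_normRr mpB.
apply: (@le_trans _ _ (wnorm mu tau r (A `|` B)
    ((fun x => `|(f \_ A) x|) \+ (fun x => `|(f \_ B) x|))%R)).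
  apply: wnorm_le => //; first exact: measurable_funD.
  move=> x ABx /=; rewrite [leRHS]ger0_norm ?addr_ge0// !patchE.
  by case: ABx => xC; rewrite (mem_set xC) ?lerDl ?lerDr.
apply: le_trans (wnormD mu r1 mAB mtau tau0 mnA mnB) _.
have absE C : C `<=` A `|` B -> measurable_fun (A `|` B) (f \_ C) ->
    wnorm mu tau r (A `|` B) (fun x => `|(f \_ C) x|)%R = wnorm mu tau r C f.
  move=> CAB mC; rewrite -(wnorm_patch _ r0 CAB) /wnorm.
  rewrite (eq_integral (fun x => (`|(f \_ C) x| `^ r * tau x)%:E))//.
  by move=> x _; rewrite normr_id.
by rewrite !absE.
Qed.

(** Where [`|f x| <= c] the power [`|f x| `^ r] is at most [c `^ r], and elsewhere it is at
    most [c `^ (r - s) * `|f x| `^ s]; both integrals are controlled. *)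
Lemma wnorm_exponent r s E f (c t : R) : (1 <= r)%R -> (r <= s)%R -> (0 < c)%R ->
  measurable E -> measurable_fun E tau -> (forall x, E x -> (0 <= tau x)%R) ->
  measurable_fun E f ->
  \int[mu]_(x in E) (tau x)%:E <= t%:E -> (0 <= t)%R ->
  wnorm mu tau s E f <= c%:E -> wnorm mu tau r E f <= (c * (t + 1) `^ r^-1)%:E.
Proof.
move=> r1 rs c0 mE mtau tau0 mf taut t0.
have s1 := le_trans r1 rs.
have r0 : (0 < r)%R by exact: lt_le_trans r1.
rewrite wnorm_le_pow ?(ltW c0)// => fs.
have t1 : (0 <= t + 1)%R by rewrite addr_ge0.
rewrite wnorm_le_pow ?mulr_ge0 ?powR_ge0 ?(ltW c0)//.
rewrite powRM ?powR_ge0 ?(ltW c0)// -powRrM mulVf ?gt_eqF// powRr1//.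
have mt : measurable_fun E (fun x => (tau x)%:E) by exact/measurable_EFinP.
have mw q := @measurable_weighted_power _ _ _ tau q E mtau f mf.
have pw (y : R) : (0 <= y -> y `^ r <= c `^ r + c `^ (r - s) * y `^ s)%R.
  move=> y0; have [yc|cy] := leP y c.
    rewrite ler_wpDr ?mulr_ge0 ?powR_ge0// ge0_ler_powR ?nnegrE ?(ltW r0)//.
    exact: ltW.
  rewrite ler_wpDl ?powR_ge0//.
  have y1 : (0 < y)%R by exact: lt_trans cy.
  rewrite [leLHS](_ : _ = y `^ (r - s) * y `^ s)%R; last first.
    by rewrite -powRD ?subrK// (gt_eqF y1) implybT.
  rewrite ler_wpM2r ?powR_ge0// -opprB !powRN lef_pV2 ?posrE ?powR_gt0//.
  by rewrite ge0_ler_powR ?nnegrE ?subr_ge0 ?(ltW c0) ?(ltW y1) ?(ltW cy).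
apply: (@le_trans _ _ (\int[mu]_(x in E) ((c `^ r)%:E * (tau x)%:E +
    (c `^ (r - s))%:E * (`|f x| `^ s * tau x)%:E))).
  apply: ge0_le_integral => //.
  - by move=> x Ex; rewrite lee_fin mulr_ge0 ?powR_ge0 ?tau0.
  - by apply: emeasurable_funD; apply: emeasurable_funM.
  move=> x Ex; rewrite -!EFinM -EFinD lee_fin mulrA -mulrDl ler_wpM2r ?tau0//.
  exact: pw.
have cr0 q : 0 <= (c `^ q)%:E by rewrite lee_fin powR_ge0.
have t0E x : E x -> 0 <= (tau x)%:E by move=> Ex; rewrite lee_fin tau0.
have f0E x : E x -> 0 <= (`|f x| `^ s * tau x)%:E.
  by move=> Ex; rewrite lee_fin mulr_ge0 ?powR_ge0 ?tau0.
rewrite ge0_integralD//; [|by move=> x Ex; rewrite mule_ge0 ?t0E|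
  by apply: emeasurable_funM|by move=> x Ex; rewrite mule_ge0 ?f0E|
  by apply: emeasurable_funM].
rewrite ge0_integralZl// ge0_integralZl//.
rewrite mulrDr mulr1 EFinD leeD//.
  by rewrite EFinM lee_wpmul2l// lee_fin powR_ge0.
apply: (@le_trans _ _ ((c `^ (r - s))%:E * (c `^ s)%:E)).
  by rewrite lee_wpmul2l// lee_fin powR_ge0.
by rewrite -EFinM -powRD ?subrK// gt_eqF ?implybT.
Qed.

(** Riesz-Fischer for a geometrically Cauchy sequence. The sum [S] of the absolute
    increments has finite norm, hence is finite where the weight is positive. *)
Lemma wnorm_geometric_limit r E (h : nat -> T -> R) :
  (1 <= r)%R -> measurable E -> measurable_fun E tau ->
  (forall x, E x -> (0 <= tau x)%R) ->
  (forall k, measurable_fun E (h k)) ->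
  (forall k, wnorm mu tau r E (h k.+1 \- h k)%R <= (2^-1 ^+ k)%:E) ->
  exists u : T -> R, [/\ measurable_fun E u,
    {ae mu, forall x, E x -> tau x != 0%R -> h k x @[k --> \oo] --> u x} &
    forall k, wnorm mu tau r E (u \- h k)%R <= (2 * 2^-1 ^+ k)%:E].
Proof.
move=> r1 mE mtau tau0 mh hinc.
have r0 : (0 < r)%R by exact: lt_le_trans r1.
have geo k m : (\sum_(k <= i < m) 2^-1 ^+ i <= 2 * 2^-1 ^+ k :> R)%R.
  have [mk|km] := leqP m k; first by rewrite big_geq// mulr_ge0.
  have -> : (\sum_(k <= i < m) 2^-1 ^+ i = 2 * 2^-1 ^+ k - 2 * 2^-1 ^+ m :> R)%R.
    elim: m km => // m IH; rewrite ltnS leq_eqVlt => /predU1P[->|km].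
      by rewrite big_nat1 [in RHS]exprS; field.
    by rewrite big_nat_recr/= ?(ltnW km)// IH// [in RHS]exprS; field.
  by rewrite gerBl mulr_ge0.
have hdist k m : (k <= m)%N -> wnorm mu tau r E (h m \- h k)%R <= (2 * 2^-1 ^+ k)%:E.
  move=> km; have := @wnorm_sum _ _ _ mu tau r E r1 mE mtau tau0 h
    (fun i => 2^-1 ^+ i)%R k m km mh (fun i _ => hinc i).
  by move=> /le_trans; apply; rewrite lee_fin.
pose inc i x : R := `|h i.+1 x - h i x|%R.
pose S m x : R := (\sum_(0 <= i < m) inc i x)%R.
have minc i : measurable_fun E (inc i).
  by apply: measurable_normRr; exact: measurable_funB.
have mS m : measurable_fun E (S m) by apply: measurable_sum.
have S0 m x : (0 <= S m x)%R by apply: sumr_ge0 => i _; exact: normr_ge0.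
have normS m : wnorm mu tau r E (S m) <= 2%:E.
  have := @wnorm_sum _ _ _ mu tau r E r1 mE mtau tau0 S
    (fun i => 2^-1 ^+ i)%R 0 m (leq0n m) mS.
  rewrite (_ : (S m \- S 0)%R = S m); last first.
    by apply/funext => x /=; rewrite /S [X in (_ - X)%R]big_geq ?subr0.
  move=> /(_ _)/le_trans; apply; last by rewrite lee_fin (le_trans (geo _ _))// expr0 mulr1.
  move=> i _; apply: le_trans (hinc i); apply: wnorm_le => //.
  - exact: measurable_funB.
  - exact: measurable_funB.
  by move=> x _ /=; rewrite /S big_nat_recr//= addrAC subrr add0r normr_id.
pose H m x := (`|S m x| `^ r * tau x)%:E.
have mH m : measurable_fun E (H m) by exact: measurable_weighted_power.
have H0 m x : E x -> 0 <= H m x.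
  by move=> Ex; rewrite lee_fin mulr_ge0 ?powR_ge0 ?tau0.
have ndS x : {homo S ^~ x : a b / (a <= b)%N >-> (a <= b)%R}.
  move=> a b ab; rewrite /S (big_cat_nat (leq0n a) ab)/= lerDl.
  by apply: sumr_ge0 => i _; exact: normr_ge0.
have ndH x : E x -> {homo H ^~ x : a b / (a <= b)%N >-> a <= b}.
  move=> Ex a b ab; rewrite lee_fin ler_wpM2r ?tau0//.
  rewrite !(ger0_norm (S0 _ _)) ge0_ler_powR ?nnegrE ?(ltW r0)//; exact: ndS.
have Hlim_int : \int[mu]_(x in E) limn (H ^~ x) <= (2 `^ r)%:E.
  rewrite monotone_convergence//; apply: lime_le.
    apply: ereal_nondecreasing_is_cvgn => a b ab.
    by apply: ge0_le_integral => // x Ex; [exact: H0|exact: ndH].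
  by apply: nearW => m; rewrite -wnorm_le_pow.
have Hcvg x : E x -> cvgn (H ^~ x).
  by move=> Ex; apply: ereal_nondecreasing_is_cvgn; exact: ndH.
have Hlim0 x : E x -> 0 <= limn (H ^~ x).
  by move=> Ex; apply: lime_ge; [exact: Hcvg|apply: nearW => m; exact: H0].
have mHlim : measurable_fun E (fun x => limn (H ^~ x)).
  by apply: (emeasurable_fun_cvg _ _ mH) => x Ex; exact: Hcvg.
have intH : mu.-integrable E (fun x => limn (H ^~ x)).
  apply/integrableP; split => //; apply: le_lt_trans (ltry (2 `^ r)%R).
  apply: le_trans Hlim_int; rewrite le_eqVlt; apply/orP; left; apply/eqP.
  by apply: eq_integral => x; rewrite inE => Ex; rewrite gee0_abs// Hlim0.
pose u x := fine (limn_esup (fun k => (h k x)%:E)).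
have mu_ : measurable_fun E u.
  apply: (@measurableT_comp _ _ _ _ _ _ (@fine R)); first exact: fine_measurable.
  by apply: measurable_fun_limn_esup => k; exact/measurable_EFinP.
have cvu : {ae mu, forall x, E x -> tau x != 0%R -> h k x @[k --> \oo] --> u x}.
  have := integrable_ae mE intH; apply: filterS => x /[swap] Ex /(_ Ex) fin taux.
  have [c Sc] : exists c, forall m, (S m x <= c)%R.
    have t0 : (0 < tau x)%R by rewrite lt_def taux tau0.
    exists ((fine (limn (H ^~ x)) / tau x) `^ r^-1)%R => m.
    have Hm : H m x <= limn (H ^~ x).
      apply: lime_ge; first exact: Hcvg.
      by exists m => // k /= mk; exact: ndH.
    rewrite -(fineK fin) lee_fin ger0_norm// -ler_pdivlMr// in Hm.
    rewrite [leLHS](_ : _ = ((S m x) `^ r) `^ r^-1)%R; last first.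
      by rewrite -powRrM divff ?gt_eqF// powRr1.
    by rewrite ge0_ler_powR ?nnegrE ?powR_ge0 ?invr_ge0 ?(ltW r0)//
      ?divr_ge0 ?fine_ge0 ?Hlim0 ?(ltW t0).
  have cS : cvgn (S ^~ x).
    apply: nondecreasing_is_cvgn; first exact: ndS.
    by exists c => _ [m _ <-].
  have ch : cvgn (h ^~ x).
    have /normed_cvg : cvgn [normed series (fun i => h i.+1 x - h i x)%R].
      exact: cS.
    move=> /cvg_ex[l hl]; apply/cvg_ex; exists (l + h 0%N x)%R.
    rewrite (_ : h ^~ x = fun m => (series (fun i => h i.+1 x - h i x)%R m + h 0%N x)%R).
      by apply: cvgD => //; exact: cvg_cst.
    by apply/funext => m; rewrite /series/= telescope_sumr// subrK.
  have /cvg_ex[l hl] := ch.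
  rewrite /u (_ : limn_esup _ = l%:E)//.
  apply: (cvg_limn_einf_sup _).2; apply: cvg_EFin => //; exact: nearW.
exists u; split => // k.
apply: (@wnorm_fatou _ _ _ mu tau r E r1 mE mtau tau0 (fun m => h (m + k)%N \- h k)%R).
- by rewrite mulr_ge0.
- by move=> m; exact: measurable_funB.
- exact: measurable_funB.
- apply: filterS cvu => x cx Ex tx; apply: cvgB; last exact: cvg_cst.
  by rewrite (cvg_shiftn k (h ^~ x)); exact: cx.
by move=> m; apply: hdist; exact: leq_addl.
Qed.

End weighted_norm_sets.

(** * Hoelder's inequality with the dual weight *)

Section weighted_hoelder.
Context d (T : measurableType d) (R : realType) (mu : {measure set T -> \bar R}).
Local Open Scope ereal_scope.

(** Finiteness of the integral of the dual weight forces the weight to be positive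
    almost everywhere. *)
Lemma dual_weight_ae_pos (B : set T) (w : T -> R) (a s : R) :
  (0 < a)%R -> measurable B -> measurable_fun B w ->
  (forall x, B x -> (0 <= w x)%R) ->
  \int[mu]_(x in B) ((w x `^ a)%:E)^-1 <= s%:E ->
  mu (B `&` [set x | w x = 0%R]) = 0.
Proof.
move=> a0 mB mw w0 ws; set Z := B `&` _.
have mZ : measurable Z.
  rewrite /Z (_ : [set x | w x = 0%R] = w @^-1` [set 0%R]); last by [].
  exact: mw.
have sk (k : nat) : k%:R%:E * mu Z <= s%:E.
  apply: le_trans ws; rewrite -integral_cst//.
  rewrite (_ : \int[mu]_(x in Z) _ = \int[mu]_(x in B) (k%:R%:E * (\1_Z x)%:E)); last first.
    rewrite integral_mkcond [RHS]integral_mkcond; apply: eq_integral => x _.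
    rewrite !patchE indicE; have [xZ|xZ] := boolP (x \in Z).
      by rewrite mem_set ?mule1//; move: xZ; rewrite inE => -[].
    by case: ifPn => _ //; rewrite mule0.
  apply: (le_integral_lower mB).
  - apply: emeasurable_funM => //; apply/measurable_EFinP.
    exact: measurable_funTS (measurable_indic _).
  - by move=> x _; rewrite mule_ge0// lee_fin.
  - by move=> x _; rewrite inve_ge0 lee_fin powR_ge0.
  apply/aeW => x Bx; rewrite indicE; case: (boolP (x \in Z)) => xZ.
    move: xZ; rewrite inE => -[_ /= ->].
    by rewrite powR0 ?gt_eqF// inve0 leey.
  by rewrite mule0 inve_ge0 lee_fin powR_ge0.
apply: contrapT => /eqP Z0; have {}Z0 : 0 < mu Z by rewrite lt0e Z0 measure_ge0.
have Zfin : mu Z \is a fin_num.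
  rewrite ge0_fin_numE//; have := sk 1%N; rewrite mul1e => /le_lt_trans; apply.
  exact: ltry.
have z0 : (0 < fine (mu Z))%R by rewrite fine_gt0// Z0 -ge0_fin_numE.
have := sk (Num.bound (`|s| / fine (mu Z))).+1.
rewrite -(fineK Zfin) -EFinM lee_fin leNgt => /negP; apply.
rewrite -ltr_pdivrMr// (le_lt_trans (y := (`|s| / fine (mu Z))%R))//.
  by rewrite ler_pM2r ?invr_gt0// ler_norm.
apply: (@lt_trans _ _ (Num.bound (`|s| / fine (mu Z)))%:R); last by rewrite ltr_nat.
by rewrite archi_boundP// divr_ge0// ltW.
Qed.

(** Hoelder's inequality for [G * w `^ p^-1] and [w `^ (- p^-1)], whose product is [G]
    wherever [w] does not vanish, hence almost everywhere. *)
Lemma weighted_hoelder (B : set T) (w G : T -> R) (p s : R) :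
  (1 < p)%R -> measurable B -> measurable_fun B w -> measurable_fun B G ->
  (forall x, B x -> (0 <= w x)%R) ->
  \int[mu]_(x in B) ((w x `^ (p - 1)^-1)%:E)^-1 <= s%:E ->
  \int[mu]_(x in B) `|G x|%:E <= wnorm mu w p B G * (s `^ ((p - 1) / p))%:E.
Proof.
move=> p1 mB mw mG w0 ws.
have p0 : (0 < p)%R by exact: lt_trans p1.
have p10 : (0 < p - 1)%R by rewrite subr_gt0.
have s0 : (0 <= s)%R.
  rewrite -lee_fin; apply: le_trans ws; apply: integral_ge0 => x _.
  by rewrite inve_ge0 lee_fin powR_ge0.
have Z0 := @dual_weight_ae_pos B w (p - 1)^-1 s _ mB mw w0 ws.
have {}Z0 := Z0 (ltac:(by rewrite invr_gt0)).
pose f : T -> R := (fun x => G x * w x `^ p^-1)%R \_ B.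
pose g : T -> R := (fun x => w x `^ (- p^-1))%R \_ B.
have mf : measurable_fun [set: T] f by exact: measurable_weighted.
have mg : measurable_fun [set: T] g.
  by apply/(measurable_restrictT _ mB); exact: measurable_powRr.
pose q := (p / (p - 1))%R.
have q0 : (0 < q)%R by rewrite divr_gt0.
have pq : (p^-1 + q^-1 = 1)%R.
  by rewrite /q invf_div; field; rewrite gt_eqF.
have := hoelder mu mf mg p0 q0 pq.
rewrite Lnorm1 -(wnormE mu (ltW p1) w0 G).
rewrite (_ : \int[mu]_x `|_| = \int[mu]_(x in B) `|G x|%:E); last first.
  rewrite [RHS]integral_mkcond; apply: ge0_ae_eq_integral => //.
  - apply/measurable_EFinP/measurable_normRr; exact: measurable_funM.
  - apply/(measurable_restrictT _ mB)/measurable_EFinP.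
    exact: measurable_normRr.
  - by move=> x _; rewrite erestrict_ge0.
  exists (B `&` [set x | w x = 0%R]); split => //.
    exact: (mw mB [set 0%R] (measurable_set1 0%R)).
  move=> x /=; apply: contra_notP => Zx _; rewrite /f /g !patchE.
  case: ifPn => [|_]; last by rewrite mulr0 normr0.
  rewrite inE => Bx; rewrite -mulrA -powRD; last first.
    by apply/implyP => _; apply/eqP => wx0; apply: Zx.
  by rewrite subrr powRr0 mulr1.
move=> h; apply: le_trans h _; rewrite lee_wpmul2l ?wnorm_ge0//.
rewrite unlock /Lnorm.
rewrite (_ : (p - 1) / p = q^-1)%R; last by rewrite /q invf_div.
rewrite -poweR_EFin; apply: le_poweR; first by rewrite invr_ge0 ltW.
  by apply: integral_ge0 => x _; exact: poweR_ge0.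
apply: le_trans ws; rewrite [leRHS]integral_mkcond.
apply: (le_integral_lower measurableT).
- apply/measurable_EFinP/measurable_powRr/measurable_normRr; exact: mg.
- by move=> x _; exact: poweR_ge0.
- by move=> x _; apply: erestrict_ge0 => y _; rewrite inve_ge0 lee_fin powR_ge0.
apply/aeW => x _ /=; rewrite /g !patchE; case: ifPn => [|_]; last first.
  by rewrite normr0 powR0 ?gt_eqF.
rewrite inE => Bx; rewrite ger0_norm ?powR_ge0// -powRrM.
have -> : (- p^-1 * q = - (p - 1)^-1)%R by rewrite /q mulNr mulrA mulVf ?gt_eqF// mul1r.
have [wx0|wx0] := eqVneq (w x) 0%R.
  rewrite wx0 powR0 ?oppr_eq0 ?invr_eq0 ?gt_eqF// inve_ge0 lee_fin powR_ge0//.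
by rewrite inver powR_eq0 (negbTE wx0)/= powRN.
Qed.

End weighted_hoelder.

(** * Balls and admissible weights *)

Section balls.
Context {R : realType} {n : nat}.
Local Notation V := 'rV[R]_n.+1.
Local Notation lam := (@lebesgue R n).
Local Notation L := (caratheodory_type (@lebesgue_outer R n)).
Implicit Types (Om : set V) (x : V).

Lemma enorm_ge0 (v : V) : 0 <= enorm v.
Proof. exact: sqrtr_ge0. Qed.

Lemma norm_le_enorm (v : V) : `|v| <= enorm v.
Proof.
by rewrite rV_norm_le ?enorm_ge0//; apply/forallP => i; exact: enorm_coord_le.
Qed.

Lemma enorm_le_norm (v : V) : enorm v <= 2 * n.+1%:R * `|v|.
Proof.
have [->|v0] := eqVneq v 0.
  rewrite normr0 mulr0 /enorm big1 ?sqrtr0// => i _; by rewrite mxE expr0n.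
by apply/ltW/enorm_lt; [rewrite normr_gt0|move=> i; exact: coord_le_norm].
Qed.

Lemma measurable_sq_enorm x :
  measurable_fun [set: L] (fun y : L => \sum_i ((y : V) - x) ord0 i ^+ 2).
Proof.
apply: measurable_sum => i; apply: measurable_funX.
under eq_fun do rewrite !mxE.
apply: measurable_funB; [exact: measurable_coord|exact: measurable_cst].
Qed.

Lemma measurable_eball Om x r : open Om -> measurable (eball Om x r : set L).
Proof.
move=> oOm; apply: measurableI; first exact: measurable_open.
have [r0|r0] := leP r 0.
  rewrite (_ : [set _ | _] = set0) ?measurable0// -subset0 => y /=.
  by apply/negP; rewrite -leNgt (le_trans r0)// enorm_ge0.
rewrite (_ : [set _ | _] =
    (fun y : L => \sum_i ((y : V) - x) ord0 i ^+ 2) @^-1` `]-oo, (r ^+ 2)[); last first.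
  have E (y : V) : (enorm (y - x) < r) = (\sum_i (y - x) ord0 i ^+ 2 < r ^+ 2).
    by rewrite /enorm -{1}(gtr0_norm r0) -sqrtr_sqr ltr_sqrt// exprn_gt0.
  by apply/seteqP; split => y /=; rewrite in_itv/= E.
rewrite -[X in measurable X]setTI; exact: measurable_sq_enorm.
Qed.

Lemma eball_sub Om x r : eball Om x r `<=` Om.
Proof. exact: subIsetl. Qed.

(** With doubling this compares the measure of any ball with that of [Om]. *)
Lemma eball_exhaust Om x r : bounded_set Om -> Om x -> 0 < r ->
  exists M : nat, Om `<=` eball Om x (2 ^+ M * r).
Proof.
move=> [K [Kreal Kb]] Ox r0.
have {}Kb y : Om y -> `|y| <= `|K| + 1.
  by apply: Kb; rewrite (le_lt_trans (ler_norm _))// ltrDl.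
pose c := 2 * n.+1%:R * (2 * (`|K| + 1)).
have c0 : 0 <= c by rewrite !mulr_ge0// addr_ge0.
have [M cM] : exists M : nat, c < 2 ^+ M * r.
  exists (Num.bound (c / r)); rewrite -ltr_pdivrMr//.
  apply: (@lt_le_trans _ _ (Num.bound (c / r))%:R).
    by rewrite archi_boundP// divr_ge0// ltW.
  by rewrite -natrX ler_nat ltnW// ltn_expl.
exists M => y Oy; split => //=; apply: le_lt_trans cM.
apply: le_trans (enorm_le_norm _) _; rewrite ler_pM2l ?mulr_gt0//.
rewrite (le_trans (ler_normB _ _))// mulr2n mulrDl mul1r.
by rewrite lerD ?Kb.
Qed.

Lemma eball_compact Om x : open Om -> Om x ->
  exists2 K, compact K /\ K `<=` Om & exists2 r, 0 < r & eball Om x r `<=` K.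
Proof.
move=> oOm Ox.
have /nbhs_ballP[e /= e0 eO] : nbhs x Om by exact: oOm.
pose K := closed_ball x (e / 2).
exists K.
  split; last first.
    move=> y; rewrite /K closed_ballE ?divr_gt0// /closed_ball_/= => xy.
    apply: eO; rewrite -ball_normE/=; apply: le_lt_trans xy _.
    by rewrite ltr_pdivrMr// ltr_pMr// ltr1n.
  apply: bounded_closed_compact; last exact: closed_ball_closed.
  exists (`|x| + e / 2); split; first exact: num_real.
  move=> c xc y; rewrite /K closed_ballE ?divr_gt0// /closed_ball_/= => xy.
  rewrite -(subrKC x y) (le_trans (ler_normD _ _))// (le_trans _ (ltW xc))//.
  by rewrite lerD2l distrC.
exists (e / 2); first by rewrite divr_gt0.
move=> y [_ /= xy]; rewrite /K closed_ballE ?divr_gt0// /closed_ball_/=.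
by rewrite distrC (le_trans (norm_le_enorm _))// ltW.
Qed.

End balls.

Section admissible_weights.
Context {R : realType} {n : nat}.
Local Notation V := 'rV[R]_n.+1.
Local Notation lam := (@lebesgue R n).
Local Notation L := (caratheodory_type (@lebesgue_outer R n)).
Variables (Om : set V) (p : R) (w tau : V -> R).
Hypotheses (oOm : open Om) (bOm : bounded_set Om) (p1 : 1 < p).
Hypothesis adm : p_admissible p Om w tau.

Let mOm : measurable (Om : set L). Proof. exact: measurable_open. Qed.

Lemma admissible_w_ge0 x : Om x -> 0 <= w x.
Proof. by case: adm => -[[+ _ _] _ _] _; apply. Qed.

Lemma admissible_tau_ge0 x : Om x -> 0 <= tau x.
Proof. by case: adm => -[_ [+ _ _] _] _; apply. Qed.

Lemma admissible_measurable_w A : A `<=` Om -> measurable_fun (A : set L) (w : L -> R).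
Proof.
case: adm => -[[_ mw _] _ _] _ AO; exact: (measurable_funS mOm AO mw).
Qed.

Lemma admissible_measurable_tau A : A `<=` Om ->
  measurable_fun (A : set L) (tau : L -> R).
Proof.
case: adm => -[_ [_ mw _] _] _ AO; exact: (measurable_funS mOm AO mw).
Qed.

Lemma admissible_le : {ae lam, forall x, Om x -> w x <= tau x}.
Proof. by case: adm => -[]. Qed.

Local Open Scope ereal_scope.

Lemma wmeas_ge0 f A : (forall x, A x -> (0 <= f x)%R) -> 0 <= wmeas f (A : set V).
Proof. by move=> f0; apply: integral_ge0 => x Ax; rewrite lee_fin f0. Qed.

Lemma wmeas_le f (A B : set V) : measurable (A : set L) -> measurable (B : set L) ->
  measurable_fun (B : set L) (f : L -> R) -> (forall x, B x -> (0 <= f x)%R) ->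
  A `<=` B -> wmeas f A <= wmeas f B.
Proof.
move=> mA mB mf f0 AB; rewrite /wmeas; apply: ge0_subset_integral => //.
exact/measurable_EFinP.
Qed.

Lemma tau_mono (A B : set V) : measurable (A : set L) -> measurable (B : set L) ->
  B `<=` Om -> A `<=` B -> wmeas tau A <= wmeas tau B.
Proof.
move=> mA mB BO AB; apply: wmeas_le => //; first exact: admissible_measurable_tau.
by move=> x /BO; exact: admissible_tau_ge0.
Qed.

Lemma w_mono (A B : set V) : measurable (A : set L) -> measurable (B : set L) ->
  B `<=` Om -> A `<=` B -> wmeas w A <= wmeas w B.
Proof.
move=> mA mB BO AB; apply: wmeas_le => //; first exact: admissible_measurable_w.
by move=> x /BO; exact: admissible_w_ge0.
Qed.

Lemma w_le_tau (A : set V) : measurable (A : set L) -> A `<=` Om ->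
  wmeas w A <= wmeas tau A.
Proof.
move=> mA AO; rewrite /wmeas; apply: (ae_ge0_le_integral mA).
- by move=> x /AO Ox; rewrite lee_fin admissible_w_ge0.
- by apply/measurable_EFinP; exact: admissible_measurable_w.
- by move=> x /AO Ox; rewrite lee_fin admissible_tau_ge0.
- by apply/measurable_EFinP; exact: admissible_measurable_tau.
have := admissible_le; apply: filterS; first exact: (ae_filter_ringOfSetsType lam).
by move=> x h /AO Ox; rewrite lee_fin; exact: h.
Qed.

Lemma tau_doubling : exists2 Cd : R, (2 <= Cd)%R & forall M x r, Om x -> (0 < r)%R ->
  wmeas tau (eball Om x (2 ^+ M * r)) <= (Cd ^+ M)%:E * wmeas tau (eball Om x r).
Proof.
case: adm => _ [[C dbl] _ _]; exists (Num.max C 2)%R; first by rewrite le_max lexx orbT.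
have t0 x r : 0 <= wmeas tau (eball Om x r).
  by apply: wmeas_ge0 => y /eball_sub; exact: admissible_tau_ge0.
have C0 : (0 <= Num.max C 2 :> R)%R by rewrite le_max ler0n orbT.
elim=> [x r _ _|M IH x r Ox r0]; first by rewrite !expr0 !mul1r mul1e.
rewrite exprS -mulrA; apply: (@le_trans _ _ (C%:E * wmeas tau (eball Om x (2 ^+ M * r)))).
  by apply: dbl => //; rewrite mulr_gt0// exprn_gt0.
apply: (@le_trans _ _ ((Num.max C 2)%R%:E * wmeas tau (eball Om x (2 ^+ M * r)))).
  by rewrite lee_wpmul2r// lee_fin le_max lexx.
by rewrite exprS EFinM -muleA lee_wpmul2l ?lee_fin// IH.
Qed.

(** A small ball has finite measure, being contained in a compact subset of [Om], and
    finitely many doublings of it exhaust [Om]. *)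
Lemma tau_Om_fin : wmeas tau Om < +oo.
Proof.
have [->|/set0P[x Ox]] := eqVneq Om set0; first by rewrite /wmeas integral_set0.
have [K [cK KO] [r r0 rK]] := eball_compact oOm Ox.
have [M OM] := eball_exhaust bOm Ox r0.
have [C C2 dbl] := tau_doubling.
have me s : measurable (eball Om x s : set L) by exact: measurable_eball.
apply: (@le_lt_trans _ _ (wmeas tau (eball Om x (2 ^+ M * r)))).
  by apply: tau_mono => //; exact: eball_sub.
apply: le_lt_trans (dbl _ _ _ Ox r0) _.
apply: lte_mul_pinfty => //; first by rewrite lee_fin exprn_ge0// (le_trans _ C2).
have mK : measurable (K : set L).
  rewrite -[K]setCK; apply: measurableC; apply: measurable_open.
  by apply: closed_openC; exact: compact_closed.
apply: le_lt_trans (tau_mono (me r) mK KO rK) _.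
by case: adm => -[_ [_ _ +] _] _; apply.
Qed.

Lemma tau_fin (A : set V) : measurable (A : set L) -> A `<=` Om ->
  wmeas tau A \is a fin_num.
Proof.
move=> mA AO; rewrite ge0_fin_numE.
  by apply: le_lt_trans tau_Om_fin; exact: tau_mono.
by apply: wmeas_ge0 => x /AO; exact: admissible_tau_ge0.
Qed.

Lemma w_fin (A : set V) : measurable (A : set L) -> A `<=` Om ->
  wmeas w A \is a fin_num.
Proof.
move=> mA AO; rewrite ge0_fin_numE.
  apply: le_lt_trans (w_le_tau mA AO) _; rewrite -ge0_fin_numE; first exact: tau_fin.
  by apply: wmeas_ge0 => x /AO; exact: admissible_tau_ge0.
by apply: wmeas_ge0 => x /AO; exact: admissible_w_ge0.
Qed.

Hypothesis tau_pos : 0 < wmeas tau Om.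

(** Doubling spreads a null ball to the whole of [Om]. *)
Lemma tau_ball_gt0 x r : Om x -> (0 < r)%R -> 0 < wmeas tau (eball Om x r).
Proof.
move=> Ox r0; rewrite lt_def wmeas_ge0 ?andbT; last first.
  by move=> y /eball_sub; exact: admissible_tau_ge0.
apply/eqP => t0.
have [M OM] := eball_exhaust bOm Ox r0.
have [C C2 dbl] := tau_doubling.
have := dbl M x r Ox r0; rewrite t0 mule0 leNgt => /negP; apply.
apply: lt_le_trans tau_pos _; apply: tau_mono => //.
  exact: measurable_eball.
exact: eball_sub.
Qed.

(** If the ball were [w]-null, the balance condition with both radii equal to [r] would
    read [1 <= 0]. *)
Lemma w_ball_gt0 x r : Om x -> (0 < r)%R -> 0 < wmeas w (eball Om x r).
Proof.
move=> Ox r0; rewrite lt_def wmeas_ge0 ?andbT; last first.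
  by move=> y /eball_sub; exact: admissible_w_ge0.
apply/eqP => W0; case: adm => _ [_ _ [C [q [C0 pq /(_ r r x r0 (lexx _) Ox)]]]].
rewrite W0 mul0e poweR0r ?mule0; last first.
  by rewrite invr_neq0// gt_eqF// (lt_trans _ p1).
rewrite divff ?gt_eqF// mul1e leNgt => /negP; apply; apply: poweR_gt0.
have T0 := tau_ball_gt0 Ox r0.
have Tf : wmeas tau (eball Om x r) \is a fin_num.
  by apply: tau_fin; [exact: measurable_eball|exact: eball_sub].
have /andP[_ Ty] : (wmeas tau (eball Om x r) != -oo) &&
    (wmeas tau (eball Om x r) != +oo) by rewrite -fin_numE.
by rewrite mule_gt0// inve_gt0//; rewrite gt_eqF.
Qed.

Lemma lebesgue_null_tau (A : set V) : measurable (A : set L) -> A `<=` Om ->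
  0 < wmeas tau A -> 0 < lam A.
Proof.
move=> mA AO tA; rewrite lt0e measure_ge0 andbT; apply/eqP => A0.
move: tA; rewrite /wmeas null_set_integral ?ltxx//.
by apply/measurable_EFinP; exact: admissible_measurable_tau.
Qed.

End admissible_weights.

(** * Averages over cells *)

Section averages.
Context {R : realType} {n : nat}.
Local Notation V := 'rV[R]_n.+1.
Local Notation lam := (@lebesgue R n).
Local Notation L := (caratheodory_type (@lebesgue_outer R n)).
Local Notation N := n.+1.
Local Notation scale := (@scale R n).
Local Notation half := (@half R n).
Local Notation side := (@side R n).
Local Notation dir := (@dir n).

Definition avg (F : V -> R) (A : set V) : R :=
  (fine (lam A))^-1 * fine (\int[lam]_(x in A) (F x)%:E).

Variable len : R.
Hypothesis len0 : 0 < len.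

Lemma cell_norm_dist k (a x y : V) : cell len k a x -> cell len k a y ->
  `|x - y| <= scale len k.
Proof.
move=> xa ya; rewrite rV_norm_le ?(ltW (scale_gt0 len0 k))//; apply/forallP => i.
by rewrite !mxE; exact: cell_coord_dist xa ya.
Qed.

Lemma lipschitz_cell_dist l (F : V -> R) k (a x y : V) : is_lipschitz l F ->
  cell len k a x -> cell len k a y -> `|F x - F y| <= `|l| * scale len k.
Proof.
move=> Fl xa ya; apply: le_trans (Fl x y) _.
apply: (@le_trans _ _ (`|l| * `|x - y|)); first by rewrite ler_wpM2r// ler_norm.
by rewrite ler_wpM2l// (cell_norm_dist xa ya).
Qed.

Lemma lipschitz_measurable l (F : V -> R) (A : set V) : is_lipschitz l F ->
  measurable_fun (A : set L) (F : L -> R).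
Proof.
move=> Fl; apply: measurable_funTS; apply: continuous_measurable.
exact: lipschitz_continuous Fl.
Qed.

Lemma lipschitz_integrable l (F : V -> R) k a : is_lipschitz l F ->
  lam.-integrable (cell len k a) (EFin \o F).
Proof.
move=> Fl; apply: measurable_bounded_integrable.
- exact: measurable_cell.
- exact: lebesgue_box_lty.
- exact: lipschitz_measurable Fl.
exists (`|F (center len k a)| + `|l| * scale len k); split; first exact: num_real.
move=> c hc x xa; apply: le_trans (ltW hc).
rewrite -(subrKC (F (center len k a)) (F x)) (le_trans (ler_normD _ _))// lerD2l.
by apply: lipschitz_cell_dist Fl xa _; exact: center_in_cell.
Qed.

Lemma lipschitz_fin l (F : V -> R) k a : is_lipschitz l F ->
  (\int[lam]_(x in cell len k a) (F x)%:E)%E \is a fin_num.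
Proof.
move=> Fl; apply: (integrable_fin_num (measurable_cell _ _ _)).
exact: lipschitz_integrable Fl.
Qed.

Local Notation I F A := (fine (\int[lam]_(x in A) (F x)%:E)).

Lemma integral_cell_split l (F : V -> R) k a : is_lipschitz l F ->
  I F (cell len k a) =
  I F (cell len k.+1 a) + I F (cell len k.+1 (sibling len k a)).
Proof.
move=> Fl; rewrite -fineD ?(lipschitz_fin _ _ Fl)//.
congr fine; rewrite [in LHS](cell_split len0) integral_setU_EFin//.
- exact: measurable_cell.
- exact: measurable_cell.
- by rewrite -cell_split//; exact: lipschitz_measurable Fl.
- by apply/eqP; rewrite cell_disjoint.
Qed.

Hypothesis lam0 : forall k a, 0 < fine (lam (cell len k a)).

Lemma lebesgue_cell_half k a :
  fine (lam (cell len k.+1 a)) = fine (lam (cell len k a)) / 2.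
Proof.
rewrite (lebesgue_cell_split len0 k a).
have /EFin_fin_numP[u ->] := cell_fin len k.+1 a.
by rewrite mule2n /=; lra.
Qed.

Lemma lebesgue_sibling k a :
  fine (lam (cell len k.+1 (sibling len k a))) = fine (lam (cell len k a)) / 2.
Proof. by rewrite /sibling lebesgue_cell_shift lebesgue_cell_half. Qed.

Lemma integral_sibling l (F : V -> R) k a : is_lipschitz l F ->
  I F (cell len k.+1 (sibling len k a)) =
  I (fun x => F (half len k *: basis_vec (dir k) + x)) (cell len k.+1 a).
Proof.
move=> Fl; congr fine.
have := integral_shift (half len k *: basis_vec (dir k))
  (measurable_cell (n := n) len k.+1 (sibling len k a)) (lipschitz_integrable k.+1 _ Fl).
move=> <-.
rewrite (_ : [set x | _] = cell len k.+1 a).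
  by apply: eq_integral => x _ /=; rewrite addrC.
by apply/seteqP; split => x; rewrite /= /sibling cell_shift /= addrK.
Qed.

(** Both children of a cell have the same volume, so that their averages differ from
    that of the cell by the same amount, half of their distance. *)
Lemma avg_child_dist l (F : V -> R) k a b : is_lipschitz l F ->
  b = a \/ b = sibling len k a ->
  ((`|avg F (cell len k.+1 b) - avg F (cell len k a)|)%:E <=
  (half len k / fine (lam (cell len k a)))%:E *
  \int[lam]_(x in cell len k a) `|partial F (dir k) x|%:E)%E.
Proof.
move=> Fl bE; pose v := half len k *: (basis_vec (dir k) : V).
have lF : is_lipschitz l (fun x => F (v + x)).
  by move=> x y; rewrite (le_trans (Fl _ _))// opprD addrACA subrr add0r.
pose lk := fine (lam (cell len k a)).
have lk0 : 0 < lk by exact: lam0.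
have -> : `|avg F (cell len k.+1 b) - avg F (cell len k a)| =
    `|I (fun x => F (v + x)) (cell len k.+1 a) - I F (cell len k.+1 a)| / lk.
  rewrite /avg -/lk (integral_cell_split k a Fl) (integral_sibling k a Fl) -/v.
  case: bE => ->.
    rewrite lebesgue_cell_half -/lk -[X in _ = _ / X](gtr0_norm lk0) -normf_div -normrN.
    by congr `|_|; field; rewrite gt_eqF.
  rewrite lebesgue_sibling (integral_sibling k a Fl) -/v -/lk.
  rewrite -[X in _ = _ / X](gtr0_norm lk0) -normf_div.
  by congr `|_|; field; rewrite gt_eqF.
have -> : (half len k / lk = lk^-1 * half len k)%R by rewrite mulrC.
rewrite mulrC !EFinM -muleA lee_wpmul2l ?lee_fin ?invr_ge0 ?(ltW lk0)//.
apply: (@le_trans _ _ (\int[lam]_(x in cell len k.+1 a) `|F (v + x)%R - F x|%:E)%E); last first.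
  apply: (integral_shift_le (l := l)) => //; try exact: measurable_cell.
  - exact: lebesgue_box_lty.
  - exact/ltW/half_gt0.
  move=> x t xa /andP[t0 th] i; have := cell_left_sub len0 xa i.
  have := xa i; rewrite sideS !mxE eqxx/=.
  case: eqVneq => [->|_]; last by rewrite mulr0 addr0.
  rewrite mulr1 -/(half len k) => /andP[h1 h2] /andP[h3 h4].
  have hs : side len k ord0 (dir k) = half len k * 2 by rewrite /half; field.
  by rewrite hs; apply/andP; split; lra.
have i1 := lipschitz_integrable k.+1 a lF.
have i2 := lipschitz_integrable k.+1 a Fl.
rewrite -fineB ?(lipschitz_fin _ _ lF) ?(lipschitz_fin _ _ Fl)//.
rewrite -integralB_EFin//; last exact: measurable_cell.
have i3 : lam.-integrable (cell len k.+1 a) (fun x => (F (v + x))%:E - (F x)%:E)%E.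
  by apply: integrableB => //; exact: measurable_cell.
rewrite -abse_EFin fineK; last exact: (integrable_fin_num (measurable_cell _ _ _)).
apply: le_abse_integral; first exact: measurable_cell.
by have /integrableP[] := i3.
Qed.

Lemma avg_le l (F : V -> R) k a : is_lipschitz l F ->
  ((`|avg F (cell len k a)|)%:E <=
   ((fine (lam (cell len k a)))^-1)%:E * \int[lam]_(x in cell len k a) `|F x|%:E)%E.
Proof.
move=> Fl; rewrite /avg normrM gtr0_norm ?invr_gt0// EFinM.
rewrite lee_wpmul2l ?lee_fin ?invr_ge0 ?(ltW (lam0 _ _))//.
have i2 := lipschitz_integrable k a Fl.
rewrite -abse_EFin fineK ?(lipschitz_fin _ _ Fl)//.
apply: le_abse_integral; first exact: measurable_cell.
by have /integrableP[] := i2.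
Qed.

Lemma avg_lipschitz l (F : V -> R) k a x : is_lipschitz l F -> cell len k a x ->
  `|F x - avg F (cell len k a)| <= `|l| * scale len k.
Proof.
move=> Fl xa; set lk := fine (lam (cell len k a)).
have lk0 : 0 < lk by exact: lam0.
have ic : lam.-integrable (cell len k a) (fun=> (F x)%:E).
  apply: (@lipschitz_integrable 0 (fun=> F x)) => y z.
  by rewrite subrr normr0 mul0r.
have iF := lipschitz_integrable k a Fl.
have -> : F x - avg F (cell len k a) = lk^-1 *
    fine (\int[lam]_(y in cell len k a) ((F x)%:E - (F y)%:E)%E).
  rewrite integralB_EFin//; last exact: measurable_cell.
  rewrite fineB ?(lipschitz_fin _ _ Fl)//; last first.
    exact: (integrable_fin_num (measurable_cell _ _ _) ic).
  rewrite integral_cst//; last exact: measurable_cell.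
  rewrite fineM ?cell_fin//= -/lk /avg -/lk mulrBr mulrCA mulVf ?mulr1 ?gt_eqF//.
rewrite normrM gtr0_norm ?invr_gt0// ler_pdivrMl// mulrC.
rewrite -lee_fin EFinM.
have iB : lam.-integrable (cell len k a) (fun y => (F x)%:E - (F y)%:E)%E.
  by apply: integrableB => //; exact: measurable_cell.
rewrite -abse_EFin fineK; last exact: (integrable_fin_num (measurable_cell _ _ _)).
apply: (@le_trans _ _ (\int[lam]_(y in cell len k a) `|(F x)%:E - (F y)%:E|)%E).
  apply: le_abse_integral; first exact: measurable_cell.
  by have /integrableP[] := iB.
rewrite /lk fineK ?cell_fin//.
apply: integral_le_bound.
- exact: measurable_cell.
- by have /integrableP[] := iB.
- by rewrite lee_fin mulr_ge0// ltW// scale_gt0.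
by apply/aeW => y ya; rewrite lee_fin; exact: lipschitz_cell_dist Fl xa ya.
Qed.

End averages.

(** * Admissible weights on dyadic cells *)

Section ap_condition.
Context {R : realType} {n : nat}.
Local Notation V := 'rV[R]_n.+1.
Local Notation lam := (@lebesgue R n).
Local Notation L := (caratheodory_type (@lebesgue_outer R n)).
Variables (Om : set V) (p : R) (w tau : V -> R).
Hypotheses (oOm : open Om) (bOm : bounded_set Om) (p1 : 1 < p).
Hypothesis adm : p_admissible p Om w tau.
Hypothesis tau_pos : (0 < wmeas tau Om)%E.

Let p0 : 0 < p. Proof. exact: lt_trans p1. Qed.
Let p10 : 0 < p - 1. Proof. by rewrite subr_gt0. Qed.

Definition dual_integral (D : set V) : \bar R :=
  (\int[lam]_(x in D) ((w x `^ (p - 1)^-1)%:E)^-1)%E.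

(** The [A_p] condition in the form in which it combines with Hoelder's inequality:
    it bounds the integral of the dual weight over a ball. *)
Lemma ap_dual_bound : exists2 K : R, 0 <= K & forall x r, Om x -> 0 < r ->
  lam (eball Om x r) \is a fin_num -> exists s : R,
  (dual_integral (eball Om x r) <= s%:E)%E /\
  s `^ ((p - 1) / p) <= K * fine (lam (eball Om x r)) *
    fine (wmeas w (eball Om x r)) `^ (- p^-1).
Proof.
case: (adm) => _ [_ [_ Apoo] _].
set S := ereal_sup _ in Apoo.
have [K0 [K0ge KS]] : exists K0 : R, 0 <= K0 /\ (S <= K0%:E)%E.
  case: S Apoo => [s _|//|_]; last by exists 0; rewrite leNye.
  by exists `|s|; rewrite lee_fin ler_norm.
exists (K0 `^ p^-1) => [|x r Ox r0 lfin]; first exact: powR_ge0.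
set D := eball Om x r in lfin *.
have mD : measurable (D : set L) by exact: measurable_eball.
have DO : D `<=` Om by exact: eball_sub.
have T0 : (0 < wmeas tau D)%E := tau_ball_gt0 oOm bOm adm tau_pos Ox r0.
have W0 : (0 < wmeas w D)%E := w_ball_gt0 oOm bOm p1 adm tau_pos Ox r0.
have l0 : (0 < lam D)%E := lebesgue_null_tau oOm adm mD DO T0.
have Wfin : wmeas w D \is a fin_num := w_fin oOm bOm adm mD DO.
have := Wfin; have := lfin; case/EFin_fin_numP => lD lDE; case/EFin_fin_numP => W WE.
have lD0 : 0 < lD by rewrite -lte_fin -lDE.
have {}W0 : 0 < W by rewrite -lte_fin -WE.
have : (Ap_product p w D <= K0%:E)%E.
  by apply: le_trans KS; apply: ereal_sup_ubound; exists (x, r).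
rewrite /Ap_product /average -/(wmeas w D) -/(dual_integral D) WE.
rewrite /= lDE /= inver gt_eqF// -EFinM.
have S0 : (0 <= dual_integral D)%E.
  by apply: integral_ge0 => y _; rewrite inve_ge0 lee_fin powR_ge0.
have lW0 : 0 < lD^-1 * W by rewrite mulr_gt0 ?invr_gt0.
case SE : (dual_integral D) S0 => [s| |]//; last first.
  move=> _; rewrite gt0_muley ?lte_fin ?invr_gt0// poweRyr ?gt_eqF//.
  by rewrite gt0_muley ?lte_fin// leye_eq.
rewrite lee_fin => s0; rewrite -(EFinM _ s) poweR_EFin -EFinM lee_fin => h.
exists s; split => //.
have hs : (lD^-1 * s) `^ (p - 1) <= K0 * lD / W.
  rewrite ler_pdivlMr// -ler_pdivrMr//; apply: le_trans h.
  by rewrite le_eqVlt; apply/orP; left; apply/eqP; ring.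
have -> : s `^ ((p - 1) / p) = ((lD^-1 * s) `^ (p - 1)) `^ p^-1 * lD `^ ((p - 1) / p).
  rewrite -powRrM -powRM ?mulr_ge0 ?invr_ge0 ?(ltW lD0)//.
  by rewrite mulrAC mulVf ?mul1r ?gt_eqF.
have -> : K0 `^ p^-1 * lD * W `^ (- p^-1) =
    (K0 * lD / W) `^ p^-1 * lD `^ ((p - 1) / p).
  rewrite !powRM ?mulr_ge0 ?invr_ge0 ?(ltW lD0) ?(ltW W0)//.
  rewrite -(powR_inv1 (ltW W0)) -powRrM mulN1r.
  have lDE' : lD = lD `^ p^-1 * lD `^ ((p - 1) / p).
    rewrite -powRD ?(gt_eqF lD0) ?implybT// (_ : _ + _ = 1) ?powRr1 ?(ltW lD0)//.
    by field; rewrite gt_eqF.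
  by rewrite [in LHS]lDE'; ring.
rewrite ler_wpM2r ?powR_ge0// ge0_ler_powR ?invr_ge0 ?nnegrE ?powR_ge0 ?(ltW p0)//.
by rewrite divr_ge0 ?mulr_ge0// ltW.
Qed.

End ap_condition.

Section cell_weights.
Context {R : realType} {n : nat}.
Local Notation V := 'rV[R]_n.+1.
Local Notation lam := (@lebesgue R n).
Local Notation L := (caratheodory_type (@lebesgue_outer R n)).
Local Notation N := n.+1.
Local Notation scale := (@scale R n).
Local Notation half := (@half R n).
Local Notation side := (@side R n).
Local Notation dir := (@dir n).
Variables (Om : set V) (p : R) (w tau : V -> R).
Hypotheses (oOm : open Om) (bOm : bounded_set Om) (p1 : 1 < p).
Hypothesis adm : p_admissible p Om w tau.
Variables (len : R) (a0 : V).
Hypothesis len0 : 0 < len.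
Let C := cell len 0 a0.
Hypothesis COm : C `<=` Om.
Hypothesis tauC : (0 < wmeas tau C)%E.

Local Notation corner := (corner len a0).
Local Notation cell := (cell len).
Local Notation radius k := (2 * N%:R * scale len k).
Local Notation ball k a := (eball Om (center len k a) (radius k)).
Local Notation tm A := (fine (wmeas tau A)).
Local Notation wm A := (fine (wmeas w A)).

Let mC : measurable (C : set L). Proof. exact: measurable_cell. Qed.

Lemma cube_tau_pos : (0 < wmeas tau Om)%E.
Proof.
apply: lt_le_trans tauC _; apply: (tau_mono oOm adm mC) => //.
exact: measurable_open.
Qed.
Let tau_pos := cube_tau_pos.

Lemma corner_in k a : corner k a -> cell k a `<=` Om.
Proof. by move=> ka; apply: subset_trans COm; exact: corner_sub. Qed.

Lemma center_in k a : corner k a -> Om (center len k a).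
Proof. by move=> /corner_in; apply; exact: center_in_cell. Qed.

Lemma radius_gt0 k : 0 < radius k.
Proof. by rewrite !mulr_gt0// scale_gt0. Qed.

Lemma cell_sub_ball k a : corner k a -> cell k a `<=` ball k a.
Proof.
move=> ka x xa; split; first exact: corner_in xa.
by apply: cell_enorm_dist xa _ => //; exact: center_in_cell.
Qed.

Lemma small_ball_sub k a : eball Om (center len k a) (scale len k / 4) `<=` cell k a.
Proof. by move=> x [_ /= h]; exact: ball_sub_cell. Qed.

Lemma cell_tau_gt0 k a : corner k a -> 0 < tm (cell k a).
Proof.
move=> ka; have kO := corner_in ka.
rewrite fine_gt0//; apply/andP; split; last first.
  by rewrite ltey_eq (tau_fin oOm bOm adm (measurable_cell _ _ _) kO).
apply: (@lt_le_trans _ _ (wmeas tau (eball Om (center len k a) (scale len k / 4)))).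
  by apply: (tau_ball_gt0 oOm bOm adm) => //; [exact: center_in|rewrite divr_gt0// scale_gt0].
apply: (tau_mono oOm adm _ (measurable_cell _ _ _) kO); last exact: small_ball_sub.
exact: measurable_eball.
Qed.

Lemma cell_lebesgue_gt0 k a : 0 < fine (lam (cell k a)).
Proof.
have C0 : 0 < fine (lam C).
  by rewrite fine_gt0// (lebesgue_null_tau oOm adm mC COm tauC) lebesgue_box_lty.
have -> : cell k a = cell k (a0 + (a - a0)) by rewrite addrC subrK.
rewrite lebesgue_cell_shift.
have -> : fine (lam (cell k a0)) = fine (lam C) / 2 ^+ k.
  by apply: lebesgue_cellE => //; elim: k => [|k IH]; [exact: corner0|exact: corner_left].
by rewrite divr_gt0// exprn_gt0.
Qed.

Lemma tau_additive k a : corner k a -> tm (cell k a) =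
  tm (cell k.+1 a) + tm (cell k.+1 (sibling len k a)).
Proof.
move=> ka; have kO := corner_in ka.
have k1 := corner_in (corner_left ka); have k2 := corner_in (corner_right ka).
rewrite -fineD ?(tau_fin oOm bOm adm)//; try exact: measurable_cell.
congr fine; rewrite /wmeas [in LHS](cell_split len0) ge0_integral_setU//.
- exact: measurable_cell.
- exact: measurable_cell.
- apply/measurable_EFinP; rewrite -cell_split//; exact: (admissible_measurable_tau oOm adm).
- by rewrite -cell_split// => x /kO Ox; rewrite lee_fin (admissible_tau_ge0 adm).
- by apply/eqP; rewrite cell_disjoint.
Qed.

(** Doubling: each half of a cell carries at least a fixed fraction of its measure,
    hence also at most a fixed fraction. *)
Lemma cell_tau_decay : exists2 th : R, 0 < th < 1 &
  forall k a, corner k a -> tm (cell k a) <= th ^+ k * tm C.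
Proof.
have [Cd Cd2 dbl] := tau_doubling adm.
have Cd0 : 0 < Cd by exact: lt_le_trans Cd2.
(* [2 ^+ M] times a quarter of the child's scale exceeds the diameter of the parent *)
pose M := (N + 4)%N; pose kap := (Cd ^+ M)^-1.
have CdM : 2 <= Cd ^+ M.
  by rewrite /M addnS exprS (le_trans Cd2)// ler_pMr// exprn_ege1// (le_trans _ Cd2)// ler1n.
have kap0 : 0 < kap by rewrite invr_gt0 exprn_gt0.
have kap1 : kap < 1 by rewrite invf_lt1 ?exprn_gt0// (lt_le_trans _ CdM)// ltr1n.
have child k a b : corner k a -> corner k.+1 b -> cell k.+1 b `<=` cell k a ->
    kap * tm (cell k a) <= tm (cell k.+1 b).
  move=> ka kb ba; rewrite ler_pdivrMl ?exprn_gt0//.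
  have bO := center_in kb; have s0 : 0 < scale len k.+1 / 4 by rewrite divr_gt0// scale_gt0.
  have me r : measurable (eball Om (center len k.+1 b) r : set L) by exact: measurable_eball.
  have fin A := tau_fin oOm bOm adm (A := A).
  have fa := fin _ (measurable_cell len k a) (corner_in ka).
  have fb := fin _ (measurable_cell len k.+1 b) (corner_in kb).
  rewrite -lee_fin EFinM !fineK//.
  apply: (@le_trans _ _ (wmeas tau (eball Om (center len k.+1 b) (2 ^+ M * (scale len k.+1 / 4))))).
    apply: (tau_mono oOm adm (measurable_cell _ _ _) (me _)); first exact: eball_sub.
    move=> x xa; split; first exact: corner_in xa.
    have cb : cell k a (center len k.+1 b) by apply: ba; exact: center_in_cell.
    apply: lt_le_trans (cell_enorm_dist len0 xa cb) _.
    apply: (@le_trans _ _ (2 * N%:R * (2 * scale len k.+1))).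
      by rewrite ler_pM2l ?mulr_gt0// scale_le_double.
    rewrite (_ : 2 ^+ M = 2 ^+ N * 2 ^+ 4); last by rewrite -exprD.
    have : N%:R <= 2 ^+ N :> R by rewrite -natrX ler_nat ltnW// ltn_expl.
    have : 0 < scale len k.+1 by exact: scale_gt0.
    set u := N%:R; set v := 2 ^+ N; set z := scale len k.+1 => z0 uv.
    have := ler_wpM2r (ltW z0) uv; lra.
  apply: le_trans (dbl M _ _ bO s0) _.
  rewrite lee_wpmul2l ?lee_fin ?exprn_ge0 ?(ltW Cd0)//.
  apply: (tau_mono oOm adm (me _) (measurable_cell _ _ _) (corner_in kb)).
  exact: small_ball_sub.
exists (1 - kap); first by rewrite subr_gt0 kap1 ltrBlDr ltrDl kap0.
move=> k a; elim=> {k a} [|k a ka IH|k a ka IH]; first by rewrite expr0 mul1r.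
- have h := child k a _ ka (corner_right ka) (cell_right_sub len0 (k := k) (a := a)).
  rewrite exprS -mulrA; apply: (@le_trans _ _ ((1 - kap) * tm (cell k a))).
    by rewrite mulrBl mul1r lerBrDr {2}(tau_additive ka) lerD2l.
  by rewrite ler_pM2l// subr_gt0.
have h := child k a _ ka (corner_left ka) (cell_left_sub len0 (k := k) (a := a)).
rewrite exprS -mulrA; apply: (@le_trans _ _ ((1 - kap) * tm (cell k a))).
  by rewrite mulrBl mul1r lerBrDr {2}(tau_additive ka) addrC lerD2r.
by rewrite ler_pM2l// subr_gt0.
Qed.

Lemma ball_lebesgue_fin k a : lam (ball k a) \is a fin_num.
Proof.
rewrite ge0_fin_numE ?measure_ge0//; apply: le_lt_trans (lebesgue_box_lty _ _).
apply: le_measure; rewrite ?inE; first exact: measurable_eball.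
  exact: measurable_box.
by move=> x [_ /= h]; exact: ball_sub_box h.
Qed.

(** The ball lies in a box whose edges are comparable to the scale of the cell. *)
Lemma ball_lebesgue_le : exists2 K : R, 0 <= K & forall k a, corner k a ->
  fine (lam (ball k a)) <= K * fine (lam (cell k a)).
Proof.
have lC : 0 < fine (lam C) := cell_lebesgue_gt0 0 a0.
exists ((4 * N%:R) ^+ N * (len ^+ N * 2 ^+ n) / fine (lam C)).
  by rewrite !mulr_ge0 ?exprn_ge0 ?mulr_ge0 ?invr_ge0 ?(ltW lC) ?(ltW len0).
move=> k a ka; rewrite (lebesgue_cellE len0 ka) -/C.
rewrite mulrA divfK ?gt_eqF// -lee_fin fineK ?ball_lebesgue_fin//.
set c := center len k a; set r := radius k.
apply: (@le_trans _ _ (lam (box (c - const_mx r) (c + const_mx r)))).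
  apply: le_measure; rewrite ?inE; first exact: measurable_eball.
    exact: measurable_box.
  by move=> x [_ /= h]; exact: ball_sub_box h.
apply: le_trans (lebesgue_box_le _ _) _; rewrite lee_fin /box_vol.
rewrite (eq_bigr (fun=> 2 * r)); last first.
  move=> i _; rewrite !mxE (_ : _ - _ = 2 * r); last by ring.
  by rewrite max_r// mulr_ge0// ltW// radius_gt0.
rewrite prodr_const card_ord /r.
rewrite (_ : 2 * _ = 4 * N%:R * scale len k); last by ring.
rewrite exprMn -!mulrA ler_pM2l ?exprn_gt0 ?mulr_gt0//.
by rewrite mulrA; apply: le_trans (scaleN_le len0 k) _.
Qed.

End cell_weights.

(** * A Poincare inequality on cells *)

Lemma balance_arith (R : realFieldType) (rho len t ts tr T ws wr W C : R) :
  0 < len -> 0 < rho -> 0 < C -> t <= ts -> tr <= T -> W <= wr ->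
  0 < tr -> 0 < W -> 0 <= ws ->
  rho / len * (ts / tr) <= C * (ws / wr) ->
  rho * t <= len * C * T * W^-1 * ws.
Proof.
move=> len0 rho0 C0 tts trT Wwr tr0 W0 ws0 h.
have wr0 : 0 < wr by exact: lt_le_trans Wwr.
apply: (@le_trans _ _ (rho * ts)); first by rewrite ler_pM2l.
have -> : rho * ts = len * tr * (rho / len * (ts / tr)) by field; rewrite !gt_eqF.
apply: (@le_trans _ _ (len * tr * (C * (ws / wr)))).
  by rewrite ler_pM2l// mulr_gt0.
have -> : len * tr * (C * (ws / wr)) = len * C * (tr * (wr^-1 * ws)) by ring.
have -> : len * C * T * W^-1 * ws = len * C * (T * (W^-1 * ws)) by ring.
rewrite ler_pM2l ?mulr_gt0// ler_pM ?(ltW tr0)//.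
  by rewrite mulr_ge0// invr_ge0 ltW.
by rewrite ler_wpM2r// lef_pV2.
Qed.

Lemma real_quotients (R : realType) (c C a b : R) (t1 t2 w1 w2 : \bar R) :
  t1 \is a fin_num -> t2 \is a fin_num -> w1 \is a fin_num -> w2 \is a fin_num ->
  0 < fine t2 -> 0 < fine w2 ->
  (c%:E * (t1 / t2) `^ a <= C%:E * (w1 / w2) `^ b)%E ->
  c * (fine t1 / fine t2) `^ a <= C * (fine w1 / fine w2) `^ b.
Proof.
case: t1 => [t1| |]//; case: t2 => [t2| |]//; case: w1 => [w1| |]//.
case: w2 => [w2| |]// _ _ _ _ /= t20 w20.
by rewrite !inver !gt_eqF.
Qed.

Section cell_inequalities.
Context {R : realType} {n : nat}.
Local Notation V := 'rV[R]_n.+1.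
Local Notation lam := (@lebesgue R n).
Local Notation L := (caratheodory_type (@lebesgue_outer R n)).
Local Notation N := n.+1.
Local Notation scale := (@scale R n).
Local Notation half := (@half R n).
Local Notation dir := (@dir n).
Variables (Om : set V) (p : R) (w tau : V -> R).
Hypotheses (oOm : open Om) (bOm : bounded_set Om) (p1 : 1 < p).
Hypothesis adm : p_admissible p Om w tau.
Variables (len : R) (a0 : V).
Hypothesis len0 : 0 < len.
Local Notation C := (cell len 0 a0).
Hypothesis COm : C `<=` Om.
Hypothesis tauC : (0 < wmeas tau C)%E.

Local Notation corner := (corner len a0).
Local Notation cell := (cell len).
Local Notation radius k := (2 * N%:R * scale len k).
Local Notation ball k a := (eball Om (center len k a) (radius k)).
Local Notation tm A := (fine (wmeas tau A)).
Local Notation wm A := (fine (wmeas w A)).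

Let p0 : 0 < p. Proof. exact: lt_trans p1. Qed.
Let tau_pos : (0 < wmeas tau Om)%E := cube_tau_pos oOm adm COm tauC.
Let mball k a : measurable (ball k a : set L).
Proof. exact: measurable_eball. Qed.

Lemma scale_le k : scale len k <= len.
Proof.
by rewrite /scale ler_pdivrMr ?exprn_gt0// ler_peMr ?(ltW len0)// exprn_ege1// ler1n.
Qed.

Lemma scale0 : scale len 0 = len.
Proof. by rewrite /scale div0n expr0 divr1. Qed.

Lemma ball_tau_gt0 k a r : corner k a -> 0 < r ->
  0 < tm (eball Om (center len k a) r).
Proof.
move=> ka r0; rewrite fine_gt0//.
rewrite (tau_ball_gt0 oOm bOm adm) ?center_in//=; last exact: (center_in len0 COm ka).
by rewrite ltey_eq (tau_fin oOm bOm adm)//; [exact: measurable_eball|exact: eball_sub].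
Qed.

Lemma ball_w_gt0 k a r : corner k a -> 0 < r ->
  0 < wm (eball Om (center len k a) r).
Proof.
move=> ka r0; rewrite fine_gt0//.
rewrite (w_ball_gt0 oOm bOm p1 adm)//=; last exact: (center_in len0 COm ka).
by rewrite ltey_eq (w_fin oOm bOm adm)//; [exact: measurable_eball|exact: eball_sub].
Qed.

Lemma cube_w_gt0 : 0 < wm C.
Proof.
have c0 := @corner0 R n len a0.
have s0 : 0 < scale len 0 / 4 by rewrite divr_gt0// scale_gt0.
apply: lt_le_trans (ball_w_gt0 c0 s0) _.
apply: fine_le.
- by apply: (w_fin oOm bOm adm); [exact: measurable_eball|exact: eball_sub].
- by apply: (w_fin oOm bOm adm) => //; exact: measurable_cell.
apply: (w_mono oOm adm _ (measurable_cell _ _ _) COm); first exact: measurable_eball.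
exact: small_ball_sub.
Qed.

Section balance.
Variables (Cb q : R).
Hypotheses (Cb0 : 0 < Cb) (pq : p < q).
Hypothesis bal : forall s r x, 0 < s -> s <= r -> Om x ->
  ((s / r)%:E * (wmeas tau (eball Om x s) / wmeas tau (eball Om x r)) `^ q^-1 <=
   Cb%:E * (wmeas w (eball Om x s) / wmeas w (eball Om x r)) `^ p^-1)%E.

Let q0 : 0 < q. Proof. exact: lt_trans pq. Qed.

Lemma real_balance k a : corner k a ->
  scale len k / len * (tm (ball k a) / tm (eball Om (center len k a) (radius 0))) `^ q^-1 <=
  Cb * (wm (ball k a) / wm (eball Om (center len k a) (radius 0))) `^ p^-1.
Proof.
move=> ka; have cO := center_in len0 COm ka.
have r0 m : 0 < radius m by rewrite !mulr_gt0// scale_gt0.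
have rk : radius k <= radius 0.
  by rewrite scale0 -subr_ge0 -mulrBr !mulr_ge0// subr_ge0 scale_le.
have tf r : wmeas tau (eball Om (center len k a) r) \is a fin_num.
  by apply: (tau_fin oOm bOm adm); [exact: measurable_eball|exact: eball_sub].
have wf r : wmeas w (eball Om (center len k a) r) \is a fin_num.
  by apply: (w_fin oOm bOm adm); [exact: measurable_eball|exact: eball_sub].
have -> : scale len k / len = radius k / radius 0.
  by rewrite scale0; field; rewrite gt_eqF//= pnatr_eq0.
apply: (real_quotients (tf _) (tf _) (wf _) (wf _)).
- exact: ball_tau_gt0.
- exact: ball_w_gt0.
exact: (bal (r0 k) rk cO).
Qed.

(** The balance condition compares the ball around a cell with a concentric ball that
    contains the whole cube. The [tau]-measure of the latter is at most that of [Om] and its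
    [w]-measure at least that of the cube, so that both disappear into the constant. *)
Lemma cell_balance : exists2 K : R, 0 <= K & forall k a, corner k a ->
  scale len k * tm (cell k a) `^ q^-1 <= K * wm (ball k a) `^ p^-1.
Proof.
have T0 : 0 < tm Om.
  by rewrite fine_gt0// tau_pos ltey_eq (tau_fin oOm bOm adm)//; exact: measurable_open.
have W0 := cube_w_gt0.
exists (len * Cb * tm Om `^ q^-1 * (wm C `^ p^-1)^-1).
  by rewrite !mulr_ge0 ?invr_ge0 ?powR_ge0// ltW.
move=> k a ka; have cO := center_in len0 COm ka.
have h := real_balance ka.
have r0 m : 0 < radius m by rewrite !mulr_gt0// scale_gt0.
have ts0 := ball_tau_gt0 ka (r0 k); have tr0 := ball_tau_gt0 ka (r0 0%N).
have ws0 := ball_w_gt0 ka (r0 k); have wr0 := ball_w_gt0 ka (r0 0%N).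
set ts := tm (ball k a) in h ts0; set tr := tm (eball _ _ (radius 0)) in h tr0.
set ws := wm (ball k a) in h ws0 *; set wr := wm (eball _ _ (radius 0)) in h wr0.
have tfin A : measurable (A : set L) -> A `<=` Om -> wmeas tau A \is a fin_num.
  exact: (tau_fin oOm bOm adm).
have wfin A : measurable (A : set L) -> A `<=` Om -> wmeas w A \is a fin_num.
  exact: (w_fin oOm bOm adm).
have tcs : tm (cell k a) <= ts.
  apply: fine_le; rewrite ?tfin//; try exact: eball_sub; try exact: measurable_cell.
    exact: (corner_in len0 COm ka).
  apply: (tau_mono oOm adm (measurable_cell _ _ _) (mball _ _)); first exact: eball_sub.
  exact: (cell_sub_ball len0 COm ka).
have trO : tr <= tm Om.
  apply: fine_le; rewrite ?tfin//; try exact: eball_sub; try exact: measurable_open.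
    exact: measurable_eball.
  apply: (tau_mono oOm adm) => //.
  - exact: measurable_eball.
  - exact: measurable_open.
  - exact: eball_sub.
have wCr : wm C <= wr.
  apply: fine_le; rewrite ?wfin//; try exact: eball_sub; try exact: measurable_cell.
    exact: measurable_eball.
  apply: (w_mono oOm adm (measurable_cell _ _ _)); [exact: measurable_eball|exact: eball_sub|].
  move=> x xC; split; first exact: COm.
  apply: (cell_enorm_dist len0 xC); apply: (corner_sub len0 ka).
  exact: center_in_cell.
rewrite !powRM ?invr_ge0 ?(ltW ts0) ?(ltW tr0) ?(ltW ws0) ?(ltW wr0)// in h.
have powV x s : 0 < x -> x^-1 `^ s = (x `^ s)^-1.
  by move=> x0; rewrite -(powR_inv1 (ltW x0)) -powRrM mulN1r powRN.
rewrite !powV// in h.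
have q1 : 0 <= q^-1 by rewrite invr_ge0 ltW.
have pp1 : 0 <= p^-1 by rewrite invr_ge0 ltW.
have H1 : tm (cell k a) `^ q^-1 <= ts `^ q^-1.
  by apply: ge0_ler_powR => //; rewrite nnegrE ?(ltW ts0)// fine_ge0//
    wmeas_ge0// => x /(corner_in len0 COm ka); exact: (admissible_tau_ge0 adm).
have H2 : tr `^ q^-1 <= tm Om `^ q^-1 by apply: ge0_ler_powR => //; rewrite nnegrE ltW.
have H3 : wm C `^ p^-1 <= wr `^ p^-1 by apply: ge0_ler_powR => //; rewrite nnegrE ltW.
apply: (balance_arith len0 (scale_gt0 len0 k) Cb0 H1 H2 H3 _ _ _ h).
- by rewrite powR_gt0.
- by rewrite powR_gt0.
- exact: powR_ge0.
Qed.

(** The [A_p] condition on the ball around a cell bounds the dual weight on the cell. *)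
Lemma cell_hoelder : exists2 K : R, 0 <= K & forall k a (G : V -> R), corner k a ->
  measurable_fun (cell k a : set L) (G : L -> R) ->
  (\int[lam]_(x in cell k a) `|G x|%:E <=
   (K * fine (lam (cell k a)) * wm (ball k a) `^ (- p^-1))%:E *
   wnorm lam w p (cell k a) G)%E.
Proof.
have [K1 K10 hK1] := ap_dual_bound oOm bOm p1 adm tau_pos.
have [K2 K20 hK2] := ball_lebesgue_le oOm adm len0 COm tauC.
exists (K1 * K2) => [|k a G ka mG]; first exact: mulr_ge0.
have r0 : 0 < radius k by rewrite !mulr_gt0// scale_gt0.
have [s [sD sK]] := hK1 _ _ (center_in len0 COm ka) r0 (ball_lebesgue_fin oOm len k a).
have kO := corner_in len0 COm ka.
have sC : (\int[lam]_(x in cell k a) ((w x `^ (p - 1)^-1)%:E)^-1 <= s%:E)%E.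
  apply: le_trans sD; apply: le_integral_subset_lower.
    exact: (cell_sub_ball len0 COm ka).
  by move=> x _; rewrite inve_ge0 lee_fin powR_ge0.
have := @weighted_hoelder _ L R lam (cell k a) w G p s p1 (measurable_cell _ _ _)
  (admissible_measurable_w oOm adm kO) mG
  (fun x Cx => admissible_w_ge0 adm (kO x Cx)) sC.
move=> h; apply: le_trans h _; rewrite muleC lee_wpmul2r ?wnorm_ge0// lee_fin.
apply: le_trans sK _; rewrite ler_wpM2r ?powR_ge0// -(mulrA K1) ler_wpM2l//.
exact: hK2.
Qed.

(** The distance of the averages is at most the scale times the mean of one partial
    derivative. The [A_p] condition bounds the mean by the [w]-norm at the cost of
    [wm (ball k a) `^ (- p^-1)], and the balance condition trades this factor and the scale
    for a power of the [tau]-measure with the larger exponent [q]. *)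
Lemma cell_poincare : exists2 K : R, 0 <= K & forall l (F : V -> R) k a b,
  is_lipschitz l F -> corner k a -> b = a \/ b = sibling len k a ->
  ((`|avg F (cell k.+1 b) - avg F (cell k a)|)%:E <=
   (K * tm (cell k a) `^ (- q^-1))%:E *
   wnorm lam w p (cell k a) (partial F (dir k)))%E.
Proof.
have [K1 K10 hK1] := cell_hoelder.
have [K2 K20 hK2] := cell_balance.
exists (K1 * K2) => [|l F k a b Fl ka bE]; first exact: mulr_ge0.
have l0 := cell_lebesgue_gt0 oOm adm len0 COm tauC.
apply: le_trans (avg_child_dist len0 l0 Fl bE) _.
have mp : measurable_fun (cell k a : set L) (partial F (dir k) : L -> R).
  by apply: measurable_funTS; exact: measurable_partial Fl.
have hl := half_gt0 (n := n) len0 k.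
apply: (@le_trans _ _ ((half len k / fine (lam (cell k a)))%:E *
  ((K1 * fine (lam (cell k a)) * wm (ball k a) `^ (- p^-1))%:E *
   wnorm lam w p (cell k a) (partial F (dir k))))%E).
  by rewrite lee_wpmul2l ?hK1// lee_fin divr_ge0 ?ltW.
rewrite muleA -EFinM lee_wpmul2r ?wnorm_ge0// lee_fin.
have := hK2 _ _ ka.
have r0 : 0 < radius k by rewrite !mulr_gt0// scale_gt0.
have W0 := ball_w_gt0 ka r0.
have t0 := cell_tau_gt0 oOm bOm adm len0 COm tauC ka.
rewrite !powRN => h.
have := l0 k a; have := half_le_scale (n := n) len0 k.
have : 0 < wm (ball k a) `^ p^-1 by rewrite powR_gt0.
have : 0 < tm (cell k a) `^ q^-1 by rewrite powR_gt0.
move: h; move: (half len k) (wm (ball k a) `^ p^-1) (tm (cell k a) `^ q^-1) (fine (lam (cell k a))).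
move: (scale len k).
move=> s h W t lc hK t1 W1 hs lc0.
have -> : h / lc * (K1 * lc / W) = K1 * (h / W) by field; rewrite !gt_eqF.
rewrite -mulrA ler_wpM2l// ler_pdivrMr// mulrAC ler_pdivlMr//.
by apply: le_trans hK; rewrite ler_pM2r.
Qed.

End balance.

Lemma cell_avg_bound k a : corner k a -> exists2 K : R, 0 <= K &
  forall l (F : V -> R), is_lipschitz l F ->
  ((`|avg F (cell k a)|)%:E <= K%:E * wnorm lam w p C F)%E.
Proof.
move=> ka; have [K1 K10 hK1] := cell_hoelder.
have l0 := cell_lebesgue_gt0 oOm adm len0 COm tauC.
exists ((fine (lam (cell k a)))^-1 *
  (K1 * fine (lam (cell k a)) * wm (ball k a) `^ (- p^-1))).
  by rewrite !mulr_ge0 ?invr_ge0 ?powR_ge0 ?(ltW (l0 _ _)).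
move=> l F Fl; apply: le_trans (avg_le len0 l0 k a Fl) _.
rewrite EFinM -muleA lee_wpmul2l ?lee_fin ?invr_ge0 ?(ltW (l0 _ _))//.
have mF A : measurable_fun (A : set L) (F : L -> R) by exact: lipschitz_measurable Fl.
apply: le_trans (hK1 _ _ F ka (mF _)) _.
rewrite lee_wpmul2l ?lee_fin ?mulr_ge0 ?powR_ge0 ?(ltW (l0 _ _))//.
apply: wnorm_subset => //; try exact: measurable_cell.
- exact: ltW.
- exact: (admissible_measurable_w oOm adm COm).
- by move=> x /COm; exact: (admissible_w_ge0 adm).
exact: corner_sub.
Qed.

End cell_inequalities.

(** * Approximation by cell averages *)

Lemma geometric_sum_le (R : realFieldType) (x : R) k m : 0 < x < 1 ->
  \sum_(k <= i < m) x ^+ i <= x ^+ k / (1 - x).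
Proof.
move=> /andP[x0 x1]; have y0 : 0 < 1 - x by rewrite subr_gt0.
have [mk|km] := leqP m k.
  by rewrite big_geq// divr_ge0 ?exprn_ge0 ?ltW.
have -> : \sum_(k <= i < m) x ^+ i = (x ^+ k - x ^+ m) / (1 - x).
  elim: m km => // m IH; rewrite ltnS leq_eqVlt => /predU1P[->|km].
    by rewrite big_nat1 exprS; field; rewrite gt_eqF.
  by rewrite big_nat_recr/= ?(ltnW km)// IH// exprS; field; rewrite gt_eqF.
by rewrite ler_pM2r ?invr_gt0// gerBl exprn_ge0 ?ltW.
Qed.

Section dyadic_expectation.
Context {R : realType} {n : nat}.
Local Notation V := 'rV[R]_n.+1.
Local Notation lam := (@lebesgue R n).
Local Notation L := (caratheodory_type (@lebesgue_outer R n)).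
Local Notation scale := (@scale R n).
Local Notation half := (@half R n).
Local Notation dir := (@dir n).
Variable len : R.
Hypothesis len0 : 0 < len.
Local Notation cell := (cell len).

(** The conditional expectation of [F] on the cells [m] generations below [cell k a]. *)
Fixpoint cavg (F : V -> R) (m k : nat) (a x : V) : R :=
  if m is m'.+1 then
    if x ord0 (dir k) < a ord0 (dir k) + half len k then cavg F m' k.+1 a x
    else cavg F m' k.+1 (sibling len k a) x
  else avg F (cell k a).

Lemma cavg_left F m k a x : cell k.+1 a x ->
  cavg F m.+1 k a x = cavg F m k.+1 a x.
Proof. by rewrite -cell_left// => -[_ /= ->]. Qed.

Lemma cavg_right F m k a x : cell k.+1 (sibling len k a) x ->
  cavg F m.+1 k a x = cavg F m k.+1 (sibling len k a) x.
Proof. by rewrite -cell_right// => -[_ /=]; rewrite leNgt => /negbTE ->. Qed.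

Lemma measurable_cavg F m k a : measurable_fun [set: L] (cavg F m k a : L -> R).
Proof.
elim: m k a => [|m IH] k a /=; first exact: measurable_cst.
apply: measurable_fun_ifT; [|exact: IH|exact: IH].
apply: measurable_fun_ltr; first exact: measurable_coord.
exact: measurable_cst.
Qed.

Hypothesis lam0 : forall k a, 0 < fine (lam (cell k a)).

Lemma cavg_lipschitz l (F : V -> R) m k a x : is_lipschitz l F -> cell k a x ->
  `|F x - cavg F m k a x| <= `|l| * scale len (k + m).
Proof.
move=> Fl; elim: m k a => [|m IH] k a xa.
  by rewrite addn0; exact: avg_lipschitz.
move: xa; rewrite cell_split// => -[xa|xa].
  by rewrite cavg_left// addnS -addSn; exact: IH.
by rewrite cavg_right// addnS -addSn; exact: IH.
Qed.

Lemma cvg_scale : scale len k @[k --> \oo] --> 0.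
Proof.
apply/cvgrPdist_le => e e0.
have [K cK] : exists K : nat, len / e < 2 ^+ K.
  exists (Num.bound (len / e)).
  apply: (@lt_le_trans _ _ (Num.bound (len / e))%:R).
    by rewrite archi_boundP// divr_ge0// ltW.
  by rewrite -natrX ler_nat ltnW// ltn_expl.
exists (K * n.+1)%N => // k /= Kk.
rewrite sub0r normrN gtr0_norm ?scale_gt0// /scale ler_pdivrMr ?exprn_gt0//.
rewrite mulrC -ler_pdivrMr//; apply: (le_trans (ltW cK)).
by rewrite ler_weXn2l ?ler1n// leq_divRL.
Qed.

Lemma cvg_cavg l (F : V -> R) k a x : is_lipschitz l F -> cell k a x ->
  cavg F m k a x @[m --> \oo] --> F x.
Proof.
move=> Fl xa; apply/cvgrPdist_le => e e0.
have e1 : 0 < e / (`|l| + 1) by rewrite divr_gt0// ltr_wpDl.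
have /cvgrPdist_le/(_ _ e1)[K _ hK] := cvg_scale.
exists K => // m /= Km; apply: le_trans (cavg_lipschitz m Fl xa) _.
have /= := hK (k + m)%N (leq_trans Km (leq_addl _ _)).
rewrite sub0r normrN gtr0_norm ?scale_gt0// ler_pdivlMr ?ltr_wpDl// mulrC.
by apply: le_trans; rewrite ler_wpM2r ?lerDl// ltW// scale_gt0.
Qed.

Variables (p : R) (w : V -> R).

(** The [p]-th power of a gradient norm, kept as a sum over the coordinates because each
    bisection involves a single partial derivative. *)
Definition energy (F : V -> R) (A : set V) : \bar R :=
  (\sum_(j < n.+1) \int[lam]_(x in A) (`|partial F j x| `^ p * w x)%:E)%E.

Hypothesis p1 : 1 < p.
Variable (Om : set V).
Hypothesis mw : measurable_fun (Om : set L) (w : L -> R).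
Hypothesis mOm : measurable (Om : set L).
Hypothesis w0 : forall x, Om x -> 0 <= w x.

Lemma measurable_energy_density l F j k a : is_lipschitz l F -> cell k a `<=` Om ->
  measurable_fun (cell k a : set L)
    (fun x : L => (`|partial F j x| `^ p * w x)%:E).
Proof.
move=> Fl aO; apply: measurable_weighted_power.
  exact: measurable_funS mOm aO mw.
by apply: measurable_funTS; exact: measurable_partial Fl.
Qed.

Lemma energy_split l F k a : is_lipschitz l F -> cell k a `<=` Om ->
  energy F (cell k a) =
  (energy F (cell k.+1 a) + energy F (cell k.+1 (sibling len k a)))%E.
Proof.
move=> Fl aO; rewrite /energy -big_split/=; apply: eq_bigr => j _.
have := measurable_energy_density j Fl aO; rewrite (cell_split len0) => mf.
rewrite ge0_integral_setU//.
- exact: measurable_cell.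
- exact: measurable_cell.
- by rewrite -cell_split// => x /aO Ox; rewrite lee_fin mulr_ge0 ?powR_ge0 ?w0.
by apply/eqP; rewrite cell_disjoint.
Qed.

Lemma energy_ge0 F A : A `<=` Om -> (0 <= energy F A)%E.
Proof.
move=> AO; apply: sume_ge0 => j _; apply: integral_ge0 => x /AO Ox.
by rewrite lee_fin mulr_ge0 ?powR_ge0 ?w0.
Qed.

Lemma energy_le l F k a b : is_lipschitz l F ->
  cell k a `<=` cell 0 b -> cell 0 b `<=` Om ->
  (energy F (cell k a) <= energy F (cell 0 b))%E.
Proof.
move=> Fl ab bO; apply: lee_sum => j _; apply: ge0_subset_integral => //.
- exact: measurable_cell.
- exact: measurable_cell.
- exact: measurable_energy_density.
by move=> x /bO Ox; rewrite lee_fin mulr_ge0 ?powR_ge0 ?w0.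
Qed.

Lemma wnorm_partial_le F j A : A `<=` Om ->
  (wnorm lam w p A (partial F j) <= energy F A `^ p^-1)%E.
Proof.
move=> AO; apply: le_poweR; first by rewrite invr_ge0 ltW// (lt_trans _ p1).
  by apply: integral_ge0 => x /AO Ox; rewrite lee_fin mulr_ge0 ?powR_ge0 ?w0.
rewrite /energy (bigD1 j)//= leeDl// sume_ge0// => i _.
by apply: integral_ge0 => x /AO Ox; rewrite lee_fin mulr_ge0 ?powR_ge0 ?w0.
Qed.

Variables (tau : V -> R) (a0 : V) (q r K th : R).
Hypothesis mtau : measurable_fun (Om : set L) (tau : L -> R).
Hypothesis tau0 : forall x, Om x -> 0 <= tau x.
Hypothesis COm : cell 0 a0 `<=` Om.
Local Notation corner := (corner len a0).
Local Notation tm A := (fine (wmeas tau A)).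
Local Notation C := (cell 0 a0).
Hypothesis tfin : forall k a, corner k a -> wmeas tau (cell k a) \is a fin_num.
Hypothesis tpos : forall k a, corner k a -> 0 < tm (cell k a).
Hypothesis tdecay : forall k a, corner k a -> tm (cell k a) <= th ^+ k * tm C.
Hypothesis th01 : 0 < th < 1.
Hypothesis K0 : 0 <= K.
Hypothesis poincare : forall l (F : V -> R) k a b,
  is_lipschitz l F -> corner k a -> b = a \/ b = sibling len k a ->
  ((`|avg F (cell k.+1 b) - avg F (cell k a)|)%:E <=
   (K * tm (cell k a) `^ (- q^-1))%:E *
   wnorm lam w p (cell k a) (partial F (dir k)))%E.
Hypotheses (pr : p <= r) (rq : r < q).

Let p0 : 0 < p. Proof. exact: lt_trans p1. Qed.
Let r0 : 0 < r. Proof. exact: lt_le_trans pr. Qed.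
Let r1 : 1 <= r. Proof. exact: le_trans (ltW p1) pr. Qed.
Let q0 : 0 < q. Proof. exact: lt_trans rq. Qed.
Let cornerO k a : corner k a -> cell k a `<=` Om.
Proof. by move=> ka; apply: subset_trans COm; exact: corner_sub. Qed.

(** On a cell of energy [e] an average moves by at most
    [K * tm (cell k a) `^ (- q^-1) * e `^ p^-1]. The [r]-th power, integrated over the cell,
    is a multiple of [tm (cell k a) `^ (1 - r / q) * e `^ (r / p)]. Since [p <= r], the last
    factor is at most [E `^ (r / p - 1) * e], and the energies [e] of the cells of one
    generation add up to that of the cube; the [tau]-measures decay geometrically. *)
Lemma cavg_step l (F : V -> R) (E : R) m k a : is_lipschitz l F -> 0 <= E ->
  (energy F C <= E%:E)%E -> corner k a ->
  (\int[lam]_(x in cell k a)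
     (`|cavg F m.+1 k a x - cavg F m k a x| `^ r * tau x)%:E <=
   (K `^ r * E `^ (r / p - 1) * (th ^+ (k + m) * tm C) `^ (1 - r / q))%:E *
     energy F (cell k a))%E.
Proof.
move=> Fl E0 FE; elim: m k a => [|m IH] k a ka; last first.
  have aO := cornerO ka.
  rewrite (energy_split Fl aO) ge0_muleDr; last 2 first.
  - by apply: energy_ge0; exact: cornerO (corner_left ka).
  - by apply: energy_ge0; exact: cornerO (corner_right ka).
  have mf : measurable_fun (cell k a : set L) (fun x : L =>
      (`|cavg F m.+2 k a x - cavg F m.+1 k a x| `^ r * tau x)%:E).
    apply: measurable_weighted_power; first exact: measurable_funS mOm aO mtau.
    by apply: measurable_funTS; apply: measurable_funB; exact: measurable_cavg.
  rewrite {1}(cell_split len0) ge0_integral_setU; last first.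
  - by apply/eqP; rewrite cell_disjoint.
  - by rewrite -cell_split// => x /aO Ox; rewrite lee_fin mulr_ge0 ?powR_ge0 ?tau0.
  - by rewrite -cell_split.
  - exact: measurable_cell.
  - exact: measurable_cell.
  rewrite addnS -addSn; apply: leeD.
    apply: le_trans (IH _ _ (corner_left ka)).
    rewrite le_eqVlt; apply/orP; left; apply/eqP; apply: eq_integral => x.
    by rewrite inE => xa; rewrite !(cavg_left _ _ xa).
  apply: le_trans (IH _ _ (corner_right ka)).
  rewrite le_eqVlt; apply/orP; left; apply/eqP; apply: eq_integral => x.
  by rewrite inE => xa; rewrite !(cavg_right _ _ xa).
have aO := cornerO ka.
have eE : (energy F (cell k a) <= E%:E)%E.
  by apply: le_trans FE; apply: energy_le Fl _ COm; exact: corner_sub.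
have e0 := energy_ge0 F aO.
have efin : energy F (cell k a) \is a fin_num.
  by rewrite ge0_fin_numE//; exact: le_lt_trans eE (ltry _).
have [e eEq] := EFin_fin_numP _ efin; rewrite eEq in eE e0 *.
rewrite !lee_fin in eE e0.
set t := tm (cell k a); have t0 : 0 < t by exact: tpos.
have dist b : b = a \/ b = sibling len k a ->
    `|avg F (cell k.+1 b) - avg F (cell k a)| <= K * t `^ (- q^-1) * e `^ p^-1.
  move=> bE; rewrite -lee_fin; apply: le_trans (poincare Fl ka bE) _.
  rewrite [leRHS]EFinM lee_wpmul2l ?lee_fin ?mulr_ge0 ?powR_ge0//.
  by rewrite -poweR_EFin -eEq; exact: wnorm_partial_le.
pose c := (K * t `^ (- q^-1) * e `^ p^-1) `^ r.
apply: (@le_trans _ _ (\int[lam]_(x in cell k a) (c%:E * (tau x)%:E))%E).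
  have mt : measurable_fun (cell k a : set L) (tau : L -> R).
    exact: measurable_funS mOm aO mtau.
  have md : measurable_fun (cell k a : set L)
      (fun x : L => cavg F 1 k a x - cavg F 0 k a x).
    by apply: measurable_funTS; apply: measurable_funB; exact: measurable_cavg.
  apply: ge0_le_integral.
  - exact: measurable_cell.
  - by move=> x /aO Ox; rewrite lee_fin mulr_ge0 ?powR_ge0 ?tau0.
  - exact: (@measurable_weighted_power _ L R tau r _ mt _ md).
  - by apply: emeasurable_funM; [exact: measurable_cst|exact/measurable_EFinP].
  move=> x xa; have Ox := aO _ xa.
  rewrite -EFinM lee_fin ler_wpM2r ?tau0// ge0_ler_powR ?nnegrE ?(ltW r0)//.
    by rewrite !mulr_ge0 ?powR_ge0.
  by move=> /=; case: ifPn => _; apply: dist; [left|right].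
rewrite ge0_integralZl; last first.
- by rewrite lee_fin powR_ge0.
- by move=> x /aO Ox; rewrite lee_fin tau0.
- by apply/measurable_EFinP; exact: measurable_funS mOm aO mtau.
- exact: measurable_cell.
rewrite -/(wmeas tau _) -(fineK (tfin ka)) -/t -!EFinM lee_fin addn0.
have -> : c * t = K `^ r * e `^ (r / p) * t `^ (1 - r / q).
  rewrite /c !powRM ?mulr_ge0 ?powR_ge0// -!powRrM.
  rewrite (_ : t `^ (1 - r / q) = t `^ (- q^-1 * r) * t); last first.
    rewrite addrC powRD ?(gt_eqF t0) ?implybT// powRr1 ?(ltW t0)//.
    by congr (_ `^ _ * _); ring.
  by rewrite [p^-1 * r]mulrC; ring.
have rp1 : 0 <= r / p - 1 by rewrite subr_ge0 ler_pdivlMr// mul1r.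
have rq1 : 0 <= 1 - r / q by rewrite subr_ge0 ler_pdivrMr// mul1r ltW.
have -> : e `^ (r / p) = e `^ (r / p - 1) * e.
  have [->|ne0] := eqVneq e 0; first by rewrite mulr0 powR0// gt_eqF// divr_gt0.
  by rewrite -[X in _ = _ * X](powRr1 e0) -powRD ?ne0 ?implybT// subrK.
have He : e `^ (r / p - 1) <= E `^ (r / p - 1).
  by apply: ge0_ler_powR => //; rewrite nnegrE.
have Ht : t `^ (1 - r / q) <= (th ^+ k * tm C) `^ (1 - r / q).
  apply: ge0_ler_powR => //; rewrite ?nnegrE ?(ltW t0)//; last exact: tdecay.
  by apply: le_trans (tdecay ka); exact: ltW.
rewrite mulrA -[leRHS]mulrA [X in _ <= _ * X]mulrC mulrA.
rewrite ler_pM ?mulr_ge0 ?powR_ge0// ler_wpM2r//.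
by rewrite ler_wpM2l ?powR_ge0.
Qed.

(** The increments decay geometrically because [r < q] makes the exponent [1 - r / q] in
    [cavg_step] positive, and the averages converge to [F] pointwise. *)
Lemma cavg_approx : exists2 Kt : R, 0 <= Kt & exists2 eta : R, 0 < eta < 1 &
  forall l (F : V -> R) (E : R) m, is_lipschitz l F -> 0 <= E ->
  (energy F C <= E%:E)%E ->
  (wnorm lam tau r C (fun x => F x - cavg F m 0 a0 x)%R <=
   (Kt * E `^ p^-1 * eta ^+ m)%:E)%E.
Proof.
have /andP[t0 t1] := th01.
have tC0 : 0 < tm C by apply: tpos; exact: corner0.
(* [s * r] is the exponent [1 - r / q] of [cavg_step] *)
pose s := r^-1 - q^-1; have s0 : 0 < s by rewrite subr_gt0 ltf_pV2.
pose eta := th `^ s.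
have eta01 : 0 < eta < 1.
  have one : 1 `^ s = 1 by rewrite powR1.
  by rewrite /eta powR_gt0//= -[ltRHS]one gt0_ltr_powR ?nnegrE ?(ltW t0).
pose D := K * tm C `^ s.
exists (D / (1 - eta)).
  have /andP[_ e1] := eta01.
  by rewrite divr_ge0 ?mulr_ge0 ?powR_ge0// subr_ge0 ltW.
exists eta => // l F E m Fl E0 FE.
have mt : measurable_fun (C : set L) (tau : L -> R) by exact: measurable_funS mOm COm mtau.
have tC x : C x -> 0 <= tau x by move=> /COm; exact: tau0.
have mcC i : measurable_fun (C : set L) (cavg F i 0 a0 : L -> R).
  by apply: measurable_funTS; exact: measurable_cavg.
have mF : measurable_fun (C : set L) (F : L -> R) by exact: lipschitz_measurable Fl.
have mC : measurable (C : set L) by exact: measurable_cell.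
have inc i : (wnorm lam tau r C (cavg F i.+1 0 a0 \- cavg F i 0 a0)%R <=
    (D * E `^ p^-1 * eta ^+ i)%:E)%E.
  have b0 : 0 <= D * E `^ p^-1 * eta ^+ i.
    by rewrite !mulr_ge0 ?powR_ge0// exprn_ge0// powR_ge0.
  rewrite (wnorm_le_pow lam r1 tC)//.
  apply: le_trans (cavg_step i Fl E0 FE (corner0 len a0)) _.
  apply: (@le_trans _ _ ((K `^ r * E `^ (r / p - 1) *
      (th ^+ (0 + i) * tm C) `^ (1 - r / q))%:E * E%:E)%E).
    by rewrite lee_wpmul2l// lee_fin !mulr_ge0 ?powR_ge0.
  rewrite -EFinM lee_fin add0n le_eqVlt; apply/orP; left; apply/eqP.
  have ti0 : 0 <= th ^+ i by rewrite exprn_ge0 ?ltW.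
  have e1 : th ^+ i = th `^ i%:R by rewrite powR_mulrn// ltW.
  have e2 : (th `^ s) ^+ i = th `^ (s * i%:R) by rewrite powRrM powR_mulrn// powR_ge0.
  rewrite /D /eta e1 e2 !powRM ?mulr_ge0 ?powR_ge0 ?(ltW tC0)//.
  rewrite -!powRrM.
  have sr : s * r = 1 - r / q by rewrite /s; field; rewrite !gt_eqF.
  have -> : s * i%:R * r = i%:R * (1 - r / q) by rewrite -sr; ring.
  rewrite sr [p^-1 * r]mulrC.
  have -> : E `^ (r / p) = E `^ (r / p - 1) * E.
    have [->|ne0] := eqVneq E 0; first by rewrite mulr0 powR0// gt_eqF// divr_gt0.
    by rewrite -[X in _ = _ * X](powRr1 E0) -powRD ?ne0 ?implybT// subrK.
  ring.
apply: (@wnorm_fatou _ _ _ lam tau r C r1 mC mt tC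
  (fun i => cavg F (i + m) 0 a0 \- cavg F m 0 a0)).
- have /andP[e0 e1] := eta01.
  by rewrite !mulr_ge0 ?invr_ge0 ?powR_ge0 ?exprn_ge0 ?(ltW e0)// subr_ge0 ltW.
- by move=> i; exact: measurable_funB.
- exact: measurable_funB.
- apply/aeW => x xC _; apply: cvgB; last exact: cvg_cst.
  by rewrite (cvg_shiftn m (fun i => cavg F i 0 a0 x)); exact: cvg_cavg Fl xC.
move=> i.
have := @wnorm_sum _ _ _ lam tau r C r1 mC mt tC (fun i => cavg F i 0 a0)
  (fun i => D * E `^ p^-1 * eta ^+ i) m (i + m) (leq_addl _ _) mcC (fun j _ => inc j).
move=> /le_trans; apply; rewrite lee_fin -mulr_sumr.
rewrite (_ : D / _ * _ * _ = D * E `^ p^-1 * (eta ^+ m / (1 - eta))); last by ring.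
by rewrite ler_wpM2l ?mulr_ge0 ?powR_ge0// geometric_sum_le.
Qed.

End dyadic_expectation.

(** * Subsequences *)

Section subsequences.

Definition subseq_index (phi : nat -> nat) := {homo phi : i j / (i < j)%N}.

Lemma subseq_index_id : subseq_index id.
Proof. by []. Qed.

Lemma subseq_index_comp f g : subseq_index f -> subseq_index g ->
  subseq_index (f \o g).
Proof. by move=> hf hg i j ij /=; apply/hf/hg. Qed.

Lemma subseq_index_ge f k : subseq_index f -> (k <= f k)%N.
Proof.
by move=> hf; elim: k => // k IH; apply: leq_ltn_trans IH _; exact: hf.
Qed.

Lemma subseq_index_step (f : nat -> nat) :
  (forall k, (f k < f k.+1)%N) -> subseq_index f.
Proof.
move=> h i j; elim: j => // j IH; rewrite ltnS leq_eqVlt => /predU1P[->//|].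
by move=> /IH /ltn_trans; apply.
Qed.

Lemma bounded_close_subseq (R : realType) (u : R^nat) (M e : R) :
  0 < e -> (forall k, `|u k| <= M) ->
  exists2 phi, subseq_index phi & forall i j, `|u (phi i) - u (phi j)| <= e.
Proof.
move=> e0 uM.
have : compact (`[- M, M]%classic : set R) by exact: segment_compact.
pose F := u @ \oo.
have FM : F `[- M, M]%classic.
  by exists 0%N => // k _ /=; rewrite in_itv/= -ler_norml.
move=> /(_ F _ FM)[l [_ cl]].
have near_l m : exists k, (m <= k)%N /\ `|u k - l| <= e / 2.
  have Fm : F (u @` [set k | (m <= k)%N]).
    by exists m => // k /= mk; exists k.
  have lb : nbhs l (ball l (e / 2)) by apply: nbhsx_ballx; rewrite divr_gt0.
  have [_ [[k /= mk <-]]] := cl _ _ Fm lb.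
  by rewrite -ball_normE/= distrC => /ltW; exists k.
have [f hf] := choice near_l.
pose phi := fix phi i := if i is i'.+1 then f (phi i').+1 else f 0%N.
exists phi.
  by apply: subseq_index_step => k /=; have [] := hf (phi k).+1.
have hphi i : `|u (phi i) - l| <= e / 2.
  by case: i => [|i] /=; [have [] := hf 0%N|have [] := hf (phi i).+1].
move=> i j; rewrite (_ : _ - _ = (u (phi i) - l) - (u (phi j) - l)); last by ring.
by rewrite (le_trans (ler_normB _ _))// [leRHS]splitr lerD.
Qed.

(** Cantor's diagonal: if at every scale every subsequence has a further one that is
    close at that scale, then some subsequence is close at all scales eventually. *)
Lemma diagonal_subseq (P : nat -> nat -> nat -> Prop) :
  (forall m phi, subseq_index phi -> exists2 psi, subseq_index psi &
     forall i j, P m (phi (psi i)) (phi (psi j))) ->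
  exists2 phi, subseq_index phi &
    forall m i j, (m <= i)%N -> (m <= j)%N -> P m (phi i) (phi j).
Proof.
move=> H.
pose sub := {phi : nat -> nat | subseq_index phi}.
have step (m : nat) (phi : sub) : {psi : sub |
    forall i j, P m (sval phi (sval psi i)) (sval phi (sval psi j))}.
  by apply: cid; have [psi hpsi Ppsi] := H m _ (svalP phi); exists (exist _ psi hpsi).
pose comp (f g : sub) : sub :=
  exist _ (sval f \o sval g) (subseq_index_comp (svalP f) (svalP g)).
pose Phi := fix Phi m : sub := if m is m'.+1
  then comp (Phi m') (sval (step m' (Phi m'))) else exist _ id subseq_index_id.
have Phi_tail m i : (m <= i)%N -> exists2 g, subseq_index g &
    forall k, sval (Phi i) k = sval (Phi m) (g k).
  elim: i => [|i IH].
    by rewrite leqn0 => /eqP ->; exists id.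
  rewrite leq_eqVlt => /predU1P[->|]; first by exists id.
  rewrite ltnS => /IH[g hg gE].
  exists (g \o sval (sval (step i (Phi i)))).
    by apply: subseq_index_comp => //; exact: svalP.
  by move=> k /=; rewrite gE.
exists (fun i => sval (Phi i.+1) i).
  apply: subseq_index_step => k.
  have [g hg gE] := Phi_tail k.+1 k.+2 (leqnSn _).
  rewrite gE; apply: (svalP (Phi k.+1)).
  exact: (subseq_index_ge _ hg).
move=> m i j mi mj.
have [g hg ->] := Phi_tail m.+1 i.+1 mi; have [g' hg' ->] := Phi_tail m.+1 j.+1 mj.
exact: (svalP (step m (Phi m))).
Qed.

End subsequences.

(** * Compactness on a cube *)

Section cube_compactness.
Context {R : realType} {n : nat}.
Local Notation V := 'rV[R]_n.+1.
Local Notation lam := (@lebesgue R n).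
Local Notation L := (caratheodory_type (@lebesgue_outer R n)).
Variables (Om : set V) (p : R) (w tau : V -> R).
Hypotheses (oOm : open Om) (bOm : bounded_set Om) (p1 : 1 < p).
Hypothesis adm : p_admissible p Om w tau.
Variables (len : R) (a0 : V).
Hypothesis len0 : 0 < len.
Local Notation C := (cell len 0 a0).
Hypothesis COm : C `<=` Om.
Variables (Cb q r : R).
Hypotheses (Cb0 : 0 < Cb) (pr : p <= r) (rq : r < q).
Hypothesis bal : forall s r x, 0 < s -> s <= r -> Om x ->
  ((s / r)%:E * (wmeas tau (eball Om x s) / wmeas tau (eball Om x r)) `^ q^-1 <=
   Cb%:E * (wmeas w (eball Om x s) / wmeas w (eball Om x r)) `^ p^-1)%E.

Let pq : p < q. Proof. exact: le_lt_trans rq. Qed.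
Let r1 : 1 <= r. Proof. exact: le_trans (ltW p1) pr. Qed.
Let r0 : 0 < r. Proof. exact: lt_le_trans r1. Qed.
Let mC : measurable (C : set L). Proof. exact: measurable_cell. Qed.
Let mtC : measurable_fun (C : set L) (tau : L -> R).
Proof. exact: (admissible_measurable_tau oOm adm COm). Qed.
Let tC x : C x -> 0 <= tau x.
Proof. by move=> /COm; exact: (admissible_tau_ge0 adm). Qed.

Lemma wnorm_null_cube f : wmeas tau C = 0%E -> measurable_fun (C : set L) (f : L -> R) ->
  wnorm lam tau r C f = 0%E.
Proof.
move=> tC0 mf; rewrite /wnorm.
suff -> : (\int[lam]_(x in C) (`|f x| `^ r * tau x)%:E)%E = 0%E.
  by rewrite poweR0r// invr_neq0// gt_eqF.
have mtE : measurable_fun (C : set L) (fun x : L => (tau x)%:E) by exact/measurable_EFinP.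
have : (\int[lam]_(x in C) `|(tau x)%:E| = 0)%E.
  rewrite -[RHS]tC0; apply: eq_integral => x; rewrite inE => Cx.
  by rewrite gee0_abs// lee_fin tC.
move=> /(ae_eq_integral_abs lam mC mtE) t0.
rewrite (ae_eq_integral (cst 0%E))//; first by rewrite integral0.
  exact: (@measurable_weighted_power _ L R tau r C mtC f mf).
apply: filterS t0 => x h Cx.
by have := h Cx => -[->]; rewrite mulr0.
Qed.

(** A cell average ranges over a bounded set of numbers, and there are finitely many
    cells [m] generations below a given one. *)
Lemma cavg_close_subseq (F : nat -> V -> R) m k a (e : R) : 0 < e ->
  (forall b j, corner len a0 j b -> exists M : R, forall i, `|avg (F i) (cell len j b)| <= M) ->
  corner len a0 k a ->
  exists2 phi, subseq_index phi & forall i j x, cell len k a x ->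
    `|cavg len (F (phi i)) m k a x - cavg len (F (phi j)) m k a x| <= e.
Proof.
move=> e0; elim: m k a F => [|m IH] k a F bF ka.
  have [M hM] := bF a k ka.
  have [phi hphi close] := bounded_close_subseq e0 hM.
  by exists phi => // i j x _ /=; exact: close.
have [phi hphi close1] := IH _ _ F bF (corner_left ka).
have bF' b j : corner len a0 j b ->
    exists M : R, forall i, `|avg ((F \o phi) i) (cell len j b)| <= M.
  by move=> /bF[M hM]; exists M => i; exact: hM.
have [psi hpsi close2] := IH _ _ (F \o phi) bF' (corner_right ka).
exists (phi \o psi); first exact: subseq_index_comp.
move=> i j x; rewrite (cell_split len0) => -[xa|xa].
  by rewrite !(cavg_left len0 _ _ xa) /=; exact: close1.
by rewrite !(cavg_right len0 _ _ xa) /=; exact: close2.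
Qed.

(** At a fine generation all the functions are uniformly close to their averages; these
    take finitely many values, each ranging over a bounded set. *)
Lemma cube_close_subseq (F : nat -> V -> R) (E M e : R) : 0 < e -> 0 <= E ->
  (forall i, exists l, is_lipschitz l (F i)) ->
  (forall i, energy p w (F i) C <= E%:E)%E ->
  (forall i, wnorm lam w p C (F i) <= M%:E)%E ->
  exists2 phi, subseq_index phi & forall i j,
    (wnorm lam tau r C (F (phi i) \- F (phi j))%R <= e%:E)%E.
Proof.
move=> e0 E0 lF FE FM.
have mF i : measurable_fun (C : set L) (F i : L -> R).
  by have [l Fl] := lF i; exact: lipschitz_measurable Fl.
have [t0|tpos] := eqVneq (wmeas tau C) 0%E.
  exists id => // i j; rewrite wnorm_null_cube ?lee_fin ?(ltW e0)//.
  exact: measurable_funB.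
have {}tpos : (0 < wmeas tau C)%E.
  by rewrite lt0e tpos wmeas_ge0.
have [K K0 poinc] := cell_poincare oOm bOm p1 adm len0 COm tpos Cb0 pq bal.
have [th th01 decay] := cell_tau_decay oOm bOm adm len0 COm.
have lam0 := cell_lebesgue_gt0 oOm adm len0 COm tpos.
have mOm := measurable_open oOm.
have Oid : Om `<=` Om by [].
have [Kt Kt0 [eta eta01 approx]] := @cavg_approx R n len len0 lam0 p w p1 Om
  (admissible_measurable_w oOm adm Oid) mOm (admissible_w_ge0 adm) tau a0 q r K th
  (admissible_measurable_tau oOm adm Oid) (admissible_tau_ge0 adm) COm
  (fun k a ka => tau_fin oOm bOm adm (measurable_cell len k a) (corner_in len0 COm ka))
  (fun k a ka => cell_tau_gt0 oOm bOm adm len0 COm tpos ka)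
  decay th01 K0 poinc pr rq.
have e4 : 0 < e / 4 by rewrite divr_gt0.
have [m hm] : exists m, Kt * E `^ p^-1 * eta ^+ m <= e / 4.
  have /andP[eta0 eta1] := eta01.
  have : Kt * E `^ p^-1 * eta ^+ m @[m --> \oo] --> Kt * E `^ p^-1 * 0.
    by apply: cvgM; [exact: cvg_cst|apply: cvg_expr; rewrite ger0_norm// ltW].
  rewrite mulr0 => /cvgrPdist_le/(_ _ e4)[m _ hm].
  exists m; have /= := hm m (leqnn m); rewrite sub0r normrN; apply: le_trans.
  exact: ler_norm.
have bavg b j : corner len a0 j b ->
    exists M : R, forall i, `|avg (F i) (cell len j b)| <= M.
  move=> jb; have [K1 K10 hK1] := cell_avg_bound oOm bOm p1 adm len0 COm tpos jb.
  exists (K1 * M) => i; have [l Fl] := lF i.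
  rewrite -lee_fin; apply: le_trans (hK1 _ _ Fl) _.
  by rewrite EFinM lee_wpmul2l.
have tfin : wmeas tau C \is a fin_num := tau_fin oOm bOm adm mC COm.
pose T := fine (wmeas tau C).
have T0 : 0 < T by rewrite fine_gt0// tpos ltey_eq tfin.
pose e' := e / 2 / T `^ r^-1.
have e'0 : 0 < e' by rewrite !divr_gt0// powR_gt0.
have [phi hphi close] := cavg_close_subseq m e'0 bavg (corner0 len a0).
exists phi => // i j.
have mc s : measurable_fun (C : set L) (cavg len (F s) m 0 a0 : L -> R).
  by apply: measurable_funTS; exact: measurable_cavg.
have ap s : (wnorm lam tau r C (F s \- cavg len (F s) m 0 a0)%R <= (e / 4)%:E)%E.
  have [l Fl] := lF s.
  by apply: le_trans (approx l (F s) E m Fl E0 (FE s)) _; rewrite lee_fin.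
have mid : (wnorm lam tau r C
    (cavg len (F (phi i)) m 0 a0 \- cavg len (F (phi j)) m 0 a0)%R <= (e / 2)%:E)%E.
  apply: (@le_trans _ _ (wnorm lam tau r C (cst e'))).
    apply: (wnorm_le lam r1 mC mtC tC).
    - exact: measurable_funB.
    - exact: measurable_cst.
    by move=> x xC /=; rewrite [leRHS]ger0_norm ?(ltW e'0)//; exact: close.
  rewrite (wnorm_le_pow lam r1 tC) ?divr_ge0 ?(ltW e0)//.
  have mtE : measurable_fun (C : set L) (fun x : L => (tau x)%:E).
    exact/measurable_EFinP.
  have tE x : C x -> (0 <= (tau x)%:E)%E by move=> xC; rewrite lee_fin tC.
  rewrite (eq_integral (fun x : L => ((e' `^ r)%:E * (tau x)%:E)%E)); last first.
    by move=> x _; rewrite /= (ger0_norm (ltW e'0)) EFinM.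
  rewrite (@ge0_integralZl_EFin _ L R lam C mC (fun x => (tau x)%:E) tE mtE
    (e' `^ r) (powR_ge0 _ _)).
  rewrite -/(wmeas tau C) -(fineK tfin) -EFinM lee_fin -/T.
  rewrite (_ : T = (T `^ r^-1) `^ r); last first.
    by rewrite -powRrM mulVf ?gt_eqF// powRr1// ltW.
  rewrite -powRM ?powR_ge0 ?(ltW e'0)//.
  by rewrite /e' divfK// gt_eqF// powR_gt0.
have h1 := wnorm_dist lam r1 mC mtC tC (mF (phi i)) (mc (phi i)) (mF (phi j)).
apply: le_trans h1 _.
have h2 := wnorm_dist lam r1 mC mtC tC (mc (phi i)) (mc (phi j)) (mF (phi j)).
rewrite (_ : e%:E = (e / 4)%:E + ((e / 2)%:E + (e / 4)%:E))%E; last first.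
  by rewrite -!EFinD; congr EFin; field.
apply: leeD; first exact: ap.
apply: le_trans h2 _; apply: leeD; first exact: mid.
by rewrite wnorm_distC; exact: ap.
Qed.

End cube_compactness.

(** * Locally Lipschitz functions on cubes *)

Section lipschitz_extension.
Context {R : realType} {n : nat}.
Local Notation V := 'rV[R]_n.+1.

Definition closed_box (a b : V) : set V := [set x | forall i, a ord0 i <= x ord0 i <= b ord0 i].

(** The retraction of the whole space onto a box. *)
Definition clip (a b x : V) : V :=
  \row_i Num.max (a ord0 i) (Num.min (b ord0 i) (x ord0 i)).

Lemma clip_in (a b x : V) : (forall i, a ord0 i <= b ord0 i) -> closed_box a b (clip a b x).
Proof.
by move=> ab i; rewrite mxE le_max lexx/= ge_max ab ge_min lexx.
Qed.

Lemma clip_id (a b x : V) : closed_box a b x -> clip a b x = x.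
Proof.
move=> xab; apply/rowP => i; rewrite mxE; have /andP[ax xb] := xab i.
by rewrite min_r// max_r.
Qed.

Lemma clip_contract (a b x y : V) : `|clip a b x - clip a b y| <= `|x - y|.
Proof.
rewrite rV_norm_le//; apply/forallP => i; rewrite !mxE.
apply: le_trans (coord_le_norm (x - y) i); rewrite !mxE.
move: (a ord0 i) (b ord0 i) (x ord0 i) (y ord0 i) => {}a {}b {}x {}y.
have := ler_norm (x - y); have := ler_norm (y - x); rewrite distrC ler_norml.
move: `|x - y| => d h1 h2.
have d0 : 0 <= d by lra.
by case: (leP b x) => ?; case: (leP b y) => ?; case: (leP a) => ?; try case: (leP a) => ?;
  apply/andP; split; lra.
Qed.

Lemma closed_box_compact (a b : V) : compact (closed_box a b).
Proof.
apply: bounded_closed_compact.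
  exists (`|a| + `|b|); split; first exact: num_real.
  move=> c abc x xab; apply: le_trans (ltW abc).
  rewrite rV_norm_le ?addr_ge0//; apply/forallP => i; have /andP[ax xb] := xab i.
  have := coord_le_norm a i; have := coord_le_norm b i; rewrite !ler_norml.
  by move=> /andP[? ?] /andP[? ?]; apply/andP; split; lra.
rewrite (_ : closed_box a b = \bigcap_(i in [set: 'I_n.+1])
  ((fun x : V => x ord0 i) @^-1` `[a ord0 i, b ord0 i]%classic)); last first.
  apply/seteqP; split => [x xab i _|x xab i] /=; first by rewrite in_itv/=; exact: xab.
  by have := xab i I; rewrite /= in_itv.
apply: closed_bigI => i _; apply: preimage_closed; last exact: interval_closed.
by move=> x _; exact: coord_continuous.
Qed.

(** On a compact set local Lipschitz constants can be made uniform; points at a definite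
    distance are handled by boundedness. *)
Lemma compact_lipschitz (G K : set V) (f : V -> R) :
  locally_lipschitz G f -> compact K -> K `<=` G ->
  exists2 l : R, 0 <= l & forall x y, K x -> K y -> `|f x - f y| <= l * `|x - y|.
Proof.
move=> fG /compact_near_coveringP cK KG.
have loc x : K x -> exists2 d : R, 0 < d & exists2 l : R, 0 <= l &
    forall y z, G y -> G z -> `|x - y| < d -> `|x - z| < d ->
    `|f y - f z| <= l * `|y - z|.
  move=> Kx; have [U /nbhs_ballP[d /= d0 dU] [M [Mr hM]]] := fG x (KG _ Kx).
  exists d => //; exists (`|M| + 1); first by rewrite addr_ge0.
  move=> y z Gy Gz xy xz.
  have MM : M < `|M| + 1 by rewrite (le_lt_trans (ler_norm _))// ltrDl.
  apply: (hM _ MM (y, z)); split => /=.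
    by split=> //; apply: dU; rewrite -ball_normE.
  by split=> //; apply: dU; rewrite -ball_normE.
have [B hB] : exists B : R, forall x, K x -> `|f x| <= B.
  have := cK R +oo%R (fun B x => K x -> `|f x| <= B) _.
  move=> /(_ _) H.
  have {}H : \forall B \near +oo, K `<=` (fun x => K x -> `|f x| <= B).
    apply: H => x Kx; have [d d0 [l l0 hl]] := loc x Kx.
    exists (ball x d, [set B : R | `|f x| + l * d < B]) => /=.
      by split; [apply: nbhsx_ballx|apply: nbhs_pinfty_gt; exact: num_real].
    move=> [y B] /= [xy fB] Ky; apply: le_trans (ltW fB).
    rewrite -(subrKC (f x) (f y)) (le_trans (ler_normD _ _))// lerD2l distrC.
    rewrite -ball_normE /= in xy.
    apply: le_trans (hl x y (KG _ Kx) (KG _ Ky) _ xy) _; first by rewrite subrr normr0.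
    by rewrite ler_wpM2l// ltW.
  have [B [Br hB]] := H; exists (B + 1) => x Kx.
  by apply: (hB (B + 1)) => //; rewrite ltrDl.
pose P l x := K x -> forall y, K y -> `|f x - f y| <= l * `|x - y|.
have H : \forall l \near +oo, K `<=` P l.
  apply: (cK R +oo%R P _) => x Kx; have [d d0 [l l0 hl]] := loc x Kx.
  exists (ball x (d / 2), [set m : R | l + 4 * `|B| / d < m]) => /=.
    split; [by apply: nbhsx_ballx; rewrite divr_gt0|].
    by apply: nbhs_pinfty_gt; exact: num_real.
  move=> [y m] /= [xy lm] Ky z Kz; rewrite -ball_normE /= in xy.
  have Bd : 0 <= 4 * `|B| / d by rewrite divr_ge0 ?mulr_ge0// ltW.
  have [yz|yz] := ltP `|y - z| (d / 2).
    apply: (@le_trans _ _ (l * `|y - z|)); last first.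
      by rewrite ler_wpM2r// (le_trans _ (ltW lm))// lerDl.
    apply: hl; [exact: KG|exact: KG| |].
      by rewrite (lt_le_trans xy)// ler_pdivrMr// ler_peMr ?ler1n// ltW.
    rewrite -(subrK y x) -addrA (le_lt_trans (ler_normD _ _))// [ltRHS]splitr.
    exact: ltrD.
  apply: (@le_trans _ _ (2 * `|B|)).
    rewrite (le_trans (ler_normB _ _))// mulr2n mulrDl mul1r lerD//;
    exact: le_trans (hB _ _) (ler_norm _).
  apply: (@le_trans _ _ (4 * `|B| / d * (d / 2))).
    by rewrite (_ : _ * (d / 2) = 2 * `|B|)//; field; rewrite gt_eqF.
  rewrite ler_pM// ?divr_ge0 ?(ltW d0)// (le_trans _ (ltW lm))// lerDr//.
have [l [lr hl]] := H; exists (`|l| + 1); first by rewrite addr_ge0.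
move=> x y Kx Ky; apply: (hl (`|l| + 1)) => //.
by rewrite (le_lt_trans (ler_norm _))// ltrDl.
Qed.

(** Composition with the retraction onto the box. *)
Lemma lipschitz_extension (G : set V) (f : V -> R) (a b : V) :
  locally_lipschitz G f -> (forall i, a ord0 i <= b ord0 i) ->
  closed_box a b `<=` G ->
  exists F l, is_lipschitz l F /\ forall x, closed_box a b x -> F x = f x.
Proof.
move=> fG ab KG.
have [l l0 hl] := compact_lipschitz fG (@closed_box_compact a b) KG.
exists (f \o clip a b), l; split => [x y|x xab] /=; last by rewrite clip_id.
apply: le_trans (hl _ _ (@clip_in a b _ ab) (@clip_in a b _ ab)) _.
by rewrite ler_wpM2l// clip_contract.
Qed.

(** The closed box is the cube enlarged by its edge length on every side; a function may be
    changed outside of it without affecting the derivatives in the cube. *)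
Definition safe_cube (Om : set V) (al : V * R) :=
  0 < al.2 /\ closed_box (al.1 - const_mx al.2) (al.1 + const_mx (2 * al.2)) `<=` Om.

Lemma safe_cube_sub Om al : safe_cube Om al -> cell al.2 0 al.1 `<=` Om.
Proof.
move=> [l0 lO] x xa; apply: lO => i; have := xa i; rewrite !mxE.
by move=> /andP[? ?]; apply/andP; split; lra.
Qed.

(** On a safe cube a locally Lipschitz function can be replaced by a Lipschitz one with
    the same partial derivatives. *)
Lemma safe_cube_lipschitz Om al (f : V -> R) : safe_cube Om al ->
  locally_lipschitz Om f -> exists F l, [/\ is_lipschitz l F,
    forall x, cell al.2 0 al.1 x -> F x = f x &
    forall x j, cell al.2 0 al.1 x -> partial F j x = partial f j x].
Proof.
move=> [l0 lO] fO; set a := al.1 - _ in lO; set b := al.1 + _ in lO.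
have ab i : a ord0 i <= b ord0 i by rewrite !mxE; lra.
have [F [l [Fl Ff]]] := lipschitz_extension fO ab lO.
have inner x : cell al.2 0 al.1 x -> \forall y \near x, closed_box a b y.
  move=> xa; apply/nbhs_ballP; exists al.2 => // y; rewrite -ball_normE/= => xy i.
  have := xa i; have := le_lt_trans (coord_le_norm _ i) xy; rewrite !mxE ltr_norml.
  by move=> /andP[? ?] /andP[? ?]; apply/andP; split; lra.
exists F, l; split => // [x xa|x j xa].
  by apply: Ff; exact: nbhs_singleton (inner _ xa).
by apply: near_eq_derive; apply: filterS (inner _ xa) => y; exact: Ff.
Qed.

Lemma safe_cube_cover (Om K : set V) : open Om -> compact K -> K `<=` Om ->
  exists s : seq (V * R), (forall al, al \in s -> safe_cube Om al) /\
    forall x, K x -> exists2 al, al \in s & cell al.2 0 al.1 x.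
Proof.
move=> oOm; rewrite compact_cover => cK KO.
have loc x : K x -> exists2 d : R, 0 < d & forall y, `|x - y| < d -> Om y.
  move=> /KO Ox; have /nbhs_ballP[d /= d0 dO] : nbhs x Om by exact: oOm.
  by exists d => // y xy; apply: dO; rewrite -ball_normE.
pose cube (xd : V * R) : V * R := (xd.1 - const_mx (xd.2 / 4), xd.2 / 2).
pose D := [set xd : V * R | 0 < xd.2 /\ forall y, `|xd.1 - y| < xd.2 -> Om y].
have [|x Kx|s sD sK] := cK _ D (fun xd => ball xd.1 (xd.2 / 4)).
- by move=> xd _; exact: ball_open.
- have [d d0 dO] := loc x Kx; exists (x, d) => //=.
  by apply: ballxx; rewrite divr_gt0.
exists [seq cube xd | xd <- finmap.enum_fset s]; split.
  move=> _ /mapP[[x d] /sD + ->]; rewrite inE => -[/= d0 dO].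
  split; first by rewrite /= divr_gt0.
  move=> y yb; apply: dO; rewrite rV_norm_lt//; apply/forallP => i.
  have := yb i; rewrite !mxE /= ltr_norml => /andP[? ?]; apply/andP; split; lra.
move=> x /sK[[y d] /= ys]; rewrite -ball_normE/= => xy.
have := sD _ ys; rewrite inE => -[/= d0 _].
exists (cube (y, d)); first by apply/mapP; exists (y, d).
move=> i; have := le_lt_trans (coord_le_norm _ i) xy; rewrite !mxE ltr_norml /=.
by move=> /andP[? ?]; apply/andP; split; lra.
Qed.

End lipschitz_extension.

(** * Compactness for locally Lipschitz functions *)

Section weighted_norm_null.
Context d (T : measurableType d) (R : realType) (mu : {measure set T -> \bar R}).
Variables (tau : T -> R) (E : set T).
Hypothesis mE : measurable E.
Hypothesis mtau : measurable_fun E tau.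
Hypothesis tau0 : forall x, E x -> 0 <= tau x.

(** Both norms vanish exactly when the function is zero almost everywhere for the measure
    of density [tau]. *)
Lemma wnorm_eq0_exponent r s (f : T -> R) : 1 <= r -> 1 <= s -> measurable_fun E f ->
  wnorm mu tau s E f = 0%E -> wnorm mu tau r E f = 0%E.
Proof.
move=> r1 s1 mf f0.
have s0 : 0 < s by exact: lt_le_trans s1.
have r0 : 0 < r by exact: lt_le_trans r1.
have mg := measurable_weighted_power s mtau mf.
have := wnorm_powE mu s1 tau0 f; rewrite f0 poweR0r ?gt_eqF// => /esym I0.
have {}I0 : {ae mu, forall x, E x -> (`|f x| `^ s * tau x)%:E = 0%E}.
  apply/(ae_eq_integral_abs mu mE mg).
  rewrite -[RHS]I0; apply: eq_integral => x /set_mem Ex.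
  by rewrite gee0_abs// (weighted_power_ge0 s tau0).
rewrite /wnorm (ae_eq_integral (cst 0%E)) ?integral0 ?poweR0r ?invr_eq0 ?gt_eqF//.
  exact: measurable_weighted_power.
apply: filterS I0 => x h Ex; have /eqP := h Ex.
rewrite eqe mulf_eq0 => /orP[/eqP|/eqP->]; last by rewrite mulr0.
by move=> /powR_eq0_eq0 ->; rewrite powR0 ?gt_eqF// mul0r.
Qed.

End weighted_norm_null.

Section compactness.
Context {R : realType} {n : nat}.
Local Notation V := 'rV[R]_n.+1.
Local Notation lam := (@lebesgue R n).
Local Notation L := (caratheodory_type (@lebesgue_outer R n)).
Local Notation cube al := (cell al.2 0 al.1).

Variables (Om : set V) (p : R) (w tau : V -> R).
Hypotheses (oOm : open Om) (bOm : bounded_set Om) (p1 : 1 < p).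
Hypothesis adm : p_admissible p Om w tau.

Lemma locally_lipschitz_measurable_cube f al : locally_lipschitz Om f ->
  safe_cube Om al -> measurable_fun (cube al : set L) (f : L -> R).
Proof.
move=> fO sal; have [F [l [Fl Ff _]]] := safe_cube_lipschitz sal fO.
apply: (@eq_measurable_fun _ _ _ _ _ (F : L -> R)).
  by move=> x /set_mem xal; exact: Ff.
exact: lipschitz_measurable Fl.
Qed.

(** The bounds are asked on safe cubes, where the function may be taken Lipschitz, and for
    one partial derivative at a time with the weight [w], so that the matrix [Q] no longer
    appears. *)
Definition tame (B : R) (f : V -> R) := locally_lipschitz Om f /\
  forall al, safe_cube Om al -> (wnorm lam tau p (cube al) f <= B%:E)%E /\
    forall j, (wnorm lam w p (cube al) (partial f j) <= B%:E)%E.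

Lemma wnorm_weight_le (A : set V) (f : V -> R) : measurable (A : set L) -> A `<=` Om ->
  measurable_fun (A : set L) (f : L -> R) ->
  (wnorm lam w p A f <= wnorm lam tau p A f)%E.
Proof.
move=> mA AO mf.
have w0 x : A x -> 0 <= w x by move=> /AO /(admissible_w_ge0 adm).
have t0 x : A x -> 0 <= tau x by move=> /AO /(admissible_tau_ge0 adm).
have p0 : 0 <= p by rewrite (le_trans ler01)// ltW.
apply: le_poweR; first by rewrite invr_ge0.
  by apply: integral_ge0 => x Ax; rewrite lee_fin mulr_ge0 ?powR_ge0 ?w0.
apply: (le_integral_lower mA).
- apply: measurable_weighted_power => //.
  exact: (admissible_measurable_w oOm adm AO).
- by move=> x Ax; rewrite lee_fin mulr_ge0 ?powR_ge0 ?w0.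
- by move=> x Ax; rewrite lee_fin mulr_ge0 ?powR_ge0 ?t0.
have := admissible_le adm; apply: filterS; first exact: (ae_filter_ringOfSetsType lam).
move=> x wt Ax.
by rewrite lee_fin ler_wpM2l ?powR_ge0//; apply: wt (AO _ Ax).
Qed.

Section one_exponent.
Variables (Cb q r : R).
Hypotheses (Cb0 : 0 < Cb) (pr : p <= r) (rq : r < q).
Hypothesis bal : forall s r x, 0 < s -> s <= r -> Om x ->
  ((s / r)%:E * (wmeas tau (eball Om x s) / wmeas tau (eball Om x r)) `^ q^-1 <=
   Cb%:E * (wmeas w (eball Om x s) / wmeas w (eball Om x r)) `^ p^-1)%E.

Let r1 : 1 <= r. Proof. by rewrite (le_trans (ltW p1)). Qed.

Lemma tame_cube_close_subseq (F : nat -> V -> R) (B e : R) al : 0 < e -> 0 <= B ->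
  safe_cube Om al -> (forall i, tame B (F i)) ->
  exists2 phi, subseq_index phi & forall i j,
    (wnorm lam tau r (cube al) (F (phi i) \- F (phi j))%R <= e%:E)%E.
Proof.
move=> e0 B0 sal tF.
have mC := measurable_cell al.2 0 al.1.
have CO := safe_cube_sub sal.
have p0 : 0 < p by rewrite (lt_trans ltr01).
have w0 x : cube al x -> 0 <= w x by move=> /CO /(admissible_w_ge0 adm).
have [G hG] := choice (fun i => safe_cube_lipschitz sal (tF i).1).
have GF i x : cube al x -> G i x = F i x.
  by move=> xC; have [l [_ + _]] := hG i; exact.
have [|i|i|i|phi hphi close] := @cube_close_subseq R n Om p w tau oOm bOm p1 adm
    al.2 al.1 sal.1 CO Cb q r Cb0 pr rq bal G (n.+1%:R * B `^ p) B e e0.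
- by rewrite mulr_ge0 ?powR_ge0.
- by have [l [Gl _ _]] := hG i; exists l.
- rewrite /energy (_ : n.+1%:R * B `^ p = \sum_(j < n.+1) B `^ p); last first.
    by rewrite big_const_ord iter_addr_0 mulr_natl.
  rewrite -sumEFin; apply: lee_sum => j _.
  rewrite -(wnorm_le_pow lam (ltW p1) w0)//.
  have GFj x : cube al x -> partial (G i) j x = partial (F i) j x.
    by have [l [_ _ +]] := hG i; exact.
  rewrite (@eq_wnorm _ L R lam w p (cube al) (partial (G i) j) (partial (F i) j) GFj).
  by have [_ /(_ _ sal)[_]] := tF i; exact.
- have [fO /(_ _ sal)[FB _]] := tF i.
  apply: le_trans FB; rewrite (@eq_wnorm _ L R lam w p (cube al) (G i) (F i) (GF i)).
  apply: wnorm_weight_le => //.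
  exact: locally_lipschitz_measurable_cube.
exists phi; first exact: hphi.
move=> i j.
have FG x : cube al x -> (F (phi i) \- F (phi j)) x = (G (phi i) \- G (phi j)) x.
  by move=> xC; rewrite /= !GF.
rewrite (@eq_wnorm _ L R lam tau r (cube al) _ _ FG).
exact: close.
Qed.

End one_exponent.
End compactness.

Section compactness.
Context {R : realType} {n : nat}.
Local Notation V := 'rV[R]_n.+1.
Local Notation lam := (@lebesgue R n).
Local Notation L := (caratheodory_type (@lebesgue_outer R n)).
Local Notation cube al := (cell al.2 0 al.1).

Variables (Om : set V) (p : R) (w tau : V -> R).
Hypotheses (oOm : open Om) (bOm : bounded_set Om) (p1 : 1 < p).
Hypothesis adm : p_admissible p Om w tau.
Local Notation tame := (tame Om p w tau).

(** Finitely many safe cubes cover a compact set. *)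
Definition cubes (s : seq (V * R)) : set V := \big[setU/set0]_(al <- s) cube al.

Lemma in_cubes s al x : al \in s -> cube al x -> cubes s x.
Proof.
elim: s => // b s IH; rewrite inE /cubes big_cons => /orP[/eqP -> ?|ins xal]; first by left.
by right; exact: IH.
Qed.

Lemma measurable_cubes s : measurable (cubes s : set L).
Proof. by apply: bigsetU_measurable => al _; exact: measurable_cell. Qed.

Lemma cubes_sub s : {in s, forall al, safe_cube Om al} -> cubes s `<=` Om.
Proof.
elim: s => [_ x|al s IH ss]; first by rewrite /cubes big_nil.
rewrite /cubes big_cons => x [|]; first by apply: safe_cube_sub; apply: ss; rewrite mem_head.
by apply: IH => b bs; apply: ss; rewrite inE bs orbT.
Qed.

Lemma locally_lipschitz_measurable f s : locally_lipschitz Om f ->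
  {in s, forall al, safe_cube Om al} -> measurable_fun (cubes s : set L) (f : L -> R).
Proof.
move=> fO; elim: s => [_|al s IH ss]; first by rewrite /cubes big_nil; exact: measurable_fun_set0.
rewrite /cubes big_cons.
have := @measurable_funU _ _ L R (cube al) (cubes s) f
  (measurable_cell al.2 0 al.1) (measurable_cubes s).
move=> ->; split.
  by apply: (locally_lipschitz_measurable_cube fO); apply: ss; rewrite mem_head.
by apply: IH => b bs; apply: ss; rewrite inE bs orbT.
Qed.

Section one_exponent.
Variables (Cb q r : R).
Hypotheses (Cb0 : 0 < Cb) (pr : p <= r) (rq : r < q).
Hypothesis bal : forall s r x, 0 < s -> s <= r -> Om x ->
  ((s / r)%:E * (wmeas tau (eball Om x s) / wmeas tau (eball Om x r)) `^ q^-1 <=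
   Cb%:E * (wmeas w (eball Om x s) / wmeas w (eball Om x r)) `^ p^-1)%E.

Let r1 : 1 <= r. Proof. by rewrite (le_trans (ltW p1)). Qed.

Variables (E : set V) (s : seq (V * R)).
Hypothesis ss : {in s, forall al, safe_cube Om al}.
Hypothesis mE : measurable (E : set L).
Hypothesis Es : E `<=` cubes s.

Let EO : E `<=` Om. Proof. by apply: subset_trans Es _; exact: cubes_sub. Qed.

Let mtE : measurable_fun (E : set L) (tau : L -> R).
Proof. exact: (admissible_measurable_tau oOm adm EO). Qed.

Let tE x : E x -> 0 <= tau x.
Proof. by move=> /EO; exact: (admissible_tau_ge0 adm). Qed.

Let mtame B f : tame B f -> measurable_fun (E : set L) (f : L -> R).
Proof.
move=> [fO _]; apply: (@measurable_funS _ _ L R (cubes s) E f (measurable_cubes s) Es).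
exact: locally_lipschitz_measurable.
Qed.

(** Subsequences are extracted one cube after the other. *)
Lemma tame_close_subseq (F : nat -> V -> R) (B e : R) : 0 < e -> 0 <= B ->
  (forall i, tame B (F i)) ->
  exists2 phi, subseq_index phi & forall i j,
    (wnorm lam tau r E (F (phi i) \- F (phi j))%R <= e%:E)%E.
Proof.
move=> e0 B0 tF.
suff /(_ s ss e e0)[phi hphi close] : forall t, {in t, forall al, safe_cube Om al} ->
    forall e, 0 < e -> exists2 phi, subseq_index phi & forall i j,
    (wnorm lam tau r (cubes t) (F (phi i) \- F (phi j))%R <= e%:E)%E.
  exists phi; first exact: hphi.
  move=> i j; apply: le_trans (close i j).
  have CO := cubes_sub ss.
  apply: (wnorm_subset lam r1 mE (measurable_cubes s)
    (admissible_measurable_tau oOm adm CO)) => //.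
    by move=> x /CO; exact: (admissible_tau_ge0 adm).
  by apply: measurable_funB; apply: locally_lipschitz_measurable => //; exact: (tF _).1.
elim=> {e e0} [_ e e0|al s' IH ss' e e0].
  exists id; first exact: subseq_index_id.
  move=> i j; rewrite /wnorm /cubes big_nil integral_set0 poweR0r ?lee_fin ?ltW//.
  by rewrite invr_eq0 gt_eqF// (lt_le_trans ltr01).
have e2 : 0 < e / 2 by rewrite divr_gt0.
have {}ss' : safe_cube Om al /\ {in s', forall al, safe_cube Om al}.
  by split=> [|b bs]; apply: ss'; rewrite inE ?eqxx ?bs ?orbT.
have [phi hphi close] := IH ss'.2 _ e2.
have [psi hpsi closea] := @tame_cube_close_subseq R n Om p w tau oOm bOm p1 adm
  Cb q r Cb0 pr rq bal (F \o phi) B _ al e2 B0 ss'.1 (fun i => tF (phi i)).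
exists (phi \o psi); first exact: subseq_index_comp.
have sal : {in al :: s', forall al, safe_cube Om al}.
  by move=> b; rewrite inE => /orP[/eqP ->|]; [exact: ss'.1|exact: ss'.2].
have CO := cubes_sub sal; have mf i := locally_lipschitz_measurable (tF i).1 sal.
move: CO mf; rewrite /cubes big_cons -/(cubes s') => CO mf i j.
have := @wnorm_setU _ L R lam tau r (cube al) (cubes s')
  (F (phi (psi i)) \- F (phi (psi j)))%R r1 (measurable_cell al.2 0 al.1)
  (measurable_cubes s') (admissible_measurable_tau oOm adm CO)
  (fun x xC => admissible_tau_ge0 adm (CO x xC)) (measurable_funB (mf _) (mf _)).
move=> h; apply: (le_trans h); rewrite [e in leRHS]splitr EFinD; apply: leeD.
  exact: closea.
exact: close.
Qed.

(** A diagonal argument turns arbitrarily close subsequences into a convergent one. *)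
Lemma tame_limit (F : nat -> V -> R) (B : R) : 0 <= B -> (forall i, tame B (F i)) ->
  exists2 phi, subseq_index phi & exists y : V -> R,
  [/\ measurable_fun (E : set L) (y : L -> R),
    {ae lam, forall x, E x -> tau x != 0 -> F (phi k) x @[k --> \oo] --> y x} &
    forall k, (wnorm lam tau r E (y \- F (phi k))%R <= (2 * 2^-1 ^+ k)%:E)%E].
Proof.
move=> B0 tF.
have [m chi hchi|phi hphi close] := @diagonal_subseq (fun m i j =>
    (wnorm lam tau r E (F i \- F j)%R <= (2^-1 ^+ m)%:E)%E).
  have m0 : 0 < 2^-1 ^+ m :> R by rewrite exprn_gt0.
  exact: (@tame_close_subseq (F \o chi) B (2^-1 ^+ m) m0 B0 (fun i => tF (chi i))).
exists phi; first exact: hphi.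
have [||y [my yF yd]] := @wnorm_geometric_limit _ L R lam tau r E (fun k => F (phi k)) r1 mE mtE tE.
- by move=> k; exact: mtame (tF _).
- by move=> k; apply: close.
by exists y.
Qed.

End one_exponent.
End compactness.

(** * Compactness for limits of locally Lipschitz functions *)

Lemma half_pow_small (R : realType) (e : R) : 0 < e -> exists k, 2^-1 ^+ k <= e.
Proof.
move=> e0; have : (2^-1 : R) ^+ k @[k --> \oo] --> 0.
  by apply: cvg_expr; rewrite ger0_norm// invf_lt1// ltr1n.
move=> /cvgrPdist_le/(_ _ e0)[k _ hk]; exists k.
have := hk k (leqnn k); rewrite /= sub0r normrN; apply: le_trans; exact: ler_norm.
Qed.

Section approximation.
Context {R : realType} {n : nat}.
Local Notation V := 'rV[R]_n.+1.
Local Notation lam := (@lebesgue R n).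
Local Notation L := (caratheodory_type (@lebesgue_outer R n)).

Variables (Om : set V) (p : R) (w tau : V -> R).
Hypotheses (oOm : open Om) (bOm : bounded_set Om) (p1 : 1 < p).
Hypothesis adm : p_admissible p Om w tau.
Local Notation tame := (tame Om p w tau).

(** Elements of the completion enter only through their first components; their gradients
    survive as the uniform bounds on the approximants. *)
Definition approximable (B : R) (u : V -> R) := measurable_fun (Om : set L) (u : L -> R) /\
  forall e : R, 0 < e -> exists2 f, tame B f & (wnorm lam tau p Om (u \- f)%R <= e%:E)%E.

Lemma tame_bounded B f s : tame B f -> {in s, forall al, safe_cube Om al} ->
  exists D : R, forall x, cubes s x -> `|f x| <= D.
Proof.
move=> [fO _]; elim: s => [_|al s IH ss]; first by exists 0 => x; rewrite /cubes big_nil.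
have [|D hD] := IH; first by move=> b bs; apply: ss; rewrite inE bs orbT.
have sal : safe_cube Om al by apply: ss; rewrite mem_head.
have [F [l [Fl Ff _]]] := safe_cube_lipschitz sal fO.
exists (Num.max D (`|F al.1| + `|l| * al.2)) => x; rewrite /cubes big_cons le_max => -[xal|/hD->//].
apply/orP; right; rewrite -Ff// -(subrKC (F al.1) (F x)).
rewrite (le_trans (ler_normD _ _))// lerD2l (le_trans (Fl _ _))//.
apply: (@le_trans _ _ (`|l| * `|x - al.1|)); first by rewrite ler_wpM2r// ler_norm.
rewrite ler_wpM2l// rV_norm_le ?(ltW sal.1)//; apply/forallP => i; have := xal i.
by rewrite !mxE ler_norml => /andP[? ?]; have := sal.1; move=> ?; apply/andP; split; lra.
Qed.

Section one_exponent.
Variables (Cb q r : R).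
Hypotheses (Cb0 : 0 < Cb) (pr : p <= r) (rq : r < q).
Hypothesis bal : forall s r x, 0 < s -> s <= r -> Om x ->
  ((s / r)%:E * (wmeas tau (eball Om x s) / wmeas tau (eball Om x r)) `^ q^-1 <=
   Cb%:E * (wmeas w (eball Om x s) / wmeas w (eball Om x r)) `^ p^-1)%E.

Let r1 : 1 <= r. Proof. by rewrite (le_trans (ltW p1)). Qed.

Variables (E : set V) (s : seq (V * R)).
Hypothesis ss : {in s, forall al, safe_cube Om al}.
Hypothesis mE : measurable (E : set L).
Hypothesis Es : E `<=` cubes s.

Let EO : E `<=` Om. Proof. by apply: subset_trans Es _; exact: cubes_sub. Qed.

Let mtE : measurable_fun (E : set L) (tau : L -> R).
Proof. exact: (admissible_measurable_tau oOm adm EO). Qed.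

Let tE x : E x -> 0 <= tau x.
Proof. by move=> /EO; exact: (admissible_tau_ge0 adm). Qed.

Let mtame B f : tame B f -> measurable_fun (E : set L) (f : L -> R).
Proof.
move=> [fO _]; apply: (@measurable_funS _ _ L R (cubes s) E f (measurable_cubes s) Es).
exact: (locally_lipschitz_measurable fO ss).
Qed.

Let mapprox B u : approximable B u -> measurable_fun (E : set L) (u : L -> R).
Proof.
move=> [mu _]; exact: (@measurable_funS _ _ L R Om E u (measurable_open oOm) EO).
Qed.

Lemma tame_fin B f : tame B f -> (wnorm lam tau r E f < +oo)%E.
Proof.
move=> tf; have [D hD] := tame_bounded tf ss.
apply: (@le_lt_trans _ _ (wnorm lam tau r E (cst `|D|))).
  apply: (@wnorm_le _ L R lam tau r E r1 mE mtE tE); first exact: mtame tf.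
    exact: measurable_cst.
  by move=> x /Es /hD /le_trans; apply; rewrite /= normr_id ler_norm.
rewrite /wnorm; apply: poweR_lty.
have tfin := tau_fin oOm bOm adm mE EO.
rewrite (eq_integral (fun x : L => ((`|D| `^ r)%:E * (tau x)%:E)%E)); last first.
  by move=> x _; rewrite /= normr_id EFinM.
have mtE' : measurable_fun (E : set L) (fun x : L => (tau x)%:E) by exact/measurable_EFinP.
have tE' x : E x -> (0 <= (tau x)%:E)%E by move=> xE; rewrite lee_fin tE.
rewrite (@ge0_integralZl_EFin _ L R lam E mE (fun x => (tau x)%:E) tE' mtE' (`|D| `^ r)
  (powR_ge0 _ _)).
by rewrite -/(wmeas tau E) -(fineK tfin) -EFinM ltry.
Qed.

(** Norm approximation in the exponent [p] passes to the exponent [r]: along a subsequence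
    the approximants converge in both norms, and the limits agree. *)
Lemma approximable_exponent B u (e : R) : 0 <= B -> 0 < e -> approximable B u ->
  exists2 f, tame B f & (wnorm lam tau r E (u \- f)%R <= e%:E)%E.
Proof.
move=> B0 e0 au; have mu := mapprox au.
have ap (m : nat) : exists f, tame B f /\ (wnorm lam tau p Om (u \- f)%R <= (2^-1 ^+ m)%:E)%E.
  have [|f tf uf] := au.2 (2^-1 ^+ m); first by rewrite exprn_gt0.
  by exists f.
have [f hf] := choice ap.
have [phi hphi [y [my yf yd]]] := tame_limit oOm bOm p1 adm Cb0 pr rq bal ss mE Es B0
  (fun i => (hf i).1).
have mf k : measurable_fun (E : set L) (f k : L -> R) := mtame (hf k).1.
(* the limits in the two norms agree, by Fatou's lemma in the exponent [p] *)
have yu0 : wnorm lam tau p E (y \- u)%R = 0%E.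
  apply/eqP; rewrite eq_le wnorm_ge0 andbT.
  apply/lee_addgt0Pr => d d0; rewrite add0e.
  have [K hK] := half_pow_small d0.
  apply: (@wnorm_fatou _ L R lam tau p E (ltW p1) mE mtE tE
    (fun k => f (phi (k + K)%N) \- u)%R (y \- u)%R d (ltW d0)).
  - by move=> k; exact: measurable_funB.
  - exact: measurable_funB.
  - move: yf; apply: filterS; first exact: (ae_filter_ringOfSetsType lam).
    move=> x yf Ex tx; apply: cvgB; last exact: cvg_cst.
    by have := yf Ex tx; rewrite -(cvg_shiftn K).
  move=> k; rewrite wnorm_distC.
  apply: (@le_trans _ _ (wnorm lam tau p Om (u \- f (phi (k + K)%N))%R)).
    apply: le_poweR; first by rewrite invr_ge0 (le_trans ler01)// ltW.
      by apply: integral_ge0 => x /tE t0; rewrite lee_fin mulr_ge0 ?powR_ge0.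
    apply: (@le_integral_subset_lower _ L R lam E Om _ EO) => x Ox.
    by rewrite lee_fin mulr_ge0 ?powR_ge0// (admissible_tau_ge0 adm).
  apply: le_trans (hf _).2 _; rewrite lee_fin (le_trans _ hK)//.
  apply: ler_wiXn2l; rewrite ?invr_ge0// ?invf_le1// ?ler1n//.
  by rewrite (leq_trans (leq_addl k K))// subseq_index_ge.
have uy : wnorm lam tau r E (u \- y)%R = 0%E.
  rewrite wnorm_distC; apply: (@wnorm_eq0_exponent _ L R lam tau E mE mtE tE r p) => //.
    exact: ltW.
  exact: measurable_funB.
have e2 : 0 < e / 2 by rewrite divr_gt0.
have [k hk] := half_pow_small e2; exists (f (phi k)); first exact: (hf _).1.
apply: le_trans (@wnorm_dist _ L R lam tau r E r1 mE mtE tE u y (f (phi k)) mu my (mf _)) _.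
rewrite uy add0e; apply: le_trans (yd k) _.
by rewrite lee_fin mulrC -ler_pdivlMr.
Qed.

Lemma approximable_fin B u : 0 <= B -> approximable B u -> (wnorm lam tau r E u < +oo)%E.
Proof.
move=> B0 au; have [f tf uf] := approximable_exponent B0 ltr01 au.
have mf := mtame tf; have mu := mapprox au.
rewrite (@eq_wnorm _ L R lam tau r E u ((u \- f) \+ f)%R); last by move=> x _; rewrite /= subrK.
apply: le_lt_trans (@wnormD _ L R lam tau r E r1 mE mtE tE _ _ _ mf) _.
  exact: measurable_funB.
by apply: lte_add_pinfty; [exact: le_lt_trans uf (ltry _)|exact: tame_fin tf].
Qed.

(** Each [u i] is replaced by a tame function at distance [2^-1 ^+ i], to which the limit
    along a subsequence applies. *)
Lemma approximable_compact (u : nat -> V -> R) B : 0 <= B -> (forall i, approximable B (u i)) ->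
  exists2 phi, subseq_index phi & exists y : V -> R,
  [/\ measurable_fun (E : set L) (y : L -> R), (wnorm lam tau r E y < +oo)%E &
    forall k, (wnorm lam tau r E (u (phi k) \- y)%R <= (3 * 2^-1 ^+ k)%:E)%E].
Proof.
move=> B0 au.
have ap (i : nat) : exists f, tame B f /\ (wnorm lam tau r E (u i \- f)%R <= (2^-1 ^+ i)%:E)%E.
  have [|f tf uf] := approximable_exponent (e := 2^-1 ^+ i) B0 _ (au i).
    by rewrite exprn_gt0.
  by exists f.
have [f hf] := choice ap.
have [phi hphi [y [my yf yd]]] := tame_limit oOm bOm p1 adm Cb0 pr rq bal ss mE Es B0
  (fun i => (hf i).1).
have mf k : measurable_fun (E : set L) (f k : L -> R) := mtame (hf k).1.
have mu k : measurable_fun (E : set L) (u k : L -> R) := mapprox (au k).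
exists phi; first exact: hphi.
exists y; split => [//||k].
  rewrite (@eq_wnorm _ L R lam tau r E y ((y \- f (phi 0%N)) \+ f (phi 0%N))%R); last first.
    by move=> x _; rewrite /= subrK.
  apply: le_lt_trans (@wnormD _ L R lam tau r E r1 mE mtE tE _ _ _ (mf _)) _.
    exact: measurable_funB.
  apply: lte_add_pinfty; first exact: le_lt_trans (yd 0%N) (ltry _).
  exact: tame_fin (hf _).1.
apply: le_trans (@wnorm_dist _ L R lam tau r E r1 mE mtE tE _ (f (phi k)) _ (mu _) (mf _) my) _.
rewrite (_ : 3 * _ = 2^-1 ^+ k + 2 * 2^-1 ^+ k); last by rewrite -[X in X + _]mul1r -mulrDl.
rewrite EFinD; apply: leeD; last by rewrite wnorm_distC; exact: yd.
apply: le_trans (hf _).2 _; rewrite lee_fin.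
by apply: ler_wiXn2l; rewrite ?invr_ge0 ?invf_le1 ?ler1n// subseq_index_ge.
Qed.

End one_exponent.
End approximation.

(** * From Sobolev norms to bounds on cubes *)

Section embedding.
Context {R : realType} {n : nat}.
Local Notation V := 'rV[R]_n.+1.
Local Notation lam := (@lebesgue R n).
Local Notation L := (caratheodory_type (@lebesgue_outer R n)).

Variables (Om : set V) (p : R) (w tau : V -> R) (Q : V -> 'M[R]_n.+1).
Hypotheses (oOm : open Om) (bOm : bounded_set Om) (p1 : 1 < p).
Hypothesis adm : p_admissible p Om w tau.

Section compactness.
Variables (Cb q : R).
Hypotheses (Cb0 : 0 < Cb) (pq : p < q).
Hypothesis bal : forall s r x, 0 < s -> s <= r -> Om x ->
  ((s / r)%:E * (wmeas tau (eball Om x s) / wmeas tau (eball Om x r)) `^ q^-1 <=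
   Cb%:E * (wmeas w (eball Om x s) / wmeas w (eball Om x r)) `^ p^-1)%E.
Variables (E : set V) (r : R).
Hypotheses (mE : measurable (E : set L)) (cE : compactly_inside E Om).
Hypotheses (r1 : 1 <= r) (rq : r < q).

Let EO : E `<=` Om. Proof. exact: subset_trans (@subset_closure _ E) cE.2. Qed.

Let mtE : measurable_fun (E : set L) (tau : L -> R).
Proof. exact: (admissible_measurable_tau oOm adm EO). Qed.

Let tE x : E x -> 0 <= tau x.
Proof. by move=> /EO; exact: (admissible_tau_ge0 adm). Qed.

Let s := Num.max r p.
Let ps : p <= s. Proof. by rewrite le_max lexx orbT. Qed.
Let rs : r <= s. Proof. by rewrite le_max lexx. Qed.
Let sq : s < q. Proof. by rewrite gt_max rq. Qed.
Let t := fine (wmeas tau E).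

Let lower_exponent (f : V -> R) (c : R) : 0 < c -> measurable_fun (E : set L) (f : L -> R) ->
  (wnorm lam tau s E f <= c%:E)%E -> (wnorm lam tau r E f <= (c * (t + 1) `^ r^-1)%:E)%E.
Proof.
move=> c0 mf; apply: (@wnorm_exponent _ L R lam tau r s E f c t r1 rs c0 mE mtE tE mf).
  by rewrite fineK// (tau_fin oOm bOm adm mE EO).
by rewrite fine_ge0// wmeas_ge0.
Qed.

Let lower_exponent_fin (f : V -> R) : measurable_fun (E : set L) (f : L -> R) ->
  (wnorm lam tau s E f < +oo)%E -> Lspace_weight tau r E f.
Proof.
move=> mf ffin; split; first exact: mf.
have f0 := @wnorm_ge0 _ L R lam tau s E f.
have fE : wnorm lam tau s E f \is a fin_num by rewrite ge0_fin_numE.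
apply: le_lt_trans (ltry _).
apply: (lower_exponent (c := fine (wnorm lam tau s E f) + 1)) => //.
  by rewrite ltr_wpDl// fine_ge0.
by rewrite -[leLHS](fineK fE) lee_fin lerDl.
Qed.

Lemma approximable_Lspace B u : 0 <= B -> approximable Om p w tau B u ->
  Lspace_weight tau r E u.
Proof.
move=> B0 au; have [sc [ss scov]] := safe_cube_cover oOm cE.1 cE.2.
have Es : E `<=` cubes sc.
  by move=> x /(@subset_closure _ E)/scov[al als xal]; exact: in_cubes als xal.
apply: lower_exponent_fin.
  exact: (@measurable_funS _ _ L R Om E u (measurable_open oOm) EO au.1).
exact: (approximable_fin oOm bOm p1 adm Cb0 ps sq bal ss mE Es B0 au).
Qed.

(** For an exponent [r] below [p] the convergence is first obtained for [p] and then
    lowered, [tau] having finite total mass. *)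
Lemma approximable_embedding B (u : nat -> V -> R) : 0 <= B ->
  (forall i, approximable Om p w tau B (u i)) ->
  exists2 phi : nat -> nat, {homo phi : i j / (i < j)%N} &
  exists2 y, Lspace_weight tau r E y &
    (fun j => Lnorm_weight tau r E (u (phi j) - y)) @ \oo --> 0%E.
Proof.
move=> B0 au; have [sc [ss scov]] := safe_cube_cover oOm cE.1 cE.2.
have Es : E `<=` cubes sc.
  by move=> x /(@subset_closure _ E)/scov[al als xal]; exact: in_cubes als xal.
have [phi hphi [y [my yfin yd]]] :=
  approximable_compact oOm bOm p1 adm Cb0 ps sq bal ss mE Es B0 au.
exists phi; first exact: hphi.
exists y; first exact: lower_exponent_fin.
have t0 : 0 <= t by rewrite fine_ge0// wmeas_ge0.
apply: (@squeeze_cvge _ _ _ _ (cst 0%E) _ (fun k => (3 * 2^-1 ^+ k * (t + 1) `^ r^-1)%:E)).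
- apply: nearW => k; rewrite [X in (X <= _)%E]/= wnorm_ge0 /=.
  apply: lower_exponent; first by rewrite mulr_gt0 ?exprn_gt0.
    apply: measurable_funB; last exact: my.
    exact: (@measurable_funS _ _ L R Om E _ (measurable_open oOm) EO (au _).1).
  exact: yd.
- exact: cvg_cst.
apply: cvg_EFin; first exact: nearW.
rewrite [X in _ --> X](_ : _ = 3 * 0 * (t + 1) `^ r^-1); last by rewrite mulr0 mul0r.
apply: cvgM; last exact: cvg_cst.
apply: cvgM; first exact: cvg_cst.
by apply: cvg_expr; rewrite ger0_norm// invf_lt1// ltr1n.
Qed.

End compactness.

Hypothesis sQ : structure_condition p Om w tau Q.

(** The lower bound on [Q]: the [w]-weighted power of a component is at most the density of
    the norm of the field. *)
Lemma component_le_field (A : set V) (g : V -> V) j : measurable (A : set L) -> A `<=` Om ->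
  measurable_fun (A : set L) (fun x : L => g x ord0 j) ->
  (wnorm lam w p A (fun x => g x ord0 j) <= Lnorm_field Q p Om g)%E.
Proof.
move=> mA AO mg.
have p0 : 0 <= p by rewrite (le_trans ler01)// ltW.
have w0 x : A x -> 0 <= w x by move=> /AO; exact: (admissible_w_ge0 adm).
apply: le_poweR; first by rewrite invr_ge0.
  by apply: integral_ge0 => x Ax; rewrite lee_fin mulr_ge0 ?powR_ge0 ?w0.
apply: (@le_trans _ _ (\int[lam]_(x in A) (Qnorm Q x (g x) `^ p)%:E)%E).
  apply: (@le_integral_lower _ L R lam A _ _ mA).
  - apply: (@measurable_weighted_power _ L R w p A) => //.
    exact: (admissible_measurable_w oOm adm AO).
  - by move=> x Ax; rewrite lee_fin mulr_ge0 ?powR_ge0 ?w0.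
  - by move=> x _; rewrite lee_fin powR_ge0.
  move: sQ; apply: filterS; first exact: (ae_filter_ringOfSetsType lam).
  move=> x h Ax; have /andP[+ _] := h (AO _ Ax) (g x).
  rewrite lee_fin; apply: le_trans; rewrite mulrC ler_wpM2l ?w0//.
  by apply: ge0_ler_powR; rewrite ?nnegrE ?enorm_ge0 ?enorm_coord_le.
apply: (@le_integral_subset_lower _ L R lam A Om _ AO) => x _.
by rewrite lee_fin powR_ge0.
Qed.

Lemma measurable_partial_cube f j al : locally_lipschitz Om f -> safe_cube Om al ->
  measurable_fun (cell al.2 0 al.1 : set L) (partial f j : L -> R).
Proof.
move=> fO sal; have [F [l [Fl _ Ff]]] := safe_cube_lipschitz sal fO.
apply: (@eq_measurable_fun _ _ _ _ _ (partial F j : L -> R)).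
  by move=> x /set_mem xal; exact: Ff.
by apply: measurable_funTS; exact: measurable_partial Fl.
Qed.

(** An approximant at distance at most 1 inherits the bound on [(u, k)], increased by 1. *)
Lemma sobolev_approximable (u : V -> R) (k : V -> V) (M : R) :
  measurable_fun (Om : set L) (u : L -> R) -> measurable_field Om k ->
  (QHnorm p tau Q Om (u, k) <= M%:E)%E ->
  (forall e : R, 0 < e -> exists2 f, locally_lipschitz Om f &
     (QHnorm p tau Q Om (u \- f, k \- grad f)%R < e%:E)%E) ->
  approximable Om p w tau (M + 1) u.
Proof.
have N0 f : (0 <= Lnorm_weight tau p Om f)%E by exact: poweR_ge0.
have F0 g : (0 <= Lnorm_field Q p Om g)%E by exact: poweR_ge0.
have part1 f g (e : R) : (QHnorm p tau Q Om (f, g) <= e%:E -> Lnorm_weight tau p Om f <= e%:E)%E.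
  by apply: le_trans; rewrite /QHnorm leeDl.
have part2 f g (e : R) : (QHnorm p tau Q Om (f, g) <= e%:E -> Lnorm_field Q p Om g <= e%:E)%E.
  by apply: le_trans; rewrite /QHnorm leeDr.
move=> mu mk uM ap; split; first exact: mu.
move=> e e0; have e1 : 0 < Num.min e 1 by rewrite lt_min e0 ltr01.
have [f fO /ltW uf] := ap _ e1; exists f; last first.
  by apply: le_trans (part1 _ _ _ uf) _; rewrite lee_fin ge_min lexx.
have {}uf : (QHnorm p tau Q Om (u \- f, k \- grad f)%R <= 1%:E)%E.
  by apply: le_trans uf _; rewrite lee_fin ge_min lexx orbT.
split; first exact: fO.
move=> al sal.
have CO := safe_cube_sub sal; have mC := measurable_cell al.2 0 al.1.
have sub g : measurable_fun (Om : set L) (g : L -> R) ->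
    measurable_fun (cell al.2 0 al.1 : set L) (g : L -> R).
  exact: (@measurable_funS _ _ L R Om _ g (measurable_open oOm) CO).
have mtC := admissible_measurable_tau oOm adm CO.
have mwC := admissible_measurable_w oOm adm CO.
have t0 x : cell al.2 0 al.1 x -> 0 <= tau x by move=> /CO; exact: (admissible_tau_ge0 adm).
have w0 x : cell al.2 0 al.1 x -> 0 <= w x by move=> /CO; exact: (admissible_w_ge0 adm).
have Csub f0 : (wnorm lam tau p (cell al.2 0 al.1) f0 <= Lnorm_weight tau p Om f0)%E.
  apply: le_poweR; first by rewrite invr_ge0 (le_trans ler01)// ltW.
    by apply: integral_ge0 => x /t0 ?; rewrite lee_fin mulr_ge0 ?powR_ge0.
  apply: (@le_integral_subset_lower _ L R lam _ Om _ CO) => x Ox.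
  by rewrite lee_fin mulr_ge0 ?powR_ge0// (admissible_tau_ge0 adm).
have mf := locally_lipschitz_measurable_cube fO sal.
split=> [|j].
  rewrite (@eq_wnorm _ L R lam tau p _ f (u \- (u \- f))%R); last first.
    by move=> x _; rewrite /= opprB subrKC.
  have := @wnormB _ L R lam tau p _ (ltW p1) mC mtC t0 u (u \- f)%R (sub _ mu)
    (measurable_funB (sub _ mu) mf).
  move=> h; apply: (le_trans h); rewrite EFinD; apply: leeD.
    exact: le_trans (Csub _) (part1 _ _ _ uM).
  exact: le_trans (Csub _) (part1 _ _ _ uf).
have mfj := measurable_partial_cube j fO sal.
pose kj x := k x ord0 j; pose gj x := (k \- grad f)%R x ord0 j.
have mkj : measurable_fun (cell al.2 0 al.1 : set L) (kj : L -> R) by apply: sub; exact: mk.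
have gjE x : gj x = kj x - partial f j x by rewrite /gj !mxE -gradE mxE.
have mgj : measurable_fun (cell al.2 0 al.1 : set L) (gj : L -> R).
  by rewrite (_ : gj = kj \- partial f j)%R; [exact: measurable_funB|apply/funext].
rewrite (@eq_wnorm _ L R lam w p _ (partial f j) (kj \- gj)%R); last first.
  by move=> x _; rewrite /= gjE opprB subrKC.
have h := @wnormB _ L R lam w p _ (ltW p1) mC mwC w0 kj gj mkj mgj.
apply: (le_trans h); rewrite EFinD; apply: leeD.
  exact: le_trans (component_le_field mC CO mkj) (part2 _ _ _ uM).
exact: le_trans (component_le_field mC CO mgj) (part2 _ _ _ uf).
Qed.

End embedding.

(** * Extension by zero *)

Section zero_extension.
Context {R : realType} {n : nat}.
Local Notation V := 'rV[R]_n.+1.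
Local Notation lam := (@lebesgue R n).
Local Notation L := (caratheodory_type (@lebesgue_outer R n)).

Variables (Om E : set V).
Hypotheses (oE : open E) (EO : E `<=` Om).

(** The closure of the support lies in [E], so that [x] is at a distance from it. *)
Lemma zero_extension_near (f : V -> R) x :
  compactly_inside [set x | E x /\ f x != 0] E -> ~ E x ->
  \forall y \near x, (f \_ E) y = 0.
Proof.
move=> [_ SE] nEx; set S := [set x | _] in SE.
have : nbhs x (~` closure S).
  apply: open_nbhs_nbhs; split; last by move=> /SE.
  by apply: closed_openC; exact: closed_closure.
apply: filterS => y nSy; rewrite patchE; case: ifPn => // /set_mem Ey.
by apply/eqP/negPn/negP => fy; apply: nSy; apply: subset_closure.
Qed.

Lemma zero_extension_locally_lipschitz (f : V -> R) : Lip0 E f ->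
  locally_lipschitz Om (f \_ E).
Proof.
move=> [fE sf] x Ox; have [Ex|nEx] := pselect (E x); last first.
  exists [set y | (f \_ E) y = 0]; first exact: zero_extension_near.
  exists 0; split; first exact: num_real.
  move=> M M0 [y z] /= [[_ ->] [_ ->]]; rewrite subrr normr0 mulr_ge0//.
  exact: ltW.
have [U Ux [M [Mr hM]]] := fE x Ex.
exists (E `&` U); first by apply: filterI => //; exact: open_nbhs_nbhs.
exists M; split => // M' MM' [y z] /= [[_ [Ey Uy]] [_ [Ez Uz]]].
by rewrite !patchE !mem_set//; exact: (hM _ MM' (y, z)).
Qed.

Lemma zero_extension_grad (f : V -> R) : Lip0 E f -> grad (f \_ E) = (grad f) \_ E.
Proof.
move=> [fE sf]; apply/funext => x; apply/rowP => i; rewrite gradE patchE.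
have [Ex|nEx] := pselect (E x).
  rewrite mem_set// gradE /partial; apply: near_eq_derive.
  have : nbhs x E by exact: open_nbhs_nbhs.
  by apply: filterS => y Ey; rewrite patchE mem_set.
rewrite memNset// [RHS]mxE /partial.
transitivity ('D_(basis_vec i) (cst 0 : V -> R) x); last exact: derive_cst.
by apply: near_eq_derive; exact: zero_extension_near.
Qed.

Lemma zero_extension_QHnorm p tau Q (u : V -> R) (k : V -> V) : 1 < p ->
  QHnorm p tau Q Om (u \_ E, k \_ E) = QHnorm p tau Q E (u, k).
Proof.
move=> p1; have p0 : 0 < p by exact: lt_trans p1.
have hu : Lnorm_weight tau p Om (u \_ E) = Lnorm_weight tau p E u.
  exact: (@wnorm_patch _ L R lam tau p E Om u p0 EO).
have hk : (\int[lam]_(x in Om) (Qnorm Q x ((k \_ E) x) `^ p)%:E =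
           \int[lam]_(x in E) (Qnorm Q x (k x) `^ p)%:E)%E.
  rewrite [LHS]integral_mkcond [RHS]integral_mkcond; apply: eq_integral => x _.
  rewrite !patchE; have [Ex|nEx] := pselect (E x).
    by rewrite (mem_set Ex) (mem_set (EO Ex)).
  rewrite (memNset nEx); case: (x \in Om); last by [].
  have -> : point = 0 :> V by apply/rowP => i; rewrite !mxE.
  rewrite /Qnorm mul0mx /enorm big1; last by move=> i _; rewrite mxE expr0n.
  by rewrite sqrtr0 powR0// gt_eqF.
by rewrite /QHnorm hu /Lnorm_field hk.
Qed.

(** Extension by zero preserves all the norms and turns a Sobolev function on [E] into
    one on [Om]. *)
Lemma zero_extension_approximable p w tau Q (uk : (V -> R) * (V -> V)) (M : R) :
  open Om -> 1 < p -> p_admissible p Om w tau ->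
  structure_condition p Om w tau Q -> QH0 p tau Q E uk ->
  (QHnorm p tau Q E uk <= M%:E)%E ->
  approximable Om p w tau (M + 1) (uk.1 \_ E).
Proof.
case: uk => u k oOm p1 adm sQ [[mu _] [mk _] ap] uM.
have mO := measurable_open oOm; have mE := measurable_open oE.
have OE : Om `&` E = E by rewrite setIC; exact: setIidl.
have patch_measurable (f : V -> R) : measurable_fun (E : set L) (f : L -> R) ->
    measurable_fun (Om : set L) (f \_ E : L -> R).
  move=> mf; apply/(@measurable_restrict _ _ L R E Om f mE mO).
  by rewrite OE.
apply: (sobolev_approximable oOm p1 adm sQ (k := k \_ E)).
- exact: patch_measurable.
- move=> i; have := patch_measurable (fun x => k x ord0 i) (mk i).
  rewrite (_ : (fun x => _) \_ E = fun x => (k \_ E) x ord0 i)//.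
  apply/funext => x; rewrite !patchE; case: ifP => // _.
  by rewrite mxE.
- by rewrite zero_extension_QHnorm.
move=> e e0; have [f fL uf] := ap e e0.
exists (f \_ E); first exact: zero_extension_locally_lipschitz.
have hu : (u \_ E \- f \_ E)%R = (u \- f)%R \_ E.
  by apply/funext => x; rewrite /= !patchE; case: (x \in E); [|exact: subrr].
have hk : (k \_ E \- (grad f) \_ E)%R = (k \- grad f)%R \_ E.
  apply/funext => x; rewrite /= !patchE; case: (x \in E); first by [].
  by apply/rowP => i; rewrite !mxE; exact: subrr.
by rewrite (zero_extension_grad fL) hu hk (zero_extension_QHnorm _ _ _ _ p1).
Qed.

End zero_extension.

(** * The embeddings *)

Section embedding_theorem.
Context {R : realType} {n : nat}.
Local Notation V := 'rV[R]_n.+1.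
Local Notation lam := (@lebesgue R n).
Local Notation L := (caratheodory_type (@lebesgue_outer R n)).

Lemma Lnorm_weight_eq tau r (E : set V) (f g : V -> R) : (forall x, E x -> f x = g x) ->
  Lnorm_weight tau r E f = Lnorm_weight tau r E g.
Proof. exact: (@eq_wnorm _ L R lam tau r E f g). Qed.

Lemma Lspace_weight_eq tau r (E : set V) (f g : V -> R) : (forall x, E x -> f x = g x) ->
  Lspace_weight tau r E f -> Lspace_weight tau r E g.
Proof.
move=> fg [mf ffin]; split; last by rewrite -(Lnorm_weight_eq tau r fg).
by apply: (@eq_measurable_fun _ _ _ _ _ (f : L -> R)) mf => x /set_mem; exact: fg.
Qed.

Lemma QH_approximable (Om : set V) p w tau Q (uk : (V -> R) * (V -> V)) (M : R) :
  open Om -> 1 < p -> p_admissible p Om w tau ->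
  structure_condition p Om w tau Q -> QH p tau Q Om uk ->
  (QHnorm p tau Q Om uk <= M%:E)%E ->
  approximable Om p w tau (M + 1) uk.1.
Proof.
case: uk => u k oOm p1 adm sQ [[mu _] [mk _] ap] uM.
apply: (sobolev_approximable oOm p1 adm sQ mu mk uM) => e e0.
by have [f [fO _] uf] := ap e e0; exists f.
Qed.

Lemma QH_closure_fin p tau Q (G : set V) F uk : QH_closure p tau Q G F uk ->
  exists2 M : R, 0 <= M & (QHnorm p tau Q G uk <= M%:E)%E.
Proof.
move=> [[_ u1] [_ u2] _].
have u0 : (0 <= QHnorm p tau Q G uk)%E by apply: adde_ge0; exact: poweR_ge0.
have fin : QHnorm p tau Q G uk \is a fin_num.
  by rewrite ge0_fin_numE//; exact: lte_add_pinfty.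
by exists (fine (QHnorm p tau Q G uk)); rewrite ?fineK ?fine_ge0.
Qed.

(** A common form of both embeddings: [g] is [f] up to values outside [E], so as to be
    defined and approximable on the whole of [Om]. *)
Lemma compactly_embedded_approximable (Om E : set V) p w tau r Cb q
    (X : set ((V -> R) * (V -> V))) (NX : (V -> R) * (V -> V) -> \bar R)
    (f g : (V -> R) * (V -> V) -> V -> R) :
  open Om -> bounded_set Om -> 1 < p -> p_admissible p Om w tau ->
  0 < Cb -> p < q ->
  (forall s r x, 0 < s -> s <= r -> Om x ->
    ((s / r)%:E * (wmeas tau (eball Om x s) / wmeas tau (eball Om x r)) `^ q^-1 <=
     Cb%:E * (wmeas w (eball Om x s) / wmeas w (eball Om x r)) `^ p^-1)%E) ->
  measurable (E : set L) -> compactly_inside E Om -> 1 <= r -> r < q ->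
  (forall uk, X uk -> exists2 M : R, 0 <= M & (NX uk <= M%:E)%E) ->
  (forall uk (M : R), X uk -> (NX uk <= M%:E)%E ->
     approximable Om p w tau (M + 1) (g uk)) ->
  (forall uk x, E x -> g uk x = f uk x) ->
  compactly_embedded X NX (Lspace_weight tau r E) (Lnorm_weight tau r E) f.
Proof.
move=> oOm bOm p1 adm Cb0 pq bal mE cE r1 rq Xfin Xap gf; split=> [uk Xuk|u Xu [M uM]].
  have [M M0 ukM] := Xfin uk Xuk; have M1 : 0 <= M + 1 by rewrite addr_ge0.
  have := approximable_Lspace oOm bOm p1 adm Cb0 pq bal mE cE r1 rq M1 (Xap _ _ Xuk ukM).
  exact: (Lspace_weight_eq (gf uk)).
have M1 : 0 <= `|M| + 1 by rewrite addr_ge0.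
have uap i : approximable Om p w tau (`|M| + 1) (g (u i)).
  by apply: Xap => //; apply: le_trans (uM i) _; rewrite lee_fin ler_norm.
have [phi hphi [y yE yd]] :=
  approximable_embedding oOm bOm p1 adm Cb0 pq bal mE cE r1 rq M1 uap.
exists phi; first exact: hphi.
exists y; first exact: yE.
have fg j : Lnorm_weight tau r E (f (u (phi j)) - y) =
            Lnorm_weight tau r E (g (u (phi j)) - y).
  by apply: Lnorm_weight_eq => x Ex; rewrite /GRing.add /= gf.
rewrite (funext fg); exact: yd.
Qed.

End embedding_theorem.

Theorem theorem1p8 (R : realType) (n : nat) (Om : set 'rV[R]_n.+1) (p : R)
    (w tau : 'rV[R]_n.+1 -> R) (Q : 'rV[R]_n.+1 -> 'M[R]_n.+1) :
  open Om -> connected Om -> bounded_set Om ->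
  1 < p ->
  p_admissible p Om w tau ->
  measurable_matrix Om Q ->
  (forall x, Om x -> psd (Q x)) ->
  structure_condition p Om w tau Q ->
  exists2 q : R, p < q & forall r : R, 1 <= r < q ->
    (forall E : set 'rV[R]_n.+1, open E -> compactly_inside E Om ->
       compactly_embedded (QH0 p tau Q E) (QHnorm p tau Q E)
         (Lspace_weight tau r E) (Lnorm_weight tau r E)
         (fun uk => uk.1)) /\
    (forall E : set 'rV[R]_n.+1, lebesgue_measurable E ->
       compactly_inside E Om ->
       compactly_embedded (QH p tau Q Om) (QHnorm p tau Q Om)
         (Lspace_weight tau r E) (Lnorm_weight tau r E)
         (fun uk => uk.1 \_ E)).
Proof.
move=> oOm _ bOm p1 adm _ _ sQ.
have [_ [_ _ [Cb [q [Cb0 pq bal]]]]] := adm.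
exists q; first exact: pq.
move=> r /andP[r1 rq].
have mOm := measurable_open oOm.
split=> E mE cE.
  have EO : E `<=` Om by exact: subset_trans (@subset_closure _ E) cE.2.
  apply: (@compactly_embedded_approximable R n Om E p w tau r Cb q _ _ _
    (fun uk => uk.1 \_ E) oOm bOm p1 adm Cb0 pq bal (measurable_open mE) cE r1 rq).
  - by move=> uk; exact: QH_closure_fin.
  - by move=> uk M; exact: zero_extension_approximable.
  - by move=> uk x Ex; rewrite patchE mem_set.
apply: (@compactly_embedded_approximable R n Om E p w tau r Cb q _ _ _
  (fun uk => uk.1) oOm bOm p1 adm Cb0 pq bal mE cE r1 rq).
- by move=> uk; exact: QH_closure_fin.
- by move=> uk M; exact: QH_approximable.
by move=> uk x Ex; rewrite patchE mem_set.
Qed.
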